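(* Let $H$ be a Hankel operator whose sigma-function $\sigma$ satisfies $\operatorname{supp}\sigma\subset[0,\infty)$ and $\sigma\in L^\infty(\mathbb{R}_+)$. Define $s(x)=\sigma(e^{-x})$, $x\in\mathbb{R}$, and set $$A=V\,\Phi\, S\,\Phi^*\,V,$$ where $S$ is the operator of multiplication by $s(x)$ in $L^2(\mathbb{R})$, $\Phi$ is the Fourier transform, and $V$ is the operator of multiplication by $v(\xi)=\sqrt{\pi}/\sqrt{\cosh(\pi\xi)}$ in $L^2(\mathbb{R})$. Then $$H=\mathbf{M}^*A\,\mathbf{M},$$ where $\mathbf{M}:L^2(\mathbb{R}_+)\to L^2(\mathbb{R})$ is the unitary operator $(\mathbf{M}f)(\xi)=e^{i\arg\Gamma(1/2+i\xi)}(Mf)(\xi)$ and $M$ is the Mellin transform $M=\Phi U$.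
   Context: $\mathbb{R}_+=(0,\infty)$. The Fourier transform is $(\Phi u)(\xi)=(2\pi)^{-1/2}\int_{-\infty}^\infty u(x)e^{-ix\xi}\,dx$. The unitary operator $U:L^2(\mathbb{R}_+)\to L^2(\mathbb{R})$ is $(Uf)(x)=e^{x/2}f(e^x)$. Note $|\Gamma(1/2+i\xi)|=v(\xi)$. The Hankel operator $H$ with kernel $h\in C_0^\infty(\mathbb{R}_+)'$ (continuous antilinear functionals; formally $(Hf)(t)=\int_0^\infty h(t+s)f(s)\,ds$) is defined by the form $(Hf_1,f_2)=\langle h,\bar f_1\star f_2\rangle$, $f_1,f_2\in C_0^\infty(\mathbb{R}_+)$, with $(\bar f_1\star f_2)(t)=\int_0^t\overline{f_1(s)}f_2(t-s)\,ds$ and $\langle h,F\rangle=\int h\overline F$ for functions $h$. Let $(\mathsf{L}f)(\lambda)=\int_0^\infty e^{-t\lambda}f(t)\,dt$ and $\mathcal{Y}=\mathsf{L}\,C_0^\infty(\mathbb{R}_+)$ (a space of entire functions, with the topology transported by $\mathsf{L}$); the sigma-function of $h$ is the unique $\sigma\in\mathcal{Y}'$ with $\langle h,F\rangle=\langle\sigma,\mathsf{L}F\rangle$ for all $F\in C_0^\infty(\mathbb{R}_+)$. The assumptions $\operatorname{supp}\sigma\subset[0,\infty)$, $\sigma\in L^\infty(\mathbb{R}_+)$ mean that $\langle\sigma,w\rangle=\int_0^\infty\sigma(\lambda)\overline{w(\lambda)}\,d\lambda$, $w\in\mathcal{Y}$, for a function $\sigma\in L^\infty(\mathbb{R}_+)$,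 i.e. $h(t)=\int_0^\infty e^{-t\lambda}\sigma(\lambda)\,d\lambda$; under these assumptions $H$ is bounded on $L^2(\mathbb{R}_+)$. *)

(* Defs.v *)
From HB Require Import structures.
From mathcomp Require Import all_boot all_order all_algebra.
From mathcomp Require Import complex.
From mathcomp Require Import all_classical all_reals all_analysis.

Set Implicit Arguments.
Unset Strict Implicit.
Unset Printing Implicit Defensive.

Import Order.TTheory GRing.Theory Num.Theory numFieldNormedType.Exports.

Local Open Scope classical_set_scope.
Local Open Scope complex_scope.
Local Open Scope ring_scope.

Section Defs.
Context {R : realType}.
Local Notation C := R[i].
Local Notation mu := (@lebesgue_measure R).

Definition Rpos : set R := `]0, +oo[.

Definition cabs (z : C) : R := Normc.normc z.

Definition cexp (z : C) : C :=
  (expR (complex.Re z) * cos (complex.Im z))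
    +i* (expR (complex.Re z) * sin (complex.Im z)).

(* Principal argument, in ]-pi, pi]; the value at 0 is irrelevant. *)
Definition carg (z : C) : R :=
  let a := acos (complex.Re z / cabs z) in
  if 0 <= complex.Im z then a else - a.

Definition cmeasurable_fun (D : set R) (f : R -> C) : Prop :=
  measurable_fun D (fun x => complex.Re (f x)) /\
  measurable_fun D (fun x => complex.Im (f x)).

Definition cintegral (D : set R) (f : R -> C) : C :=
  (\int[mu]_(x in D) complex.Re (f x)) +i* (\int[mu]_(x in D) complex.Im (f x)).

(* Euler's integral; it represents the Gamma function for Re z > 0. *)
Definition cGamma (z : C) : C :=
  cintegral Rpos (fun t => cexp ((z - 1) * (ln t)%:C - t%:C)).

(** * The spaces L^2(D) and their operators

    Elements of L^2(D) are represented by functions R -> C; only their values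
    on D matter, and equality in L^2(D) is equality almost everywhere on D. *)

Definition sqnorm2 (D : set R) (f : R -> C) : \bar R :=
  (\int[mu]_(x in D) (cabs (f x) ^+ 2)%:E)%E.

Definition L2 (D : set R) (f : R -> C) : Prop :=
  cmeasurable_fun D f /\ (sqnorm2 D f < +oo)%E.

(* Linear in the first argument, antilinear in the second. *)
Definition dotL2 (D : set R) (f g : R -> C) : C :=
  cintegral D (fun x => f x * (g x)^*).

Definition operator := (R -> C) -> (R -> C).

Definition linear_operator (D E : set R) (T : operator) : Prop :=
  [/\ forall f, L2 D f -> L2 E (T f),
      forall f g, L2 D f -> L2 D g ->
        f = g %[ae mu in D] -> T f = T g %[ae mu in E] &
      forall (a : C) f g, L2 D f -> L2 D g ->
        T (fun x => a * f x + g x) = (fun x => a * T f x + T g x)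
          %[ae mu in E]].

Definition bounded_operator (D E : set R) (T : operator) : Prop :=
  linear_operator D E T /\
  exists K : R, forall f, L2 D f ->
    (sqnorm2 E (T f) <= (K ^+ 2)%:E * sqnorm2 D f)%E.

Definition unitary_operator (D E : set R) (T : operator) : Prop :=
  [/\ linear_operator D E T,
      forall f, L2 D f -> sqnorm2 E (T f) = sqnorm2 D f &
      forall g, L2 E g -> exists2 f, L2 D f & T f = g %[ae mu in E]].

(* The adjoint L^2(E) -> L^2(D) of T : L^2(D) -> L^2(E); the defining relation
   determines its values up to equality almost everywhere on D. *)
Definition adjoint (D E : set R) (T : operator) : operator := fun g =>
  xget (fun=> 0) [set f | L2 D f /\
    forall u, L2 D u -> dotL2 E (T u) g = dotL2 D u f].

Definition mulop (m : R -> C) : operator := fun f x => m x * f x.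

(** * Fourier and Mellin transforms *)

Definition fourier_integral (D : set R) (u : R -> C) (xi : R) : C :=
  ((Num.sqrt (2 * pi))^-1)%:C *
  cintegral D (fun x => u x * cexp (0 +i* (- (x * xi)))).

(* On L^2(R) the Fourier integral is the limit in the mean of its truncations. *)
Definition fourier : operator := fun u =>
  xget (fun=> 0) [set g | L2 setT g /\
    (fun n : nat => sqnorm2 setT
       (fun xi => g xi - fourier_integral `[- n%:R, n%:R] u xi)) @ \oo --> 0%E].

Definition Uop : operator := fun f x => (expR (x / 2))%:C * f (expR x).

Definition mellin : operator := fourier \o Uop.

Definition bmellin : operator := fun f xi =>
  cexp (0 +i* carg (cGamma (2^-1 +i* xi))) * mellin f xi.

(** * Test functions and distributions on (0, oo) *)

Definition cderive1n (n : nat) (F : R -> C) (x : R) : C :=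
  derive1n n (fun y => complex.Re (F y)) x
    +i* derive1n n (fun y => complex.Im (F y)) x.

Definition smooth (F : R -> C) : Prop := forall (n : nat) (x : R),
  derivable (derive1n n (fun y => complex.Re (F y))) x 1 /\
  derivable (derive1n n (fun y => complex.Im (F y))) x 1.

Definition supported_in (a b : R) (F : R -> C) : Prop :=
  forall x, ~ (a <= x <= b) -> F x = 0.

(* C_0^oo(0, oo), its elements being extended by 0 to R. *)
Definition test_fun (F : R -> C) : Prop :=
  smooth F /\ exists a b : R, 0 < a /\ supported_in a b F.

Definition test_cvg (F_ : nat -> R -> C) (F : R -> C) : Prop :=
  (exists a b : R, 0 < a /\ forall n, supported_in a b (F_ n)) /\
  forall (k : nat) (e : R), 0 < e -> \forall n \near \oo,
    forall x, cabs (cderive1n k (F_ n) x - cderive1n k F x) <= e.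

(* For an antilinear functional on C_0^oo(0, oo), sequential continuity is
   equivalent to continuity. *)
Definition test_continuous (h : (R -> C) -> C) : Prop :=
  forall F_ F, (forall n, test_fun (F_ n)) -> test_fun F -> test_cvg F_ F ->
    (fun n => cabs (h (F_ n) - h F)) @ \oo --> (0 : R).

Definition antilinear_distribution (h : (R -> C) -> C) : Prop :=
  (forall (a : C) F G, test_fun F -> test_fun G ->
     h (fun t => a * F t + G t) = a^* * h F + h G) /\
  test_continuous h.

(** * The sigma-function *)

Definition laplace (F : R -> C) (z : C) : C :=
  cintegral Rpos (fun t => cexp (- (t%:C * z)) * F t).

Definition Yspace : set (C -> C) := laplace @` [set F | test_fun F].

(* The topology of Y being transported by the Laplace transform, continuity on
   Y is continuity on C_0^oo(0, oo) of the composition with that transform. *)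
Definition Ydual (sg : (C -> C) -> C) : Prop :=
  (forall (a : C) w1 w2, Yspace w1 -> Yspace w2 ->
     sg (fun z => a * w1 z + w2 z) = a^* * sg w1 + sg w2) /\
  test_continuous (sg \o laplace).

Definition sigma_function (h : (R -> C) -> C) (sg : (C -> C) -> C) : Prop :=
  Ydual sg /\ forall F, test_fun F -> h F = sg (laplace F).

Definition Linfty (D : set R) (f : R -> C) : Prop :=
  cmeasurable_fun D f /\
  exists K : R, {ae mu, forall x, D x -> cabs (f x) <= K}.

(* supp sg lies in [0, oo) and sg is the function sigma in L^oo(0, oo) *)
Definition represented_by (sg : (C -> C) -> C) (sigma : R -> C) : Prop :=
  Linfty Rpos sigma /\
  forall w, Yspace w ->
    sg w = cintegral Rpos (fun l => sigma l * (w l%:C)^*).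

(** * Hankel operators *)

Definition half_convolution (f g : R -> C) (t : R) : C :=
  cintegral `[0, t] (fun s => f s * g (t - s)).

Definition hankel_operator (h : (R -> C) -> C) (H : operator) : Prop :=
  bounded_operator Rpos Rpos H /\
  forall f1 f2, test_fun f1 -> test_fun f2 ->
    dotL2 Rpos (H f1) f2 = h (half_convolution (fun s => (f1 s)^*) f2).

(** * The operator A = V Phi S Phi^* V *)

Definition cosh (x : R) : R := (expR x + expR (- x)) / 2.

Definition vfun (xi : R) : C := (Num.sqrt pi / Num.sqrt (cosh (pi * xi)))%:C.

Definition Vop : operator := mulop vfun.

Definition Sop (sigma : R -> C) : operator :=
  mulop (fun x => sigma (expR (- x))).

Definition Aop (sigma : R -> C) : operator :=
  Vop \o fourier \o Sop sigma \o adjoint setT setT fourier \o Vop.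

End Defs.

(* Main.v *)
(* In the logarithmic variable l = e^{-x}, the weighted Laplace transform
   G_f(x) = e^{-x/2} (L f)(e^{-x}) is the convolution of U f with k(-x), where
   k(x) = e^{x/2 - e^x}, and the Fourier integral of k(-x) is Gamma(1/2 + i xi);
   hence Phi G_f = Gamma(1/2 + i xi) M f, which is V applied to the phase-modified
   Mellin transform of f because |Gamma(1/2 + i xi)| = v(xi). Since L turns the
   convolution into a product, (H f1, f2) = (S G_{f1}, G_{f2}), and Plancherel's
   theorem gives the factorization on test functions, hence everywhere by density.

   Plancherel: Abel summation of the inversion integral yields the Poisson kernel,
   so Phi is a contraction of L^1 n L^2 in the L^2 norm; the inversion formula then
   only has to be checked on indicators of intervals, where the norm of the
   transform is an explicit integral of arctangents.

   |Gamma(1/2 + i xi)|^2 is the Fourier integral of 1 / (2 cosh(x/2)), the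
   autocorrelation of k. Its value pi / cosh(pi xi) comes from moving the line of
   integration of e^{i xi z} / cosh(z/2) towards Im z = pi. *)

From HB Require Import structures.
Require Import Defs.
From mathcomp Require Import all_boot all_order all_algebra.
From mathcomp Require Import complex.
From mathcomp Require Import all_classical all_reals all_analysis.
From mathcomp Require Import measurable_realfun ring lra.

Set Implicit Arguments.
Unset Strict Implicit.
Unset Printing Implicit Defensive.

Import Order.TTheory GRing.Theory Num.Theory numFieldNormedType.Exports.

Local Open Scope classical_set_scope.
Local Open Scope complex_scope.
Local Open Scope ring_scope.

(** Both [fourier] and [adjoint] select a value by [xget] among functions fixed only almost
    everywhere. Nothing is known of them until existence is proved: completeness of L^2 provides the
    limit in the mean, surjectivity provides the adjoint, and every later identity holds up to a
    null set. The Poisson kernel yields only an inequality of norms. Once inversion is known on L^2,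
    it forces the isometry: the norm of f is that of its double transform, hence at most that of its
    transform. The pole of 1/cosh(z/2) at i pi forbids integrating along Im z = pi itself. On Im z =
    t < pi the real part of 1/cosh(z/2) has mass 2 pi for every t and concentrates at 0 with an
    explicit error proportional to cos(t/2); the imaginary part is eliminated by playing xi against
    - xi. Test functions are where sigma is accessible and where all Laplace and Fourier integrals
    converge absolutely. Boundedness carries the factorization over to L^2: for H it is part of the
    definition, for the model it holds because v and s are bounded. *)

Local Notation Re := complex.Re.
Local Notation Im := complex.Im.

(** * Change of variables *)

Section density.
Context d (T : measurableType d) (R : realType).
Variables (m : {measure set T -> \bar R}) (w : T -> R).

(** The proofs [mw] and [w0] are parameters of the term so that the measure structure built below
    can be inferred from it alone. *)
Definition dmeas (mw : measurable_fun setT w) (w0 : forall x, 0 <= w x)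
  (A : set T) : \bar R := (\int[m]_(x in A) (w x)%:E)%E.

Hypotheses (mw : measurable_fun setT w) (w0 : forall x, 0 <= w x).

Let emw : measurable_fun setT (EFin \o w).
Proof. exact/measurable_EFinP. Qed.


Local Notation mdens := (dmeas mw w0).

Let mdens0 : mdens set0 = 0%E. Proof. exact: integral_set0. Qed.

Let mdens_ge0 A : (0 <= mdens A)%E. Proof. by apply: integral_ge0 => x _; rewrite lee_fin. Qed.

Let mdens_sigma_additive : semi_sigma_additive mdens.
Proof.
move=> F mF tF mUF; rewrite /dmeas ge0_integral_bigcup//.
- apply: is_cvg_ereal_nneg_natsum_cond => n _ _.
  exact: mdens_ge0.
- exact: measurable_funTS.
- by move=> x _; rewrite lee_fin.
Qed.

HB.instance Definition _ := isMeasure.Build _ _ _ mdens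
  mdens0 mdens_ge0 mdens_sigma_additive.

Import HBNNSimple.

(** Monotone convergence along simple functions on both sides leaves multiples of indicators, where
    the equality is the definition of the weighted measure. *)
Lemma ge0_integral_mdens (f : T -> \bar R) : measurable_fun setT f ->
  (forall x, (0 <= f x)%E) ->
  (\int[mdens]_x f x = \int[m]_x (f x * (w x)%:E))%E.
Proof.
move=> mf f0.
pose f_ := nnsfun_approx measurableT mf.
have fnn : forall n : nat, measurable_fun [set: T] (fun x => (f_ n x)%:E).
  by move=> n; exact/measurable_EFinP/measurable_funTS.
transitivity (lim (\int[mdens]_x (f_ n x)%:E @[n --> \oo])%E).
  rewrite -monotone_convergence//=.
  - apply: eq_integral => ? /[!inE] xD; apply/esym/cvg_lim => //=.
    exact: cvg_nnsfun_approx.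
  - by move=> n ? _; rewrite lee_fin.
  - by move=> ? _ ? ? mn; rewrite lee_fin; exact/lefP/nd_nnsfun_approx.
rewrite [RHS](_ : _ = lim (\int[m]_x ((f_ n x)%:E * (w x)%:E) @[n --> \oo])%E); last first.
  rewrite -monotone_convergence//=.
  - apply: eq_integral => x /[!inE] xD; apply/esym/cvg_lim => //.
    apply: cvgeZr => //; exact: cvg_nnsfun_approx.
  - by move=> n; apply: emeasurable_funM.
  - by move=> n ? _; rewrite mule_ge0 ?lee_fin.
  - move=> x _ ? ? mn; apply: lee_wpmul2r; first by rewrite lee_fin.
    by rewrite lee_fin; exact/lefP/nd_nnsfun_approx.
apply: congr_lim; apply/funext => n /=.
under [LHS]eq_integral do rewrite fimfunE -fsumEFin//.
rewrite [LHS]ge0_integral_fsum//; last 2 first.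
  - by move=> r; exact/measurable_EFinP/measurableT_comp.
  - by move=> k x _; rewrite EFinM nnfun_muleindic_ge0.
under [RHS]eq_integral.
  move=> x xD; rewrite fimfunE -fsumEFin// ge0_mule_fsuml; last first.
    by move=> r; rewrite EFinM nnfun_muleindic_ge0.
  over.
rewrite [RHS]ge0_integral_fsum//; last 2 first.
  - move=> r; apply: emeasurable_funM => //; apply/measurable_EFinP.
    by apply: measurable_funM.
  - by move=> k x _; rewrite mule_ge0 ?lee_fin// -lee_fin EFinM nnfun_muleindic_ge0.
apply: eq_fsbigr => r _.
have mr : measurable (f_ n @^-1` [set r]).
  by rewrite -[X in measurable X]setTI; exact: measurable_funP.
have [r0|r0] := leP 0%R r; last first.
  rewrite preimage_nnfun0// [LHS]integral0_eq ?[RHS]integral0_eq//= => x _;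
    by rewrite indic0 mulr0 ?mul0e.
rewrite integralZl_indic_nnsfun//= integral_indic//= setIT.
rewrite /dmeas integral_mkcond -ge0_integralZl//; last 2 first.
- by apply/measurable_restrict => //; rewrite setTI; exact: measurable_funTS.
- by move=> x _; apply: erestrict_ge0 => y _; rewrite lee_fin.
apply: eq_integral => x _.
by rewrite EFinM -muleA patchE indicE; case: ifPn; rewrite ?mul1e ?mul0e.
Qed.

End density.

Section change_of_variables.
Context {R : realType}.
Local Notation mu := (@lebesgue_measure R).

(** Lebesgue measure is determined by its values on half-open intervals, which the last condition on
    [phi] and [w] supplies. The image under [phi] of the measure with density [w] lives on [D] only,
    so the restriction of [mu] to the complement of [D] is added before comparing. *)
Lemma ge0_integral_subst (phi w : R -> R) (D : set R) (f : R -> \bar R) :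
  measurable_fun setT phi -> measurable_fun setT w -> (forall x, 0 <= w x) ->
  measurable D -> (forall x, D (phi x)) ->
  (forall a b, a < b -> mu (`]a, b] `&` D) =
    (\int[mu]_(x in phi @^-1` `]a, b]) (w x)%:E)%E) ->
  measurable_fun D f -> (forall x, D x -> (0 <= f x)%E) ->
  (\int[mu]_(x in D) f x = \int[mu]_x (f (phi x) * (w x)%:E))%E.
Proof.
move=> mphi mw w0 mD phiD H mf f0.
pose m1' : {measure set (measurableTypeR R) -> \bar R} :=
  pushforward (dmeas mu mw w0) (phi : measurableTypeR R -> measurableTypeR R).
pose m1 := m1' mphi.
pose m2 : {measure set (measurableTypeR R) -> \bar R} := mrestr mu (measurableC mD).
pose m : {measure set (measurableTypeR R) -> \bar R} := measure_add m1 m2.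
have mE X : m X = (m1 X + m2 X)%E by exact: measure_addE.
have E A : measurable A -> mu A = m A.
  move=> mA; apply: lebesgue_measure_unique => // _ [[a b] _ <-].
  rewrite mE.
  rewrite (_ : m1 _ = \int[mu]_(x in phi @^-1` `]a, b]) (w x)%:E)%E//.
  rewrite (_ : m2 _ = mu (`]a, b] `&` ~` D))//.
  have [ab|ba] := ltP a b.
    rewrite -H// -measureU//; last 3 first.
    - exact: measurableI.
    - by apply: measurableI => //; exact: measurableC.
    - by rewrite setIACA setICr setI0.
    by rewrite -setIUr setUCr setIT.
  rewrite set_itv_ge ?bnd_simp -?leNgt// preimage_set0 integral_set0 set0I.
  by rewrite measure0 add0e.
rewrite (eq_measure_integral m1).
  rewrite ge0_integral_pushforward//; last by move=> x /[!inE]; exact: f0.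
  rewrite (_ : phi @^-1` D = setT); last first.
    by apply/seteqP; split => // x _; exact: phiD.
  have mfp : measurable_fun setT (f \o phi).
    apply: (measurable_comp mD) => //.
    by move=> _ [x _ <-].
  by rewrite ge0_integral_mdens//= => x; exact: f0.
move=> A mA AD; rewrite [LHS](E A mA) mE.
rewrite [X in (_ + X)%E](_ : _ = 0)%E ?adde0//.
rewrite (_ : m2 _ = mu (A `&` ~` D))//.
by rewrite (_ : A `&` ~` D = set0) ?measure0// -subset0 => x [/AD].
Qed.

Lemma ge0_integral_affine (s c : R) (f : R -> \bar R) : s = 1 \/ s = -1 ->
  measurable_fun setT f -> (forall x, (0 <= f x)%E) ->
  (\int[mu]_x f (s * x + c)%R = \int[mu]_x f x)%E.
Proof.
move=> s1 mf f0.
rewrite [RHS](@ge0_integral_subst (fun x => s * x + c) (cst 1))//.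
- by apply: eq_integral => x _; rewrite mule1.
- by apply: measurable_funD => //; apply: measurable_funM.
move=> a b ab; rewrite setIT.
rewrite [RHS](_ : _ = mu ((fun x : R => s * x + c) @^-1` `]a, b]%classic)); last first.
  rewrite -[RHS]mul1e -(integral_cst mu)//.
  rewrite -[X in measurable X]setTI.
  have H : measurable_fun setT (fun x => s * x + c).
    by apply: measurable_funD => //; apply: measurable_funM.
  exact: H.
case: s1 => ->.
  rewrite (_ : _ @^-1` _ = `]a - c, b - c]%classic).
    by rewrite !lebesgue_measure_itv/= !lte_fin ltrD2r -!EFinB opprB addrA subrK.
  by apply/seteqP; split => x /=; rewrite !in_itv/= mul1r ltrBlDr lerBrDr.
rewrite (_ : _ @^-1` _ = `[c - b, c - a[%classic).
  rewrite !lebesgue_measure_itv/= !lte_fin ltrD2l ltrN2 -!EFinB.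
  by case: ifP => // _; congr EFin; ring.
apply/seteqP; split => x /=; rewrite !in_itv/= mulN1r => /andP[h1 h2];
  apply/andP; split; lra.
Qed.

Lemma integral_expR_Ny (b : R) : (\int[mu]_(x in `]-oo, b]) (expR x)%:E = (expR b)%:E)%E.
Proof.
rewrite -(opprK b) ge0_integration_by_substitutionNy; last 2 first.
- by apply/continuous_subspaceT => x; exact: continuous_expR.
- by move=> x _; rewrite expR_ge0.
rewrite (@ge0_continuous_FTC2y _ _ (fun x => - expR (- x)) _ 0).
- by rewrite opprK sub0e -EFinN opprK.
- by move=> x _ /=; rewrite expR_ge0.
- apply/continuous_subspaceT => x.
  by apply: continuous_comp; [exact: opp_continuous|exact: continuous_expR].
- rewrite -oppr0; apply: cvgN; exact: cvgr_expR.
- by move=> x _; apply: ex_derive.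
- apply: cvg_at_right_filter; apply: cvgN.
  apply: (@continuous_comp _ _ _ -%R expR); first exact: opp_continuous.
  exact: continuous_expR.
- move=> x _; rewrite derive1E; apply: derive_val => /=.
  by apply: is_derive_eq; rewrite /GRing.scale/=; ring.
Qed.

Lemma ge0_integral_expR (f : R -> \bar R) :
  measurable_fun Rpos f -> (forall x, Rpos x -> (0 <= f x)%E) ->
  (\int[mu]_(x in Rpos) f x = \int[mu]_x (f (expR x) * (expR x)%:E))%E.
Proof.
move=> mf f0; apply: ge0_integral_subst => //.
- by rewrite /Rpos.
- by move=> x; rewrite /Rpos/= in_itv/= expR_gt0.
move=> a b ab.
(* Only intervals with left end 0 are computed; []a, b]] with [0 < a] is then a difference of two of
   them. *)
have H0 (t : R) : 0 < t ->
    mu (`]0%R, t]) = (\int[mu]_(x in expR @^-1` `]0%R, t])  (expR x)%:E)%E.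
  move=> t0; rewrite lebesgue_measure_itv/= lte_fin t0 -EFinB subr0.
  rewrite (_ : _ @^-1` _ = `]-oo, ln t]%classic) ?integral_expR_Ny ?lnK ?posrE//.
  by apply/seteqP; split => x /=; rewrite !in_itv/= expR_gt0/= -[x <= ln t]ler_expR lnK.
have [b0|b0] := leP b 0.
  rewrite (_ : _ `&` _ = set0) ?measure0; last first.
    by rewrite -subset0 => x [] /=; rewrite /Rpos/= !in_itv/= andbT; lra.
  rewrite (_ : _ @^-1` _ = set0) ?integral_set0//.
  rewrite -subset0 => x /=; rewrite !in_itv/= => /andP[_].
  by have := expR_gt0 x; lra.
have [a0|a0] := leP a 0.
  rewrite (_ : _ `&` _ = `]0, b]%classic) ?H0//.
    congr integral; apply/seteqP; split => x /=; rewrite !in_itv/= ?expR_gt0//=;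
      by have := expR_gt0 x; lra.
  by apply/seteqP; split => x /=; rewrite /Rpos/= !in_itv/=; lra.
rewrite (_ : _ `&` _ = `]a, b]%classic); last first.
  by apply/seteqP; split => x /=; rewrite /Rpos/= !in_itv/=; lra.
have mI (u v : R) : measurable (expR @^-1` `]u, v] : set R).
  by rewrite -[X in measurable X]setTI; exact: measurable_expR.
have := H0 b b0.
rewrite (_ : `]0, b] = `]0, a] `|` `]a, b])%classic; last first.
  by apply/seteqP; split => x /=; rewrite !in_itv/=; lra.
rewrite measureU//; last first.
  by rewrite -subset0 => x [] /=; rewrite !in_itv/=; lra.
rewrite preimage_setU ge0_integral_setU//=; last 4 first.
- exact: mI.
- exact: mI.
- by apply: measurable_funTS; apply/measurable_EFinP; exact: measurable_expR.
- by apply/disj_setPS => x [] /=; rewrite !in_itv/=; lra.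
rewrite -H0// => /(congr1 (fun z => z - mu `]0%R, a])%E).
rewrite !(addeC (mu `]0%R, a]))%E !addeK//; rewrite lebesgue_measure_itv/=; case: ifP => //.
Qed.

End change_of_variables.

(** * Complex-valued integrals *)

Section complex_numbers.
Context {R : realType}.
Notation C := R[i].
Implicit Types z w : C.

Lemma complexP z w : Re z = Re w -> Im z = Im w -> z = w.
Proof. by case: z w => [a b] [c d] /= -> ->. Qed.

Lemma ReD z w : Re (z + w) = Re z + Re w. Proof. by case: z w => [? ?] [? ?]. Qed.
Lemma ImD z w : Im (z + w) = Im z + Im w. Proof. by case: z w => [? ?] [? ?]. Qed.
Lemma ReN z : Re (- z) = - Re z. Proof. by case: z. Qed.
Lemma ImN z : Im (- z) = - Im z. Proof. by case: z. Qed.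
Lemma ReM z w : Re (z * w) = Re z * Re w - Im z * Im w.
Proof. by case: z w => [? ?] [? ?]. Qed.
Lemma ImM z w : Im (z * w) = Re z * Im w + Im z * Re w.
Proof. by case: z w => [? ?] [? ?]. Qed.
Lemma ReJ z : Re (z^*)%R = Re z. Proof. by case: z. Qed.
Lemma ImJ z : Im (z^*)%R = - Im z. Proof. by case: z. Qed.
Lemma ReC (x : R) : Re x%:C = x. Proof. by []. Qed.
Lemma ImC (x : R) : Im x%:C = 0. Proof. by []. Qed.
Definition ReImE := (ReD, ImD, ReN, ImN, ReM, ImM, ReJ, ImJ).

Lemma conjcR (x : R) : (x%:C)^* = x%:C.
Proof. by apply: complexP; rewrite !ReImE ?ImC ?oppr0. Qed.

Lemma cabs_ge0 z : 0 <= cabs z.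
Proof. by case: z => a b; exact: sqrtr_ge0. Qed.

Lemma sqr_cabs z : cabs z ^+ 2 = Re z ^+ 2 + Im z ^+ 2.
Proof. by case: z => a b; rewrite /cabs /= sqr_sqrtr// addr_ge0// sqr_ge0. Qed.

Lemma cabsM z w : cabs (z * w) = cabs z * cabs w.
Proof. exact: Normc.normcM. Qed.

Lemma cabs_eq0 z : cabs z = 0 -> z = 0.
Proof. exact: Normc.eq0_normc. Qed.

Lemma cabs0 : cabs 0 = 0 :> R.
Proof. by rewrite /cabs Normc.normc0. Qed.

Lemma cabsJ z : cabs (z^*) = cabs z.
Proof. by case: z => a b; rewrite /cabs/= sqrrN. Qed.

Lemma cabsN z : cabs (- z) = cabs z.
Proof. by case: z => a b; rewrite /cabs/= !sqrrN. Qed.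

Lemma cabsC (x : R) : cabs x%:C = `|x|.
Proof. by rewrite /cabs/= expr0n addr0 sqrtr_sqr. Qed.

Lemma normr_cabs z : `|z| = (cabs z)%:C.
Proof. by case: z. Qed.

Lemma cabsD z w : cabs (z + w) <= cabs z + cabs w.
Proof. by rewrite -lecR rmorphD/= -!normr_cabs ler_normD. Qed.

Lemma ler_dist_cabs z w : `|cabs z - cabs w| <= cabs (z - w).
Proof.
have H (u v : C) : cabs u <= cabs v + cabs (u - v).
  by have := cabsD v (u - v); rewrite subrKC.
have := H z w; have := H w z; rewrite -(cabsN (w - z)) opprB ler_norml; lra.
Qed.

Lemma le_normRe z : `|Re z| <= cabs z.
Proof.
by case: z => a b; rewrite /cabs/= -sqrtr_sqr ler_wsqrtr// lerDl sqr_ge0.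
Qed.

Lemma le_normIm z : `|Im z| <= cabs z.
Proof.
by case: z => a b; rewrite /cabs/= -sqrtr_sqr ler_wsqrtr// lerDr sqr_ge0.
Qed.

Lemma le_cabs_ReIm z : cabs z <= `|Re z| + `|Im z|.
Proof.
rewrite -(@ler_pXn2r _ 2%N)// ?nnegrE ?addr_ge0 ?cabs_ge0// sqr_cabs sqrrD.
by rewrite !real_normK ?num_real// addrAC lerDl mulrn_wge0// mulr_ge0.
Qed.

Lemma mulcJ z : z * z^* = (cabs z ^+ 2)%:C.
Proof. by apply: complexP; rewrite !ReImE/= ?sqr_cabs; ring. Qed.

Lemma cexpD z w : cexp (z + w) = cexp z * cexp w.
Proof.
by apply: complexP; rewrite !ReImE /cexp/= !ReImE expRD ?cosD ?sinD; ring.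
Qed.

Lemma cabs_cexp z : cabs (cexp z) = expR (Re z).
Proof.
rewrite /cabs/cexp/= !exprMn -mulrDr cos2Dsin2 mulr1 sqrtr_sqr.
by rewrite ger0_norm// expR_ge0.
Qed.

Lemma cexpJ z : (cexp z)^* = cexp (z^*).
Proof.
by apply: complexP; rewrite ReImE /cexp/= !ReImE ?cosN ?sinN; ring.
Qed.

Lemma cexpC (x : R) : cexp x%:C = (expR x)%:C.
Proof. by apply: complexP; rewrite /cexp/= ?cos0 ?sin0 ?mulr1 ?mulr0. Qed.

End complex_numbers.

Section complex_measurable.
Context {R : realType} d (T : measurableType d).
Notation C := R[i].
Variable D : set T.
Implicit Types f g : T -> C.

(** Agrees with [cmeasurable_fun] on the line, but makes sense on any measurable space, as Fubini on
    the plane requires. *)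
Definition cmeas f := measurable_fun D (fun x => Re (f x)) /\
  measurable_fun D (fun x => Im (f x)).

Lemma cmeas_cst (c : C) : cmeas (fun=> c).
Proof. by split; exact: measurable_cst. Qed.

Lemma cmeasD f g : cmeas f -> cmeas g -> cmeas (fun x => f x + g x).
Proof.
by move=> [? ?] [? ?]; split; under eq_fun do rewrite ReImE;
  exact: measurable_funD.
Qed.

Lemma cmeasN f : cmeas f -> cmeas (fun x => - f x).
Proof.
by move=> [? ?]; split; under eq_fun do rewrite ReImE;
  exact: measurableT_comp.
Qed.

Lemma cmeasB f g : cmeas f -> cmeas g -> cmeas (fun x => f x - g x).
Proof. by move=> ? ?; apply: cmeasD => //; exact: cmeasN. Qed.

Lemma cmeasM f g : cmeas f -> cmeas g -> cmeas (fun x => f x * g x).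
Proof.
move=> [? ?] [? ?]; split; under eq_fun do rewrite ReImE.
  by apply: measurable_funB; exact: measurable_funM.
by apply: measurable_funD; exact: measurable_funM.
Qed.

Lemma cmeasJ f : cmeas f -> cmeas (fun x => (f x)^*).
Proof.
move=> [mr mi]; split; under eq_fun do rewrite ReImE; first exact: mr.
exact: measurableT_comp.
Qed.

Lemma cmeas_real (u : T -> R) : measurable_fun D u -> cmeas (fun x => (u x)%:C).
Proof. by move=> ?; split => //=; exact: measurable_cst. Qed.

Lemma measurable_cabs f : cmeas f -> measurable_fun D (fun x => cabs (f x)).
Proof.
move=> [mr mi].
rewrite (_ : (fun x => _) = Num.sqrt \o (fun x => Re (f x) ^+ 2 + Im (f x) ^+ 2)).
  apply: measurableT_comp => //; first exact: (continuous_measurable_fun (@sqrt_continuous R)).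
  by apply: measurable_funD; exact: measurable_funX.
by apply/funext => x /=; rewrite -sqr_cabs sqrtr_sqr ger0_norm ?cabs_ge0.
Qed.

Lemma cmeas_cexp f : cmeas f -> cmeas (fun x => cexp (f x)).
Proof.
move=> [mr mi]; rewrite /cexp; split => /=; apply: measurable_funM;
  apply: measurableT_comp => //.
- exact: (continuous_measurable_fun (@continuous_cos R)).
- exact: (continuous_measurable_fun (@continuous_sin R)).
Qed.

End complex_measurable.
Lemma cmeas_comp (R : realType) d d' (T : measurableType d) (T' : measurableType d')
    (f : T -> R[i]) (phi : T' -> T) :
  cmeas setT f -> measurable_fun setT phi -> cmeas setT (f \o phi).
Proof. by move=> [? ?] ?; split; exact: (measurableT_comp (f := fun x => _ (f x))). Qed.

Section complex_integral.
Context {R : realType} d (T : measurableType d) (m : {measure set T -> \bar R}).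
Notation C := R[i].
Variable D : set T.
Hypothesis mD : measurable D.
Implicit Types f g : T -> C.

Definition cintegrable f :=
  cmeas D f /\ m.-integrable D (fun x => (cabs (f x))%:E).

(** Convertible to [cintegral] for Lebesgue measure, so that the lemmas below apply to [dotL2] and
    [cGamma] as they stand. *)
Definition cInt f : C := (\int[m]_(x in D) Re (f x)) +i* (\int[m]_(x in D) Im (f x)).

Lemma Re_cInt f : Re (cInt f) = \int[m]_(x in D) Re (f x). Proof. by []. Qed.

Lemma Im_cInt f : Im (cInt f) = \int[m]_(x in D) Im (f x). Proof. by []. Qed.

Lemma le_cintegrable f (g : T -> R) : cmeas D f ->
  (forall x, D x -> cabs (f x) <= g x) -> m.-integrable D (EFin \o g) ->
  cintegrable f.
Proof.
move=> mf fg ig; split => //; apply: le_integrable ig => //.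
  by apply/measurable_EFinP; exact: measurable_cabs.
move=> x Dx /=; rewrite lee_fin ger0_norm ?cabs_ge0//.
by rewrite (le_trans (fg _ Dx))// ler_norm.
Qed.

Lemma cintegrable_Re f : cintegrable f -> m.-integrable D (fun x => (Re (f x))%:E).
Proof.
move=> [[mr mi] itf]; apply: le_integrable itf => //; first exact/measurable_EFinP.
by move=> x Dx; rewrite lee_fin (ger0_norm (cabs_ge0 _)) le_normRe.
Qed.

Lemma cintegrable_Im f : cintegrable f -> m.-integrable D (fun x => (Im (f x))%:E).
Proof.
move=> [[mr mi] itf]; apply: le_integrable itf => //; first exact/measurable_EFinP.
by move=> x Dx; rewrite lee_fin (ger0_norm (cabs_ge0 _)) le_normIm.
Qed.

Lemma cintegrableD f g : cintegrable f -> cintegrable g ->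
  cintegrable (fun x => f x + g x).
Proof.
move=> [mf itf] [mg itg].
apply: (@le_cintegrable _ (fun x => cabs (f x) + cabs (g x))).
- exact: cmeasD.
- by move=> x _; exact: cabsD.
- by rewrite /comp; under eq_fun do rewrite EFinD; exact: integrableD.
Qed.

Lemma cintegrable_bM f g (K : R) : cmeas D g -> (forall x, D x -> cabs (g x) <= K) ->
  cintegrable f -> cintegrable (fun x => g x * f x).
Proof.
move=> mg gK [mf itf]; apply: (@le_cintegrable _ (fun x => K * cabs (f x))).
- exact: cmeasM.
- by move=> x Dx; rewrite cabsM ler_wpM2r ?cabs_ge0 ?gK.
- by rewrite /comp; under eq_fun do rewrite EFinM; exact: integrableZl.
Qed.

Lemma cintegrableZ (c : C) f : cintegrable f -> cintegrable (fun x => c * f x).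
Proof. by apply: (@cintegrable_bM _ _ (cabs c)); [exact: cmeas_cst|]. Qed.

Lemma cintegrableN f : cintegrable f -> cintegrable (fun x => - f x).
Proof. by move=> /(cintegrableZ (-1)); under eq_fun do rewrite mulN1r. Qed.

Lemma cintegrableB f g : cintegrable f -> cintegrable g ->
  cintegrable (fun x => f x - g x).
Proof. by move=> ? ?; apply: cintegrableD => //; exact: cintegrableN. Qed.

Lemma cintegrableJ f : cintegrable f -> cintegrable (fun x => (f x)^*).
Proof.
move=> [mf itf]; split; first exact: cmeasJ.
by under eq_fun do rewrite cabsJ.
Qed.

Lemma eq_cInt f g : (forall x, D x -> f x = g x) -> cInt f = cInt g.
Proof.
by move=> fg; congr (_ +i* _); apply: eq_Rintegral => x /[!inE] Dx; rewrite fg.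
Qed.

Lemma cIntD f g : cintegrable f -> cintegrable g ->
  cInt (fun x => f x + g x) = cInt f + cInt g.
Proof.
move=> itf itg; apply: complexP; rewrite ReImE ?Re_cInt ?Im_cInt.
  under eq_Rintegral do rewrite ReImE.
  by rewrite RintegralD//; exact: cintegrable_Re.
under eq_Rintegral do rewrite ReImE.
by rewrite RintegralD//; exact: cintegrable_Im.
Qed.

Lemma cIntZ (c : C) f : cintegrable f -> cInt (fun x => c * f x) = c * cInt f.
Proof.
move=> itf; have ir := cintegrable_Re itf; have ii := cintegrable_Im itf.
have Z (k : R) h : m.-integrable D (fun x => (h x)%:E) ->
    m.-integrable D (EFin \o (fun x => k * h x)).
  by move=> ih; rewrite /comp; under eq_fun do rewrite EFinM; exact: integrableZl.
apply: complexP; rewrite ReImE ?Re_cInt ?Im_cInt.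
  under eq_Rintegral do rewrite ReImE.
  by rewrite RintegralB ?RintegralZl//; exact: Z.
under eq_Rintegral do rewrite ReImE.
by rewrite RintegralD ?RintegralZl//; exact: Z.
Qed.

Lemma cIntZr (c : C) f : cintegrable f -> cInt (fun x => f x * c) = cInt f * c.
Proof. by move=> itf; under eq_fun do rewrite mulrC; rewrite cIntZ// mulrC. Qed.

Lemma cIntN f : cintegrable f -> cInt (fun x => - f x) = - cInt f.
Proof. by move=> itf; under eq_fun do rewrite -mulN1r; rewrite cIntZ// mulN1r. Qed.

Lemma cIntB f g : cintegrable f -> cintegrable g ->
  cInt (fun x => f x - g x) = cInt f - cInt g.
Proof. by move=> ? ?; rewrite cIntD ?cIntN//; exact: cintegrableN. Qed.

Lemma cIntJ f : cintegrable f -> cInt (fun x => (f x)^*) = (cInt f)^*.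
Proof.
move=> itf; apply: complexP; rewrite ReImE ?Re_cInt ?Im_cInt; under eq_Rintegral do rewrite ReImE.
  by [].
under eq_Rintegral do rewrite -mulN1r.
by rewrite RintegralZl ?mulN1r//; exact: cintegrable_Im.
Qed.

Lemma le_cabs_cInt f : cintegrable f -> cabs (cInt f) <= \int[m]_(x in D) cabs (f x).
Proof.
move=> itf; have [->|nz] := eqVneq (cInt f) 0.
  by rewrite cabs0 Rintegral_ge0// => x _; exact: cabs_ge0.
pose z := cInt f; have z0 : 0 < cabs z.
  by rewrite lt_neqAle cabs_ge0 andbT eq_sym; apply: contra_neq nz => /cabs_eq0.
(* multiply by a unit complex number so that the integral becomes real *)
pose c := z^* * ((cabs z)^-1)%:C.
have c1 : cabs c = 1.
  by rewrite cabsM cabsJ cabsC ger0_norm ?invr_ge0 ?cabs_ge0// mulfV ?gt_eqF.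
have <- : Re (cInt (fun x => c * f x)) = cabs (cInt f).
  rewrite cIntZ// -/z mulrAC mulrC (mulrC z^*) mulcJ -rmorphM/=.
  by rewrite expr2 mulKf ?gt_eqF.
rewrite /cInt/=; apply: le_Rintegral => //.
- by apply: cintegrable_Re; exact: cintegrableZ.
- by case: itf.
move=> x Dx; rewrite (le_trans (ler_norm _))//.
by rewrite (le_trans (le_normRe _))// cabsM c1 mul1r.
Qed.

Lemma ae_eq_cInt f g : cmeas D f -> cmeas D g -> ae_eq m D f g -> cInt f = cInt g.
Proof.
move=> [fr fi] [gr gi] fg; rewrite /cInt /Rintegral; congr (fine _ +i* fine _);
  apply: ae_eq_integral => //; try (by apply/measurable_EFinP);
  by apply: filterS fg => x /= H Dx; rewrite H.
Qed.

End complex_integral.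

(** * Substitution and Fubini for signed and complex functions *)

Section real_fubini_subst.
Context {R : realType}.
Local Notation RT := (measurableTypeR R).
Local Notation mu := (@lebesgue_measure R).

Lemma integral_affine (s c : R) (f : R -> \bar R) : s = 1 \/ s = -1 ->
  measurable_fun setT f -> (\int[mu]_x f (s * x + c)%R = \int[mu]_x f x)%E.
Proof.
move=> s1 mf; rewrite integralE [RHS]integralE.
rewrite -(ge0_integral_affine c s1 (measurable_funepos mf))//.
rewrite -(ge0_integral_affine c s1 (measurable_funeneg mf))//.
have Ep : (fun x => f (s * x + c)%R)^\+%E = (fun x => f^\+ (s * x + c)%R)%E.
  exact: (funepos_comp f (fun x => s * x + c)).
have En : (fun x => f (s * x + c)%R)^\-%E = (fun x => f^\- (s * x + c)%R)%E.
  exact: (funeneg_comp f (fun x => s * x + c)).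
by rewrite Ep En.
Qed.

Lemma Rintegral_affine (s c : R) (f : R -> R) : s = 1 \/ s = -1 ->
  measurable_fun setT f -> \int[mu]_x f (s * x + c) = \int[mu]_x f x.
Proof.
move=> s1 mf; congr fine; apply: (@integral_affine s c (EFin \o f)) => //.
exact/measurable_EFinP.
Qed.

Lemma integral_expR (f : R -> \bar R) : measurable_fun Rpos f ->
  (\int[mu]_(x in Rpos) f x = \int[mu]_x (f (expR x) * (expR x)%:E))%E.
Proof.
move=> mf; rewrite integralE [RHS]integralE.
rewrite !ge0_integral_expR//; last 2 first.
- exact: measurable_funeneg.
- exact: measurable_funepos.
have e0 (x : R) : (0 <= (expR x)%:E)%E by rewrite lee_fin expR_ge0.
congr (_ - _)%E; apply: eq_integral => x _.
  by rewrite !funeposE maxe_pMl// mul0e.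
by rewrite !funenegE -mulNe maxe_pMl// mul0e.
Qed.

Lemma Rintegral_expR (f : R -> R) : measurable_fun Rpos f ->
  \int[mu]_(x in Rpos) f x = \int[mu]_x (f (expR x) * expR x).
Proof.
move=> mf; congr fine; rewrite (@integral_expR (EFin \o f))//.
exact/measurable_EFinP.
Qed.

Lemma Rfubini (f : RT * RT -> R) : (mu \x mu)%E.-integrable setT (EFin \o f) ->
  [/\ mu.-integrable setT (fun x => (\int[mu]_y f (x, y))%:E),
      mu.-integrable setT (fun y => (\int[mu]_x f (x, y))%:E) &
      \int[mu]_x \int[mu]_y f (x, y) = \int[mu]_y \int[mu]_x f (x, y)].
Proof.
move=> itf.
have iF := integrable_fubini_F itf.
have := integrable_fubini_F (f := EFin \o f \o (fun z => (z.2, z.1))) (m1 := mu) (m2 := mu).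
rewrite /fubini_F/=.
have mf := measurable_int _ itf.
move=> iG0.
have iG : mu.-integrable setT (fun y => \int[mu]_x (f (x, y))%:E)%E.
  apply: iG0; apply/integrable21ltyP.
    apply: (measurableT_comp mf).
    by apply/measurable_fun_pairP; split => /=; [exact: measurable_snd|exact: measurable_fst].
  have /(integrable12ltyP mu mu mf) H := itf.
  exact: H.
move=> {iG0}.
(* An inner integral may be infinite on a null set, where [fine] turns it into 0; neither
   integrability nor the integral is affected. *)
have key (G : R -> \bar R) : mu.-integrable setT G ->
    mu.-integrable setT (fun x => (fine (G x))%:E) /\
    (\int[mu]_x (fine (G x))%:E = \int[mu]_x G x)%E.
  move=> itG; have mG := measurable_int _ itG.
  have mfG : measurable_fun setT (fun x => (fine (G x))%:E).
    by apply/measurable_EFinP; apply: measurableT_comp => //; exact: measurable_fine.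
  split.
    apply: le_integrable itG => // x _.
    by case: (G x) => [r| |] //=; rewrite normr0 leey.
  apply: ae_eq_integral => //.
  by apply: filterS (integrable_ae measurableT itG) => x H _; rewrite fineK ?H.
have [iF1 EF] := key _ iF; have [iG1 EG] := key _ iG.
split=> //; rewrite /Rintegral [in LHS]EF [in RHS]EG.
by congr fine; exact: (Fubini itf).
Qed.

End real_fubini_subst.

Section complex_fubini_subst.
Context {R : realType}.
Local Notation mu := (@lebesgue_measure R).
Local Notation C := R[i].
Local Notation RT := (measurableTypeR R).

Lemma cInt_affine (s c : R) (f : R -> C) : s = 1 \/ s = -1 -> cmeas setT f ->
  cInt mu setT (fun x => f (s * x + c)) = cInt mu setT f.
Proof.
move=> s1 [mr mi]; apply: complexP; rewrite ?Re_cInt ?Im_cInt.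
  exact: (Rintegral_affine c s1 mr).
exact: (Rintegral_affine c s1 mi).
Qed.

Lemma measurable_affine (s c : R) : measurable_fun setT (fun x : R => s * x + c).
Proof. by apply: measurable_funD => //; apply: measurable_funM. Qed.

Lemma cintegrable_affine (s c : R) (f : R -> C) : s = 1 \/ s = -1 ->
  cintegrable mu setT f -> cintegrable mu setT (fun x => f (s * x + c)).
Proof.
move=> s1 [mf itf]; split.
  exact: (cmeas_comp mf (measurable_affine s c)).
have := itf => /integrableP[mcf lt].
apply/integrableP; split.
  exact: (measurableT_comp mcf (measurable_affine s c)).
rewrite (integral_affine c s1 (f := fun x => `|(cabs (f x))%:E|%E))//.
exact: measurableT_comp.
Qed.

Lemma measurable_Rpos : measurable (@Rpos R).
Proof. by rewrite /Rpos. Qed.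

Lemma measurable_RposEx (f : R -> R) : measurable_fun Rpos f ->
  measurable_fun setT (fun x => f (expR x)).
Proof.
move=> mf; apply: (measurable_comp measurable_Rpos _ mf) => //.
by move=> _ [x _ <-]; rewrite /Rpos/= in_itv/= expR_gt0.
Qed.

Lemma cmeas_expR (f : R -> C) : cmeas Rpos f -> cmeas setT (fun x => f (expR x)).
Proof.
by move=> [mr mi]; split; [exact: (measurable_RposEx mr)|exact: (measurable_RposEx mi)].
Qed.

Lemma cInt_expR (f : R -> C) : cmeas Rpos f ->
  cInt mu Rpos f = cInt mu setT (fun x => (expR x)%:C * f (expR x)).
Proof.
move=> [mr mi]; apply: complexP; rewrite ?Re_cInt ?Im_cInt Rintegral_expR//;
  by apply: eq_Rintegral => x _; rewrite ReImE/= mul0r ?subr0 ?addr0 mulrC.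
Qed.

Lemma cfubini (f : RT * RT -> C) : cintegrable (mu \x mu)%E setT f ->
  [/\ cintegrable mu setT (fun x => cInt mu setT (fun y => f (x, y))),
      cintegrable mu setT (fun y => cInt mu setT (fun x => f (x, y))) &
      cInt mu setT (fun x => cInt mu setT (fun y => f (x, y))) =
      cInt mu setT (fun y => cInt mu setT (fun x => f (x, y)))].
Proof.
move=> itf.
have [r1 r2 r3] := Rfubini (cintegrable_Re measurableT itf).
have [i1 i2 i3] := Rfubini (cintegrable_Im measurableT itf).
have key (u v : R -> R) : mu.-integrable setT (EFin \o u) ->
    mu.-integrable setT (EFin \o v) -> cintegrable mu setT (fun x => u x +i* v x).
  move=> iu iv.
  apply: (le_cintegrable (T := RT) (m := mu) measurableT (g := fun x => `|u x| + `|v x|)).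
  - by split => /=; [move: (measurable_int _ iu)|move: (measurable_int _ iv)] =>
      /measurable_EFinP.
  - by move=> x _; exact: le_cabs_ReIm.
  - rewrite /comp; under eq_fun do rewrite EFinD.
    by apply: integrableD => //; exact: (integrable_abse (f := EFin \o _)).
split; [exact: key|exact: key|].
by apply: complexP; rewrite ?Re_cInt ?Im_cInt.
Qed.

Lemma cintegrable_prod12 (f : RT * RT -> C) : cmeas setT f ->
  (\int[mu]_x \int[mu]_y (cabs (f (x, y)))%:E < +oo)%E ->
  cintegrable (mu \x mu)%E setT f.
Proof.
move=> mf lt; split => //; apply/integrable12ltyP.
  by apply/measurable_EFinP; exact: measurable_cabs.
under eq_integral => x _.
  under eq_integral => y _ do rewrite gee0_abs ?lee_fin ?cabs_ge0//.
  over.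
exact: lt.
Qed.

Lemma cintegrable_prod21 (f : RT * RT -> C) : cmeas setT f ->
  (\int[mu]_y \int[mu]_x (cabs (f (x, y)))%:E < +oo)%E ->
  cintegrable (mu \x mu)%E setT f.
Proof.
move=> mf lt; split => //; apply/integrable21ltyP.
  by apply/measurable_EFinP; exact: measurable_cabs.
under eq_integral => x _.
  under eq_integral => y _ do rewrite gee0_abs ?lee_fin ?cabs_ge0//.
  over.
exact: lt.
Qed.

Lemma cmeas_fst (f : R -> C) : cmeas setT f -> cmeas setT (fun z : RT * RT => f z.1).
Proof. by move=> mf; exact: (cmeas_comp mf measurable_fst). Qed.

Lemma cmeas_snd (f : R -> C) : cmeas setT f -> cmeas setT (fun z : RT * RT => f z.2).
Proof. by move=> mf; exact: (cmeas_comp mf measurable_snd). Qed.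

Lemma cintegrable_mulfs (f g : R -> C) (k : RT * RT -> C) (K : R) :
  cintegrable mu setT f -> cintegrable mu setT g -> cmeas setT k ->
  (forall z, cabs (k z) <= K) ->
  cintegrable (mu \x mu)%E setT (fun z => k z * (f z.1 * g z.2)).
Proof.
move=> [mf itf] [mg itg] mk kK.
apply: (cintegrable_bM measurableT mk (K := K)) => //.
apply: cintegrable_prod12.
  by apply: cmeasM; [exact: cmeas_fst|exact: cmeas_snd].
have mcf : measurable_fun setT (fun x => (cabs (f x))%:E).
  exact: measurable_int itf.
have mcg : measurable_fun setT (fun x => (cabs (g x))%:E).
  exact: measurable_int itg.
have f0 x : (0 <= (cabs (f x))%:E)%E by rewrite lee_fin cabs_ge0.
have g0 x : (0 <= (cabs (g x))%:E)%E by rewrite lee_fin cabs_ge0.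
have E : (fun x : RT => \int[mu]_y (cabs (f x * g y))%:E)%E =
    (fun x : RT => (cabs (f x))%:E * (\int[mu]_y (cabs (g y))%:E))%E.
  apply/funext => x; rewrite -ge0_integralZl//.
  by apply: eq_integral => y _; rewrite -EFinM cabsM.
rewrite /= [X in (integral _ _ X < _)%E]E.
rewrite ge0_integralZr//; last by apply: integral_ge0.
have fin (u : R -> C) : mu.-integrable setT (fun x => (cabs (u x))%:E) ->
    (\int[mu]_x (cabs (u x))%:E < +oo)%E.
  move=> /integrableP[mu_ lt]; apply: le_lt_trans lt.
  by apply: ge0_le_integral => //; [move=> x _; rewrite lee_fin cabs_ge0|
    exact: measurableT_comp|move=> x _; exact: lee_abs].
rewrite lte_mul_pinfty ?fin//; first by apply: integral_ge0.
by rewrite ge0_fin_numE ?fin//; apply: integral_ge0.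
Qed.

(** The integrand is dominated by K |f(x)| |g(y)|, whose integral over the plane is a product.
    Applied with [k] an exponential of modulus 1. *)
Lemma fubini_kernel (f g : R -> C) (k : RT * RT -> C) (K : R) :
  cintegrable mu setT f -> cintegrable mu setT g -> cmeas setT k ->
  (forall z, cabs (k z) <= K) ->
  [/\ cintegrable mu setT (fun x => f x * cInt mu setT (fun y : RT => k (x, y) * g y)),
      cintegrable mu setT (fun y => g y * cInt mu setT (fun x : RT => k (x, y) * f x)) &
      cInt mu setT (fun x => f x * cInt mu setT (fun y : RT => k (x, y) * g y)) =
      cInt mu setT (fun y => g y * cInt mu setT (fun x : RT => k (x, y) * f x))].
Proof.
move=> itf itg mk kK.
have ik := cintegrable_mulfs itf itg mk kK.
have m1 (x : RT) : cmeas setT (fun y : RT => k (x, y)).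
  by apply: (cmeas_comp (phi := fun y : RT => (x, y)) mk); exact: measurable_pair1.
have m2 (y : RT) : cmeas setT (fun x : RT => k (x, y)).
  by apply: (cmeas_comp (phi := fun x : RT => (x, y)) mk); exact: measurable_pair2.
have E1 : (fun x : RT => cInt mu setT (fun y : RT => k (x, y) * (f x * g y))) =
    (fun x : RT => f x * cInt mu setT (fun y : RT => k (x, y) * g y)).
  apply/funext => x; rewrite -(cIntZ (T := RT) measurableT).
    by apply: eq_cInt => y _; ring.
  exact: (cintegrable_bM (T := RT) measurableT (m1 x) (fun y _ => kK (x, y)) itg).
have E2 : (fun y : RT => cInt mu setT (fun x : RT => k (x, y) * (f x * g y))) =
    (fun y : RT => g y * cInt mu setT (fun x : RT => k (x, y) * f x)).
  apply/funext => y; rewrite -(cIntZ (T := RT) measurableT).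
    by apply: eq_cInt => x _; ring.
  exact: (cintegrable_bM (T := RT) measurableT (m2 y) (fun x _ => kK (x, y)) itf).
have [i1 i2 e] := cfubini ik.
rewrite -E1 -E2; split; [exact: i1|exact: i2|exact: e].
Qed.

End complex_fubini_subst.

(** * The spaces L^2 *)

Section almost_everywhere.
Context {R : realType}.
Local Notation mu := (@lebesgue_measure R).
Implicit Types P Q S : R -> Prop.

Lemma ae_imply P Q : (forall x, P x -> Q x) ->
  {ae mu, forall x, P x} -> {ae mu, forall x, Q x}.
Proof.
by move=> PQ [N [mN N0 sub]]; exists N; split => // x nQ; apply: sub => /PQ.
Qed.

Lemma ae_imply2 P Q S : (forall x, P x -> Q x -> S x) ->
  {ae mu, forall x, P x} -> {ae mu, forall x, Q x} -> {ae mu, forall x, S x}.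
Proof.
move=> PQS [N [mN N0 sub]] [M [mM M0 subM]]; exists (N `|` M); split.
- exact: measurableU.
- exact: null_set_setU.
- move=> x nS; have [Px|nP] := pselect (P x); last by left; exact: sub.
  by right; apply: subM => Qx; apply: nS; exact: PQS.
Qed.

End almost_everywhere.

Section L2_theory.
Context {R : realType}.
Local Notation mu := (@lebesgue_measure R).
Local Notation C := R[i].
Local Notation RT := (measurableTypeR R).
Variable D : set RT.
Hypothesis mD : measurable D.
Implicit Types f g h : R -> C.

(** Real-valued counterpart of [sqnorm2], for algebra; on L^2 the passage through [fine] loses
    nothing, see [sqnorm2E]. *)
Definition nrm2 f : R := \int[mu]_(x in D) (cabs (f x) ^+ 2).

Lemma measurable_cabs2 f : cmeas (D : set RT) f ->
  measurable_fun D (fun x => (cabs (f x) ^+ 2)%:E).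
Proof.
move=> mf; apply/measurable_EFinP; apply: measurable_funX.
exact: (measurable_cabs mf).
Qed.

Lemma sqnorm2_ge0 f : (0 <= sqnorm2 D f)%E.
Proof. by apply: integral_ge0 => x _; rewrite lee_fin sqr_ge0. Qed.

Lemma L2P f : L2 D f <->
  cmeas D f /\ mu.-integrable D (fun x => (cabs (f x) ^+ 2)%:E).
Proof.
split=> [[mf lt]|[mf /integrableP[_ lt]]]; split => //.
  apply/integrableP; split; first exact: measurable_cabs2.
  apply: le_lt_trans lt; rewrite le_eqVlt; apply/orP; left; apply/eqP.
  by apply: eq_integral => x _; rewrite gee0_abs// lee_fin sqr_ge0.
apply: le_lt_trans lt; rewrite le_eqVlt; apply/orP; left; apply/eqP.
by apply: eq_integral => x _; rewrite gee0_abs// lee_fin sqr_ge0.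
Qed.

Lemma L2_cmeas f : L2 D f -> cmeas D f. Proof. by case. Qed.

Lemma L2_int f : L2 D f -> mu.-integrable D (EFin \o (fun x => cabs (f x) ^+ 2)).
Proof. by move/L2P => []. Qed.

Lemma sqnorm2E f : L2 D f -> sqnorm2 D f = (nrm2 f)%:E.
Proof.
move=> Lf; rewrite /nrm2 /Rintegral fineK//.
exact: integrable_fin_num (L2_int Lf).
Qed.

Lemma nrm2_ge0 f : 0 <= nrm2 f.
Proof. by apply: Rintegral_ge0 => x _; exact: sqr_ge0. Qed.

Lemma le_L2 f (g : R -> R) : cmeas (D : set RT) f ->
  (forall x, D x -> cabs (f x) ^+ 2 <= g x) ->
  mu.-integrable D (EFin \o g) -> L2 D f.
Proof.
move=> mf fg ig; apply/L2P; split => //.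
apply: (le_integrable mD _ _ ig); first exact: measurable_cabs2.
by move=> x Dx; rewrite lee_fin ger0_norm ?sqr_ge0// (le_trans (fg _ Dx))// ler_norm.
Qed.

Lemma sqr_cabsD (z w : C) : cabs (z + w) ^+ 2 <= 2 * cabs z ^+ 2 + 2 * cabs w ^+ 2.
Proof.
by rewrite !sqr_cabs !ReImE; have := sqr_ge0 (Re z - Re w);
  have := sqr_ge0 (Im z - Im w); rewrite !expr2; nra.
Qed.

Lemma L2D f g : L2 D f -> L2 D g -> L2 D (fun x => f x + g x).
Proof.
move=> Lf Lg.
apply: (@le_L2 _ (fun x => 2 * cabs (f x) ^+ 2 + 2 * cabs (g x) ^+ 2)).
- exact: cmeasD (L2_cmeas Lf) (L2_cmeas Lg).
- by move=> x _; exact: sqr_cabsD.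
- rewrite /comp; under eq_fun do rewrite EFinD !EFinM.
  by apply: integrableD => //; apply: integrableZl => //; exact: L2_int.
Qed.

Lemma L2_bM f g (K : R) : cmeas (D : set RT) g -> (forall x, D x -> cabs (g x) <= K) ->
  L2 D f -> L2 D (fun x => g x * f x).
Proof.
move=> mg gK Lf; apply: (@le_L2 _ (fun x => K ^+ 2 * cabs (f x) ^+ 2)).
- exact: cmeasM mg (L2_cmeas Lf).
- move=> x Dx; rewrite cabsM exprMn ler_wpM2r ?sqr_ge0//.
  by rewrite lerXn2r ?nnegrE ?cabs_ge0 ?gK// (le_trans (cabs_ge0 (g x)) (gK _ Dx)).
- rewrite /comp; under eq_fun do rewrite EFinM.
  by apply: integrableZl => //; exact: L2_int.
Qed.

Lemma L2Z (c : C) f : L2 D f -> L2 D (fun x => c * f x).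
Proof. by apply: (@L2_bM _ _ (cabs c)); [exact: cmeas_cst|]. Qed.

Lemma L2N f : L2 D f -> L2 D (fun x => - f x).
Proof. by move=> /(L2Z (-1)); under eq_fun do rewrite mulN1r. Qed.

Lemma L2B f g : L2 D f -> L2 D g -> L2 D (fun x => f x - g x).
Proof. by move=> Lf /L2N; exact: L2D. Qed.

Lemma L2J f : L2 D f -> L2 D (fun x => (f x)^*).
Proof.
move=> Lf; apply: (@le_L2 _ (fun x => cabs (f x) ^+ 2)).
- exact: cmeasJ (L2_cmeas Lf).
- by move=> x _; rewrite cabsJ.
- exact: L2_int.
Qed.

Lemma L20 : L2 D (fun=> 0 : C).
Proof.
apply: (@le_L2 _ (cst 0)); first exact: cmeas_cst.
  by move=> x _; rewrite cabs0 expr0n.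
exact: integrable0.
Qed.

Lemma cintegrable_L2M f g : L2 D f -> L2 D g -> cintegrable mu D (fun x => f x * g x).
Proof.
move=> Lf Lg.
apply: (le_cintegrable (T := RT) mD (g := fun x => cabs (f x) ^+ 2 + cabs (g x) ^+ 2)).
- exact: cmeasM (L2_cmeas Lf) (L2_cmeas Lg).
- move=> x _; rewrite cabsM; have := sqr_ge0 (cabs (f x) - cabs (g x)).
  by have := cabs_ge0 (f x); have := cabs_ge0 (g x); rewrite !expr2; nra.
- rewrite /comp; under eq_fun do rewrite EFinD.
  by apply: integrableD => //; exact: L2_int.
Qed.

Lemma cintegrable_dot f g : L2 D f -> L2 D g -> cintegrable mu D (fun x => f x * (g x)^*).
Proof. by move=> Lf /L2J; exact: cintegrable_L2M. Qed.

Lemma dotDl f g h : L2 D f -> L2 D g -> L2 D h ->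
  dotL2 D (fun x => f x + g x) h = dotL2 D f h + dotL2 D g h.
Proof.
move=> Lf Lg Lh; rewrite /dotL2; under eq_fun do rewrite mulrDl.
by apply: (cIntD (T := RT) mD); exact: cintegrable_dot.
Qed.

Lemma dotZl (c : C) f h : L2 D f -> L2 D h ->
  dotL2 D (fun x => c * f x) h = c * dotL2 D f h.
Proof.
move=> Lf Lh; rewrite /dotL2; under eq_fun do rewrite -mulrA.
by apply: (cIntZ (T := RT) mD); exact: cintegrable_dot.
Qed.

Lemma dotC f g : L2 D f -> L2 D g -> dotL2 D g f = (dotL2 D f g)^*.
Proof.
move=> Lf Lg; rewrite /dotL2.
have H := cIntJ (T := RT) mD (cintegrable_dot Lf Lg).
apply: etrans H; apply: (eq_cInt (T := RT)) => x _.
by rewrite rmorphM/= conjCK mulrC.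
Qed.

Lemma dotBl f g h : L2 D f -> L2 D g -> L2 D h ->
  dotL2 D (fun x => f x - g x) h = dotL2 D f h - dotL2 D g h.
Proof.
move=> Lf Lg Lh; under eq_fun do rewrite -mulN1r.
by rewrite dotDl ?dotZl ?mulN1r//; exact: L2Z.
Qed.

Lemma dotDr f g h : L2 D f -> L2 D g -> L2 D h ->
  dotL2 D h (fun x => f x + g x) = dotL2 D h f + dotL2 D h g.
Proof.
move=> Lf Lg Lh; rewrite dotC ?dotDl//; last exact: L2D.
by rewrite rmorphD/= -!dotC.
Qed.

Lemma dotZr (c : C) f h : L2 D f -> L2 D h ->
  dotL2 D h (fun x => c * f x) = c^* * dotL2 D h f.
Proof.
move=> Lf Lh; rewrite dotC ?dotZl//; last exact: L2Z.
by rewrite rmorphM/= -dotC.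
Qed.

Lemma dotBr f g h : L2 D f -> L2 D g -> L2 D h ->
  dotL2 D h (fun x => f x - g x) = dotL2 D h f - dotL2 D h g.
Proof.
move=> Lf Lg Lh; rewrite dotC ?dotBl//; last exact: L2B.
by rewrite rmorphB/= -!dotC.
Qed.

Lemma dotff f : dotL2 D f f = (nrm2 f)%:C.
Proof.
rewrite /dotL2/nrm2; under eq_fun do rewrite mulcJ.
apply: complexP => //=.
by under eq_Rintegral do rewrite /=; rewrite Rintegral_cst// mul0r.
Qed.

Lemma nrm2D f g : L2 D f -> L2 D g ->
  nrm2 (fun x => f x + g x) = nrm2 f + nrm2 g + 2 * Re (dotL2 D f g).
Proof.
move=> Lf Lg; have := dotff (fun x => f x + g x).
rewrite dotDl ?dotDr//; [|exact: L2D..].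
rewrite (dotC Lf Lg) !dotff => /(congr1 (@complex.Re R)).
by rewrite !ReImE !ReC => <-; ring.
Qed.

Lemma nrm2Z (c : C) f : L2 D f -> nrm2 (fun x => c * f x) = cabs c ^+ 2 * nrm2 f.
Proof.
move=> Lf; have := dotff (fun x => c * f x).
rewrite dotZl ?dotZr//; last exact: L2Z.
by rewrite mulrA mulcJ dotff -rmorphM/= => /complexI.
Qed.

Lemma nrm2N f : L2 D f -> nrm2 (fun x => - f x) = nrm2 f.
Proof.
move=> Lf; under eq_fun do rewrite -mulN1r; rewrite nrm2Z//.
by rewrite cabsN /cabs Normc.normc1 expr1n mul1r.
Qed.

Lemma nrm2B f g : L2 D f -> L2 D g ->
  nrm2 (fun x => f x - g x) = nrm2 f + nrm2 g - 2 * Re (dotL2 D f g).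
Proof.
move=> Lf Lg; rewrite nrm2D//; last exact: L2N.
rewrite nrm2N// -mulN1r.
have -> : dotL2 D f (fun x => - g x) = - dotL2 D f g.
  by under eq_fun do rewrite -mulN1r; rewrite dotZr// rmorphN rmorph1 mulN1r.
by rewrite ReImE; ring.
Qed.

Lemma nrm2B_sym f g : nrm2 (fun x => f x - g x) = nrm2 (fun x => g x - f x).
Proof.
by apply: eq_Rintegral => x _; rewrite -cabsN opprB.
Qed.

Lemma cauchy_schwarz f g : L2 D f -> L2 D g ->
  cabs (dotL2 D f g) ^+ 2 <= nrm2 f * nrm2 g.
Proof.
move=> Lf Lg; set z := dotL2 D f g.
(* ||  ng f - <f, g> g ||^2 >= 0 *)
have [ng0|ng0] := eqVneq (nrm2 g) 0; last first.
  have Lzg := L2Z z Lg; have Lnf := L2Z (nrm2 g)%:C Lf.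
  have := nrm2_ge0 (fun x => (nrm2 g)%:C * f x - z * g x).
  rewrite nrm2B// !nrm2Z// cabsC dotZl// dotZr// -/z.
  rewrite (mulrC z^*) mulcJ -rmorphM/= real_normK ?num_real//.
  have := nrm2_ge0 g; rewrite le_eqVlt eq_sym (negbTE ng0)/= => n0 H.
  rewrite -(ler_pM2l n0); move: H; rewrite !expr2; nra.
rewrite ng0 mulr0.
(* When [g] has norm 0 the quadratic |f - t z g|^2 >= 0 degenerates to a linear bound valid for all
   [t], which forces z = 0; the value of [t] used below makes the left side [nrm2 f + 1]. *)
have H (t : R) : 2 * t * cabs z ^+ 2 <= nrm2 f.
  have Lzg := L2Z (t%:C * z) Lg.
  have := nrm2_ge0 (fun x => f x - (t%:C * z) * g x).
  rewrite nrm2B// nrm2Z// ng0 dotZr// -/z mulr0 addr0.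
  have -> : (t%:C * z)^* * z = (t * cabs z ^+ 2)%:C.
    have -> : (t%:C * z)^* = t%:C * z^*.
      by rewrite rmorphM; congr (_ * _); apply: complexP; rewrite !ReImE ?ImC ?oppr0.
    by rewrite -mulrA (mulrC _ z) mulcJ -rmorphM.
  by rewrite ReC; nra.
rewrite leNgt; apply/negP => z0.
have := H ((nrm2 f + 1) / (2 * cabs z ^+ 2)).
rewrite (_ : 2 * _ * _ = nrm2 f + 1); last by field; apply/eqP => zz; move: z0; rewrite zz expr0n ltxx.
lra.
Qed.

Definition nrm f : R := Num.sqrt (nrm2 f).

Lemma nrm_ge0 f : 0 <= nrm f. Proof. exact: sqrtr_ge0. Qed.

Lemma sqr_nrm f : nrm f ^+ 2 = nrm2 f.
Proof. by rewrite sqr_sqrtr// nrm2_ge0. Qed.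

Lemma le_cabs_dot f g : L2 D f -> L2 D g -> cabs (dotL2 D f g) <= nrm f * nrm g.
Proof.
move=> Lf Lg; rewrite -(@ler_pXn2r _ 2%N)// ?nnegrE ?cabs_ge0 ?mulr_ge0 ?nrm_ge0//.
by rewrite exprMn !sqr_nrm cauchy_schwarz.
Qed.

Lemma le_nrmD f g : L2 D f -> L2 D g -> nrm (fun x => f x + g x) <= nrm f + nrm g.
Proof.
move=> Lf Lg; rewrite -(@ler_pXn2r _ 2%N)// ?nnegrE ?addr_ge0 ?nrm_ge0//.
rewrite sqrrD !sqr_nrm nrm2D//.
have := le_trans (ler_norm _) (le_trans (le_normRe (dotL2 D f g)) (le_cabs_dot Lf Lg)).
rewrite mulr2n; lra.
Qed.

Lemma nrmZ (c : C) f : L2 D f -> nrm (fun x => c * f x) = cabs c * nrm f.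
Proof.
move=> Lf; rewrite /nrm nrm2Z// sqrtrM ?sqr_ge0// sqrtr_sqr.
by rewrite ger0_norm ?cabs_ge0.
Qed.

Lemma nrmB_sym f g : nrm (fun x => f x - g x) = nrm (fun x => g x - f x).
Proof. by rewrite /nrm nrm2B_sym. Qed.

Lemma le_nrmB3 f g h : L2 D f -> L2 D g -> L2 D h ->
  nrm (fun x => f x - h x) <= nrm (fun x => f x - g x) + nrm (fun x => g x - h x).
Proof.
move=> Lf Lg Lh; rewrite [leLHS](_ : _ = nrm (fun x => (f x - g x) + (g x - h x))).
  by apply: le_nrmD; exact: L2B.
by congr nrm; apply/funext => x; rewrite subrKA.
Qed.

Lemma nrm2_eq0 f : L2 D f -> nrm2 f = 0 -> f = (fun=> 0) %[ae mu in D].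
Proof.
move=> Lf f0.
have : (\int[mu]_(x in D) `|(cabs (f x) ^+ 2)%:E| = 0)%E.
  transitivity (sqnorm2 D f); last by rewrite sqnorm2E ?f0.
  by apply: eq_integral => x _; rewrite gee0_abs// lee_fin sqr_ge0.
move/(ae_eq_integral_abs mu mD (measurable_cabs2 (L2_cmeas Lf))).
apply: filterS => x /= H Dx; have := H Dx.
by move=> [] /eqP; rewrite sqrf_eq0 => /eqP /cabs_eq0.
Qed.

Lemma ae_eq_nrm2 f g : L2 D f -> L2 D g -> f = g %[ae mu in D] -> nrm2 f = nrm2 g.
Proof.
move=> Lf Lg fg; congr fine; apply: ae_eq_integral => //.
- exact: measurable_cabs2 (L2_cmeas Lf).
- exact: measurable_cabs2 (L2_cmeas Lg).
by apply: filterS fg => x /= H Dx; rewrite H.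
Qed.

Lemma ae_eq_dot f f' g g' : L2 D f -> L2 D f' -> L2 D g -> L2 D g' ->
  f = f' %[ae mu in D] -> g = g' %[ae mu in D] -> dotL2 D f g = dotL2 D f' g'.
Proof.
move=> Lf Lf' Lg Lg' ff' gg'.
apply: (ae_eq_cInt (T := RT) mD).
- by have [] := cintegrable_dot Lf Lg.
- by have [] := cintegrable_dot Lf' Lg'.
by apply: filterS2 ff' gg' => x H1 H2 Dx; rewrite H1// H2.
Qed.

Lemma nrm2B_eq0 f g : L2 D f -> L2 D g -> nrm2 (fun x => f x - g x) = 0 ->
  f = g %[ae mu in D].
Proof.
move=> Lf Lg /(nrm2_eq0 (L2B Lf Lg)).
by apply: filterS => x /= H Dx; apply/eqP; rewrite -subr_eq0 H.
Qed.

Lemma ae_eq_nrm2B f g : L2 D f -> L2 D g -> f = g %[ae mu in D] ->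
  nrm2 (fun x => f x - g x) = 0.
Proof.
move=> Lf Lg fg; rewrite (@ae_eq_nrm2 _ (fun=> 0)).
- by rewrite /nrm2; under eq_Rintegral do rewrite cabs0 expr0n; rewrite Rintegral_cst// mul0r.
- exact: L2B.
- exact: L20.
- by apply: filterS fg => x /= H Dx; rewrite H// subrr.
Qed.

End L2_theory.

(** * Dominated convergence and completeness in L^2 *)

Section L2_dct.
Context {R : realType}.
Local Notation mu := (@lebesgue_measure R).
Local Notation C := R[i].
Local Notation RT := (measurableTypeR R).

Lemma nrm_dct (D : set RT) (f_ : nat -> R -> C) (f : R -> C) (G : R -> R) :
  measurable D -> (forall n, cmeas D (f_ n)) -> cmeas D f ->
  (forall x, D x -> cabs (f x - f_ n x) @[n --> \oo] --> (0 : R)) ->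
  (forall n x, D x -> cabs (f x - f_ n x) ^+ 2 <= G x) ->
  mu.-integrable D (EFin \o G) ->
  nrm D (fun x => f x - f_ n x) @[n --> \oo] --> (0 : R).
Proof.
move=> mD mf_ mf cf fG iG.
rewrite -[0]sqrtr0.
apply: (@continuous_cvg _ _ _ _ _ (fun n => nrm2 D (fun x => f x - f_ n x)) Num.sqrt).
  exact: sqrt_continuous.
have := @dominated_cvg _ RT R mu D mD
  (fun n x => (cabs (f x - f_ n x) ^+ 2)%:E) (cst 0%E) (EFin \o G).
rewrite integral_cst// mul0e => H; apply: fine_cvg; apply: H.
- by move=> n; apply: measurable_cabs2; apply: cmeasB.
- move=> x Dx; rewrite /cst; apply: cvg_EFin; first by apply: nearW.
  have := cf _ Dx; move=> /(fun h => cvgM h h); rewrite mulr0.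
  by apply: cvg_trans; apply: near_eq_cvg; apply: nearW => n.
- by [].
- by [].
- by move=> n x Dx; rewrite gee0_abs ?lee_fin ?sqr_ge0// fG.
Qed.

Lemma cvg_geometric_increments (a : nat -> R) (c : R) :
  (forall k, `|a k.+1 - a k| <= c * 2^-1 ^+ k) -> cvgn a.
Proof.
move=> H.
have c1 : cvgn (series (fun k => a k.+1 - a k)).
  apply: normed_cvg.
  apply: (@series_le_cvg _ _ (geometric c 2^-1)) => //.
  - by move=> n; exact: normr_ge0.
  - by move=> n; apply: le_trans (H n); exact: normr_ge0.
  - by apply: is_cvg_geometric_series; rewrite ger0_norm//; lra.
have -> : a = (fun n => series (fun k => a k.+1 - a k) n + a 0%N).
  apply/funext => n; rewrite /series/= telescope_sumr//.
  by rewrite subrK.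
by apply: is_cvgD => //; exact: is_cvg_cst.
Qed.

End L2_dct.

Section L2_complete.
Context {R : realType}.
Local Notation mu := (@lebesgue_measure R).
Local Notation C := R[i].
Local Notation RT := (measurableTypeR R).
Variable F : nat -> R -> C.

(* Completeness follows the usual Riesz--Fischer scheme; the weights 4^k make
   a.e. finiteness of one series give geometric decay of the increments. *)
Lemma rapidly_cauchy_ae_cvg (d := fun k x => F k.+1 x - F k x) :
  (forall n, L2 setT (F n)) ->
  (forall k, nrm2 setT (d k) <= 8^-1 ^+ k) ->
  {ae mu, forall x, exists c : R, forall k, cabs (d k x) <= c * 2^-1 ^+ k}.
Proof.
move=> LF Hd.
have Ld k : L2 setT (d k) by exact: L2B.
pose s n (x : RT) := \sum_(0 <= k < n) (4 ^+ k * cabs (d k x) ^+ 2).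
have ms n : measurable_fun setT (s n).
  apply: measurable_sum => k; apply: measurable_funM => //.
  by apply: measurable_funX; apply: measurable_cabs; exact: L2_cmeas.
have s0 n x : 0 <= s n x.
  by apply: sumr_ge0 => k _; rewrite mulr_ge0 ?sqr_ge0// exprn_ge0.
have nds x : {homo (fun n => (s n x)%:E) : n m / (n <= m)%N >-> (n <= m)%E}.
  move=> n m nm; rewrite lee_fin /s [leRHS](big_cat_nat _ (n := n))//= lerDl.
  by apply: sumr_ge0 => k _; rewrite mulr_ge0 ?sqr_ge0// exprn_ge0.
(* The weights leave 4^k 8^-k = 2^-k, whose partial sums stay below 2. *)
have ints n : (\int[mu]_x (s n x)%:E <= 2%:E)%E.
  rewrite /s; under eq_integral do rewrite -sumEFin.
  rewrite ge0_integral_sum//; last 2 first.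
  - move=> k; apply/measurable_EFinP; apply: measurable_funM => //.
    by apply: measurable_funX; apply: measurable_cabs; exact: L2_cmeas.
  - by move=> k x _; rewrite lee_fin mulr_ge0 ?sqr_ge0// exprn_ge0.
  rewrite (eq_bigr (fun k => (4 ^+ k * nrm2 setT (d k))%:E)); last first.
    move=> k _; under eq_integral do rewrite EFinM.
    rewrite ge0_integralZl//.
    - by rewrite EFinM -sqnorm2E.
    - by apply: measurable_cabs2; exact: L2_cmeas.
    - by move=> x _; rewrite lee_fin sqr_ge0.
  rewrite sumEFin lee_fin.
  apply: (@le_trans _ _ (\sum_(0 <= k < n) 2^-1 ^+ k)).
    apply: ler_sum => k _; apply: le_trans (ler_wpM2l _ (Hd k)) _.
      by rewrite exprn_ge0.
    by rewrite -exprMn (_ : 4 * 8^-1 = 2^-1 :> R)//; lra.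
  have -> : \sum_(0 <= k < n) 2^-1 ^+ k = 2 - 2 * 2^-1 ^+ n :> R.
    elim: n => [|n IH]; first by rewrite big_geq// expr0; lra.
    by rewrite big_nat_recr//= IH exprS; lra.
  by rewrite gerBl mulr_ge0// exprn_ge0// invr_ge0.
pose S x := ereal_sup (range (fun n => (s n x)%:E)).
have cS x : (s n x)%:E @[n --> \oo] --> S x by exact: ereal_nondecreasing_cvgn.
have mS : measurable_fun setT S.
  by apply: (emeasurable_fun_cvg (fun n x => (s n x)%:E)) => // n; exact/measurable_EFinP.
have S0 x : (0 <= S x)%E.
  apply: le_trans (ereal_sup_ubound _); last by exists 0%N.
  by rewrite lee_fin s0.
have iS : mu.-integrable setT S.
  apply/integrableP; split => //.
  under eq_integral do rewrite gee0_abs//.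
  have H : (\int[mu]_x (s n x)%:E)%E @[n --> \oo] --> (\int[mu]_x S x)%E.
    rewrite (_ : S = fun x => limn (fun n => (s n x)%:E)).
      apply: cvg_monotone_convergence => //.
      - by move=> n; exact/measurable_EFinP.
      - by move=> n x _; rewrite lee_fin.
    by apply/funext => x; apply/esym/cvg_lim.
  apply: (@le_lt_trans _ _ 2%:E); last by rewrite ltry.
  rewrite -(cvg_lim _ H)//; apply: lime_le; first by apply/cvg_ex; eexists; exact: H.
  exact: nearW.
(* Where [S x] is finite, each term 4^k |d_k(x)|^2 is at most [S x]; hence the constant is the
   square root of [S x]. *)
apply: filterS (integrable_ae measurableT iS) => x /(_ Logic.I) Sx.
have sS n : s n x <= fine (S x).
  by rewrite -lee_fin fineK//; apply: ereal_sup_ubound; exists n.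
exists (Num.sqrt (fine (S x))) => k.
have S0' : 0 <= fine (S x) by exact: fine_ge0.
rewrite -(@ler_pXn2r _ 2%N)// ?nnegrE ?cabs_ge0// ?mulr_ge0 ?sqrtr_ge0 ?exprn_ge0//; last first.
rewrite exprMn sqr_sqrtr// exprAC (_ : 2^-1 ^+ 2 = 4^-1); last by rewrite expr2; lra.
have := sS k.+1; rewrite /s big_nat_recr//= => H.
have {H} : 4 ^+ k * cabs (d k x) ^+ 2 <= fine (S x).
  by apply: le_trans H; rewrite lerDr; exact: (s0 k x).
by rewrite exprVn ler_pdivlMr ?exprn_gt0// mulrC.
Qed.

End L2_complete.

Section L2_complete2.
Context {R : realType}.
Local Notation mu := (@lebesgue_measure R).
Local Notation C := R[i].
Local Notation RT := (measurableTypeR R).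

(** Fatou's lemma needs no dominating function. The conclusion is about the extended [sqnorm2]
    because membership of [g] in L^2 is what it serves to establish. *)
Lemma nrm_fatou (F : nat -> R -> C) (g : R -> C) (c : R) :
  (forall n, L2 setT (F n)) -> cmeas (setT : set RT) g ->
  {ae mu, forall x, cabs (F n x - g x) @[n --> \oo] --> (0 : R)} ->
  (forall n, nrm2 setT (F n) <= c) -> (sqnorm2 setT g <= c%:E)%E.
Proof.
move=> LF mg cF Fc.
have mF n : measurable_fun (setT : set RT) (fun x => (cabs (F n x) ^+ 2)%:E).
  by apply: measurable_cabs2; exact: L2_cmeas.
have H := @fatou _ RT R mu setT measurableT (fun n x => (cabs (F n x) ^+ 2)%:E) mF
  (fun n x _ => sqr_ge0 (cabs (F n x))).
apply: (@le_trans _ _ (limn_einf (fun n => \int[mu]_x (cabs (F n x) ^+ 2)%:E))%E).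
  apply: le_trans H; rewrite le_eqVlt; apply/orP; left; apply/eqP.
  apply: ae_eq_integral => //.
  - exact: measurable_cabs2.
  - rewrite /limn_einf; apply: measurableT_comp => //.
    apply: measurable_fun_limn_esup => n; exact: measurableT_comp.
  apply: ae_imply cF => x cx _.
  have cx2 : cabs (F n x) @[n --> \oo] --> cabs (g x).
    apply/cvgrPdist_le => e e0.
    move/cvgrPdist_le : cx => /(_ e e0); apply: filterS => n.
    rewrite sub0r normrN ger0_norm ?cabs_ge0// => H1.
    by rewrite distrC; apply: le_trans H1; exact: ler_dist_cabs.
  have c2 : cabs (F n x) ^+ 2 @[n --> \oo] --> cabs (g x) ^+ 2.
    by rewrite expr2; exact: cvgM.
  apply/esym; apply: (cvg_limn_einf_sup _).1.
  by apply: cvg_EFin => //; exact: nearW.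
rewrite limn_einf_lim; apply: lime_le; first exact: is_cvg_einfs.
apply: nearW => n; apply: (@le_trans _ _ (\int[mu]_x (cabs (F n x) ^+ 2)%:E)%E).
  by apply: ereal_inf_lbound; exists n => /=.
by have := sqnorm2E measurableT (LF n); rewrite /sqnorm2 => ->; rewrite lee_fin.
Qed.

Lemma L2_complete (F : nat -> R -> C) : (forall n, L2 setT (F n)) ->
  (forall e, 0 < e -> exists N : nat, forall m n, (N <= m)%N -> (N <= n)%N ->
     nrm setT (fun x => F m x - F n x) <= e) ->
  exists2 g, L2 setT g &
    forall e, 0 < e -> exists N : nat, forall n, (N <= n)%N ->
      nrm setT (fun x => g x - F n x) <= e.
Proof.
move=> LF CF.
(* Squaring gives 9^-k, which is below the 8^-k required by [rapidly_cauchy_ae_cvg]; [phi] then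
   picks a strictly increasing sequence of indices beyond the [N k]. *)
have /choice[N HN] : forall k : nat, exists N : nat, forall m n, (N <= m)%N -> (N <= n)%N ->
    nrm setT (fun x => F m x - F n x) <= 3^-1 ^+ k.
  by move=> k; apply: CF; rewrite exprn_gt0.
pose phi := fix phi k := if k is k'.+1 then maxn (phi k').+1 (N k) else N 0%N.
have phiN k : (N k <= phi k)%N by case: k => [|k]//=; exact: leq_maxr.
have phiS k : (phi k < phi k.+1)%N by exact: leq_maxl.
have phik k : (k <= phi k)%N.
  by elim: k => // k IH; apply: leq_ltn_trans (phiS k).
have := @rapidly_cauchy_ae_cvg R (fun k => F (phi k)) (fun k => LF (phi k)).
have Hd k : nrm2 setT (fun x => F (phi k.+1) x - F (phi k) x) <= 8^-1 ^+ k.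
  rewrite -sqr_nrm; apply: (@le_trans _ _ ((3^-1 ^+ k) ^+ 2)).
    rewrite lerXn2r ?nnegrE ?nrm_ge0 ?exprn_ge0//; apply: HN => //.
    exact: leq_trans (phiN k) (ltnW (phiS k)).
  by rewrite exprAC lerXn2r// ?nnegrE ?exprn_ge0//; rewrite ?expr2; lra.
move=> /(_ Hd) [N0 [mN0 N00 sub]].
(* Multiplying by the indicator of the complement of the exceptional null set makes the subsequence
   converge at every point, so that its limit is a measurable function. *)
pose a x : R := \1_(~` N0) x.
have a1 x : x \notin N0 -> a x = 1 by move=> xN; rewrite /a indicE in_setC xN.
have a0 x : x \in N0 -> a x = 0 by move=> xN; rewrite /a indicE in_setC xN.
have ma : measurable_fun (setT : set RT) a.
  by apply: measurable_indic; exact: measurableC.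
pose G k x : C := (a x)%:C * F (phi k) x.
have mG k : cmeas (setT : set RT) (G k).
  by apply: cmeasM; [exact: cmeas_real|exact: L2_cmeas].
have cG x : exists c : R, forall k, cabs (G k.+1 x - G k x) <= c * 2^-1 ^+ k.
  rewrite /G; case: (boolP (x \in N0)) => xN.
    by exists 0 => k; rewrite a0// !mul0r subr0 cabs0.
  have [c Hc] : exists c : R, forall k, cabs (F (phi k.+1) x - F (phi k) x) <= c * 2^-1 ^+ k.
    by apply: contrapT => xc; move/negP: xN; apply; rewrite inE; exact: sub.
  by exists c => k; rewrite a1// !mul1r; exact: Hc.
have cR x : cvgn (fun k => Re (G k x)).
  have [c Hc] := cG x; apply: (@cvg_geometric_increments _ _ c) => k.
  by apply: le_trans (Hc k); rewrite -[X in `|X|](_ : Re (G k.+1 x - G k x) = _) ?le_normRe// !ReImE.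
have cI x : cvgn (fun k => Im (G k x)).
  have [c Hc] := cG x; apply: (@cvg_geometric_increments _ _ c) => k.
  by apply: le_trans (Hc k); rewrite -[X in `|X|](_ : Im (G k.+1 x - G k x) = _) ?le_normIm// !ReImE.
pose g x : C := limn (fun k => Re (G k x)) +i* limn (fun k => Im (G k x)).
have mg : cmeas (setT : set RT) g.
  split => /=.
    by apply: (measurable_fun_cvg (h := fun k x => Re (G k x))) => [m|x _];
      [case: (mG m)|exact: cR].
  by apply: (measurable_fun_cvg (h := fun k x => Im (G k x))) => [m|x _];
      [case: (mG m)|exact: cI].
have cg x : cabs (G k x - g x) @[k --> \oo] --> (0 : R).
  have H : `|Re (G k x) - Re (g x)| + `|Im (G k x) - Im (g x)| @[k --> \oo] --> (0 : R).
    rewrite -[0]addr0; apply: cvgD.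
      by apply/norm_cvg0P/subr_cvg0; exact: cR.
    by apply/norm_cvg0P/subr_cvg0; exact: cI.
  apply: (squeeze_cvgr _ (cvg_cst 0) H); apply: nearW => k.
  rewrite cabs_ge0/=; apply: le_trans (le_cabs_ReIm _) _.
  by rewrite !ReImE.
(* With [n] fixed, Fatou is applied along the subsequence F(phi(k + M)) - F(n), whose norms the
   Cauchy property bounds by [e]. *)
have main (e : R) : 0 < e -> exists N : nat, forall n, (N <= n)%N ->
    (sqnorm2 setT (fun x : R => g x - F n x)%R <= (e ^+ 2)%:E)%E.
  move=> e0; have [M HM] := CF _ e0; exists M => n Mn.
  apply: (@nrm_fatou (fun k x => F (phi (k + M)%N) x - F n x)).
  - by move=> k; exact: L2B.
  - by apply: cmeasB => //; exact: L2_cmeas.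
  - exists N0; split => // x /= Hx; apply: contrapT => xN; apply: Hx.
    have -> : (fun k => cabs (F (phi (k + M)%N) x - F n x - (g x - F n x))) =
        (fun k => cabs (G (k + M)%N x - g x)).
      apply/funext => k; rewrite /G a1 ?memNset// mul1r; congr cabs.
      by rewrite opprB addrA subrK.
    by rewrite (cvg_shiftn M (fun k => cabs (G k x - g x))).
  - move=> k; rewrite -sqr_nrm lerXn2r ?nnegrE ?nrm_ge0 ?(ltW e0)//.
    by apply: HM => //; apply: leq_trans (phik _); exact: leq_addl.
have Lg : L2 setT g.
  have [M /(_ M (leqnn M)) H] := main 1 ltr01.
  have L : L2 setT (fun x => g x - F M x).
    split; first by apply: cmeasB => //; exact: L2_cmeas.
    by apply: le_lt_trans H _; rewrite ltry.
  by have := L2D measurableT L (LF M); under eq_fun do rewrite subrK.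
exists g => // e e0; have [M HM] := main _ e0; exists M => n Mn.
have := HM _ Mn; rewrite (sqnorm2E measurableT); last exact: L2B.
by rewrite lee_fin -sqr_nrm ler_pXn2r// ?nnegrE ?nrm_ge0// ltW.
Qed.

End L2_complete2.

(** * Reduction of closed linear properties to indicators of intervals *)

Section L2_density.
Context {R : realType}.
Local Notation mu := (@lebesgue_measure R).
Local Notation C := R[i].
Local Notation RT := (measurableTypeR R).
Variables (D : set RT) (u v : nat -> R).
(** The windows exhaust [D] by sets of finite measure. For D = (0, oo) they also stay away from 0,
    so that intervals inside one of them can be approximated by functions supported away from 0. *)
Let B n : set RT := `]u n, v n]%classic.
Hypothesis DB : D = \bigcup_n B n.
Hypotheses (u_dec : forall n, u n.+1 <= u n) (v_inc : forall n, v n <= v n.+1).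
Variable K : (R -> C) -> Prop.
Hypothesis K0 : K (fun=> 0).
Hypothesis Klin : forall (c : C) f g, L2 D f -> L2 D g -> K f -> K g ->
  K (fun x => c * f x + g x).
Hypothesis Kcl : forall f, L2 D f -> (forall e : R, 0 < e ->
  exists g, [/\ L2 D g, K g & nrm D (fun x => f x - g x) <= e]) -> K f.
Hypothesis Kitv : forall n (a b : R), u n <= a -> a < b -> b <= v n ->
  K (fun x => (\1_`]a, b]%classic x)%:C).

Let mD : measurable D.
Proof. by rewrite DB; apply: bigcup_measurable => n _; exact: measurable_itv. Qed.

Let mB n : measurable (B n). Proof. exact: measurable_itv. Qed.

Let BD n : B n `<=` D. Proof. by rewrite DB; exact: bigcup_sup. Qed.

Let B_mono n m : (n <= m)%N -> B n `<=` B m.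
Proof.
elim: m => [|m IH]; first by rewrite leqn0 => /eqP ->.
rewrite leq_eqVlt => /predU1P[->//|]; rewrite ltnS => /IH nm x /nm.
rewrite /B /= !in_itv/= => /andP[h1 h2]; apply/andP; split.
  exact: le_lt_trans (u_dec m) h1.
exact: le_trans h2 (v_inc m).
Qed.

Let B_fin n : (mu (B n) < +oo)%E.
Proof. by rewrite /B lebesgue_measure_itv/=; case: ifP => // _; rewrite -EFinB ltry. Qed.

Let integrable_ind (A : set RT) n : measurable A ->
  mu.-integrable D (EFin \o \1_(A `&` B n)).
Proof.
move=> mA; apply/integrableP; split.
  by apply/measurable_EFinP; apply: measurable_indic; exact: measurableI.
under eq_integral do rewrite /= ger0_norm//.
rewrite integral_indic//; last exact: measurableI.
apply: le_lt_trans (B_fin n); rewrite le_measure ?inE//; last by move=> x [[_ ?] _].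
by apply: measurableI => //; exact: measurableI.
Qed.

Let L2_ind (A : set RT) n : measurable A ->
  L2 D (fun x => (\1_(A `&` B n) x : R)%:C).
Proof.
move=> mA; have mAB : measurable (A `&` B n) by exact: measurableI.
apply: (le_L2 mD (g := \1_(A `&` B n))).
- by apply: cmeas_real; exact: measurable_indic.
- by move=> x _; rewrite cabsC indicE; case: (x \in _); rewrite ?normr1 ?normr0 ?expr1n ?expr0n.
- exact: integrable_ind.
Qed.

Let KD f g : L2 D f -> L2 D g -> K f -> K g -> K (fun x => f x + g x).
Proof.
move=> Lf Lg Kf Kg; have := Klin 1 Lf Lg Kf Kg.
by under eq_fun do rewrite mul1r.
Qed.

Let KZ c f : L2 D f -> K f -> K (fun x => c * f x).
Proof.
move=> Lf Kf; have := Klin c Lf (L20 mD) Kf K0.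
by under eq_fun do rewrite addr0.
Qed.

Let Ksum (I : Type) (r : seq I) (F : I -> R -> C) : (forall i, L2 D (F i)) ->
  (forall i, K (F i)) -> K (fun x => \sum_(i <- r) F i x) /\ L2 D (fun x => \sum_(i <- r) F i x).
Proof.
move=> LF KF; elim: r => [|i r [IH1 IH2]].
  by under eq_fun do rewrite big_nil; split; [exact: K0|exact: L20].
by under eq_fun do rewrite big_cons; split; [exact: KD|exact: L2D].
Qed.

Let Kseq (f_ : nat -> R -> C) f : L2 D f -> (forall n, L2 D (f_ n)) ->
  (forall n, K (f_ n)) -> nrm D (fun x => f x - f_ n x) @[n --> \oo] --> (0 : R) -> K f.
Proof.
move=> Lf Lf_ Kf_ cf; apply: Kcl => // e e0.
move/cvgrPdist_le : cf => /(_ e e0) [N _ /(_ N (leqnn N))].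
rewrite sub0r normrN ger0_norm ?nrm_ge0// => H.
by exists (f_ N).
Qed.

(** Finite partial unions converge in norm: the error is bounded by the indicator of [B n], which is
    integrable. *)
Let Kunion n (F : nat -> set RT) : (forall k, measurable (F k)) ->
  trivIset setT F -> (forall k, K (fun x => (\1_(F k `&` B n) x)%:C)) ->
  K (fun x => (\1_((\bigcup_k F k) `&` B n) x)%:C).
Proof.
move=> mF tF KF.
have mUF : measurable (\bigcup_k F k) by exact: bigcup_measurable.
pose f_ N (x : R) : C := \sum_(0 <= k < N) (\1_(F k `&` B n) x)%:C.
have f_E N x : f_ N x = (\1_((\bigcup_(k < N) F k) `&` B n) x)%:C.
  rewrite /f_; elim: N => [|N IH].
    by rewrite big_geq// bigcup_mkord big_ord0 set0I indic0.
  rewrite big_nat_recr//= IH -rmorphD/= !indicE !in_setI.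
  case: (x \in B n); rewrite ?andbF ?andbT ?addr0//; congr (_%:C).
  rewrite !bigcup_mkord big_ord_recr/= in_setU -bigcup_mkord.
  case: (boolP (x \in F N)) => xF; last by rewrite orbF addr0.
  rewrite (_ : (x \in \bigcup_(i < N) F i) = false) ?add0r//.
  apply/negbTE/negP; rewrite inE => -[k kN xk].
  have := tF k N Logic.I Logic.I; rewrite inE in xF.
  by move=> /(_ (ex_intro _ x (conj xk xF))) kE; move: kN; rewrite kE /= ltnn.
have Lt k : L2 D (fun x => (\1_(F k `&` B n) x)%:C) by exact: L2_ind.
have KL N : K (f_ N) /\ L2 D (f_ N) by exact: Ksum.
apply: (@Kseq f_) => [|N|N|]; [exact: L2_ind|exact: (KL N).2|exact: (KL N).1|].
apply: (@nrm_dct _ _ _ _ (\1_(setT `&` B n))) => //.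
- by move=> N; exact: (L2_cmeas (KL N).2).
- by apply: (@L2_cmeas _ D); exact: L2_ind.
- move=> x Dx; have [[k _ xk]|nx] := pselect ((\bigcup_k F k) x).
    apply: (@cvg_trans _ (cst 0 @ \oo)); last exact: cvg_cst.
    apply: near_eq_cvg; near=> N; rewrite f_E !indicE !in_setI.
    have -> : x \in \bigcup_k F k by rewrite inE; exists k.
    have -> : x \in \bigcup_(i < N) F i.
      by rewrite inE; exists k => //=; near: N; exists k.+1.
    by rewrite subrr cabs0.
  apply: (@cvg_trans _ (cst 0 @ \oo)); last exact: cvg_cst.
  apply: near_eq_cvg; apply: nearW => N; rewrite f_E !indicE !in_setI.
  have nx' : ~ (\bigcup_(k < N) F k) x by move=> [k _ xk]; apply: nx; exists k.
  by rewrite (memNset nx) (memNset nx') subrr cabs0.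
- move=> N x Dx; rewrite f_E -rmorphB cabsC !indicE !in_setI in_setT/=.
  case: (x \in B n); rewrite ?andbF ?andbT ?subrr ?normr0 ?expr0n//=.
  by case: (x \in _); case: (x \in _);
    rewrite ?subrr ?subr0 ?sub0r ?normrN ?normr0 ?normr1 ?expr0n ?expr1n.
- exact: integrable_ind.
Unshelve. all: by end_near. Qed.

(** Dynkin's theorem for the generating half-open intervals. Every set is cut down to [B n] because
    a complement may have infinite measure, whereas its trace on [B n] has the difference of two
    square integrable indicators as its indicator. *)
Let Kmeas n (A : set RT) : measurable A -> K (fun x => (\1_(A `&` B n) x)%:C).
Proof.
have KB : K (fun x => (\1_(B n) x)%:C).
  have [uv|vu] := ltP (u n) (v n); first exact: (Kitv (lexx _) uv (lexx _)).
  rewrite /B set_itv_ge ?bnd_simp -?leNgt//.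
  by under eq_fun do rewrite indic0.
move: A; apply: (dynkin_induction (G := @ocitv R)) => //.
- exact: ocitvI.
- by rewrite setTI.
- move=> _ [[a b] _ <-] /=.
  rewrite (_ : _ `&` _ = `]Num.max a (u n), Num.min b (v n)]%classic); last first.
    apply/seteqP; split => x; rewrite /B /= !in_itv/= gt_max le_min.
      by move=> [/andP[-> ->] /andP[-> ->]].
    by move=> /andP[/andP[-> ->] /andP[-> ->]].
  have [lt|le] := ltP (Num.max a (u n)) (Num.min b (v n)).
    by apply: (Kitv (n := n)) => //; rewrite ?le_max ?ge_min lexx orbT.
  rewrite set_itv_ge ?bnd_simp -?leNgt//.
  by under eq_fun do rewrite indic0.
- move=> S mS KS.
  have LB := L2_ind n (@measurableT _ RT); rewrite setTI in LB.
  have := Klin (-1) (L2_ind n mS) LB KS KB.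
  congr K; apply/funext => x; rewrite !indicE !in_setI in_setC.
  by case: (x \in S); case: (x \in B n) => /=; rewrite ?mulr0n ?mulr1n; apply: complexP => /=; lra.
- by move=> F mF tF KF; exact: Kunion.
Qed.

Import HBNNSimple.

Let Knn (f : R -> R) : (forall x, 0 <= f x) -> L2 D (fun x => (f x)%:C) -> K (fun x => (f x)%:C).
Proof.
move=> f0 Lf; have mf : measurable_fun D (EFin \o f).
  by apply/measurable_EFinP; have [[]] := Lf.
pose s := nnsfun_approx mD mf.
(* The n-th simple function is cut down to [B n]: this makes it square integrable, and since the
   windows exhaust [D] the pointwise limit is unchanged. *)
pose f_ n x : C := \sum_(r <- finmap.enum_fset (fset_set (range (s n)))) r%:C * (\1_(s n @^-1` [set r] `&` B n) x)%:C.
have mr n r : measurable (s n @^-1` [set r]).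
  by rewrite -[X in measurable X]setTI; exact: measurable_funP.
have Lt n r : L2 D (fun x => r%:C * (\1_(s n @^-1` [set r] `&` B n) x : R)%:C).
  by apply: L2Z => //; exact: L2_ind.
have Kt n r : K (fun x => r%:C * (\1_(s n @^-1` [set r] `&` B n) x)%:C).
  by apply: KZ; [exact: L2_ind|exact: Kmeas].
have f_E n x : f_ n x = (s n x * \1_(B n) x)%:C.
  rewrite fimfunE fsbig_finite//= mulr_suml rmorph_sum; apply: eq_bigr => r _.
  by rewrite -rmorphM indicI/= mulrA.
apply: (@Kseq f_) => //.
- by move=> N; apply: (Ksum _ _ _).2.
- by move=> N; apply: (Ksum _ _ _).1.
apply: (@nrm_dct _ _ _ _ (fun x => cabs (f x)%:C ^+ 2)) => //.
- by move=> N; apply: L2_cmeas; apply: (Ksum _ _ _).2.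
- exact: L2_cmeas.
- move=> x Dx.
  have cs : s n x @[n --> \oo] --> f x.
    by have := cvg_nnsfun_approx mD mf (fun x _ => f0 x) Dx; move/fine_cvg.
  have [N _ BN] : (\bigcup_n B n) x by rewrite -DB.
  apply: (@cvg_trans _ ((fun n => `|f x - s n x|) @ \oo)).
    apply: near_eq_cvg; near=> n.
    rewrite f_E indicE mem_set ?mulr1 -?rmorphB ?cabsC//.
    by apply: B_mono BN; near: n; exists N.
  by apply/norm_cvg0P; rewrite -[0](subrr (f x)); apply: cvgB => //; exact: cvg_cst.
- move=> n x Dx; rewrite f_E -rmorphB !cabsC lerXn2r ?nnegrE//.
  have s0 : 0 <= s n x by [].
  have sf : s n x <= f x.
    have := le_approx n (fun x _ => f0 x : (0 <= (EFin \o f) x)%E) Dx.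
    by rewrite lee_fin /s nnsfun_approxE.
  rewrite [leRHS]ger0_norm// indicE; case: (x \in B n); rewrite ?mulr0n ?mulr1n ?mulr0 ?mulr1 ?subr0; rewrite ger0_norm; lra.
- exact: L2_int.
Unshelve. all: by end_near. Qed.

(** Serves twice, for the inversion of the Fourier transform and for the density of test functions.
    Beyond nonnegative functions only the decomposition into positive and negative, real and
    imaginary parts remains. *)
Theorem L2_density_ind f : L2 D f -> K f.
Proof.
move=> Lf.
have Kreal (g : R -> R) : L2 D (fun x => (g x)%:C) -> K (fun x => (g x)%:C).
  move=> Lg.
  have part (h : R -> R) : (forall x, h x = Num.max (g x) 0 \/ h x = Num.max (- g x) 0) -> measurable_fun D h ->
      L2 D (fun x => (h x)%:C) /\ K (fun x => (h x)%:C).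
    move=> hE mh.
    have Lh : L2 D (fun x => (h x)%:C).
      apply: (le_L2 mD (g := fun x => cabs (g x)%:C ^+ 2)).
      - exact: cmeas_real.
      - move=> x _; rewrite !cabsC lerXn2r ?nnegrE//.
        by case: (hE x) => ->; rewrite /Num.max; case: ifP => _; rewrite ?normr0 ?normrN.
      - exact: L2_int.
    split => //; apply: Knn => // x.
    by case: (hE x) => ->; rewrite le_max lexx orbT.
  have mg : measurable_fun D g by have [[]] := Lg.
  have [L1 K1] : L2 D (fun x => (Num.max (g x) 0)%:C) /\ K (fun x => (Num.max (g x) 0)%:C).
    by apply: part => [x|]; [left|exact: measurable_maxr].
  have [L2' K2] : L2 D (fun x => (Num.max (- g x) 0)%:C) /\ K (fun x => (Num.max (- g x) 0)%:C).
    by apply: part => [x|]; [right|apply: measurable_maxr => //; exact: measurableT_comp].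
  have := Klin (-1) L2' L1 K2 K1; congr K; apply/funext => x.
  apply: complexP => /=; last by lra.
  by rewrite /Num.max; case: ifP; case: ifP; lra.
have LR : L2 D (fun x => (Re (f x))%:C).
  apply: (le_L2 mD (g := fun x => cabs (f x) ^+ 2)).
  - by apply: cmeas_real; case: Lf => [[]].
  - by move=> x _; rewrite cabsC lerXn2r ?nnegrE ?cabs_ge0 ?le_normRe.
  - exact: L2_int.
have LI : L2 D (fun x => (Im (f x))%:C).
  apply: (le_L2 mD (g := fun x => cabs (f x) ^+ 2)).
  - by apply: cmeas_real; case: Lf => [[]].
  - by move=> x _; rewrite cabsC lerXn2r ?nnegrE ?cabs_ge0 ?le_normIm.
  - exact: L2_int.
have := Klin (0 +i* 1) LI LR (Kreal _ LI) (Kreal _ LR); congr K; apply/funext => x.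
by apply: complexP; rewrite !ReImE/=; lra.
Qed.

End L2_density.

(** * Integrals over the line and the Poisson kernel *)

Section half_line.
Context {R : realType}.
Local Notation mu := (@lebesgue_measure R).
Local Notation RT := (measurableTypeR R).

Lemma Rintegral_FTC_half (f F : R -> R) (a l : R) : continuous f ->
  (forall x : R, is_derive x 1 F (f x)) -> mu.-integrable `[a, +oo[ (EFin \o f) ->
  F x @[x --> +oo] --> l -> \int[mu]_(x in `[a, +oo[) f x = l - F a.
Proof.
move=> cf dF itf Fl.
have H1 n : \int[mu]_(x in `[a, a + n.+1%:R]) f x = F (a + n.+1%:R) - F a.
  have an : a < a + n.+1%:R by rewrite ltrDl.
  rewrite /Rintegral (@continuous_FTC2 _ f F)//.
  - exact: continuous_subspaceT.
  - split.
    + by move=> x _; exact: ex_derive.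
    + apply: cvg_at_right_filter; apply: differentiable_continuous.
      by apply/derivable1_diffP; exact: ex_derive.
    + apply: cvg_at_left_filter; apply: differentiable_continuous.
      by apply/derivable1_diffP; exact: ex_derive.
  - by move=> x _; rewrite derive1E; exact: derive_val.
have H2 : \int[mu]_(x in `[a, a + n.+1%:R]) f x @[n --> \oo] --> \int[mu]_(x in `[a, +oo[) f x.
  have mf : measurable_fun setT f by exact: continuous_measurable_fun.
  apply: fine_cvg; rewrite fineK; last exact: integrable_fin_num itf.
  have En (n : nat) : (\int[mu]_x (((EFin \o f) \_ `[a, (a + n.+1%:R)%R]) x) =
      \int[mu]_(x in `[a, (a + n.+1%:R)%R]) (f x)%:E)%E by rewrite -integral_mkcond.
  rewrite -(funext En) (_ : integral mu `[a, +oo[ (EFin \o f) =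
    (\int[mu]_x (((EFin \o f) \_ `[a, +oo[) x))%E); last by rewrite -integral_mkcond.
  apply: (@dominated_cvg _ _ _ mu setT measurableT
    (fun n => (EFin \o f) \_ `[a, a + n.+1%:R]) ((EFin \o f) \_ `[a, +oo[)
    (abse \o ((EFin \o f) \_ `[a, +oo[))).
  - move=> n; apply/(measurable_restrictT _ _).1 => //.
    by apply/measurable_EFinP; exact: measurable_funTS.
  - move=> x _; rewrite !patchE; case: ifPn => xa.
      apply: cvg_near_cst; near=> n; rewrite patchE mem_set//.
      move: xa; rewrite inE/= !in_itv/= andbT => -> /=.
      rewrite -lerBlDl; near: n.
      exists (Num.bound `|x - a|) => // k /= mk.
      rewrite ltW// (le_lt_trans (ler_norm _))// (lt_le_trans (archi_boundP _))//.
      by rewrite ler_nat (leq_trans mk).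
    apply: cvg_near_cst; apply: nearW => n; rewrite patchE ifN//.
    apply: contra xa; rewrite !inE/= !in_itv/= => /andP[-> _]//.
  - by move=> x _; rewrite /= patchE; case: ifP.
  - by apply: integrable_abse; exact: ((integrable_mkcond _ _).1 itf).
  - move=> n x _; rewrite [leRHS]/= !patchE.
    case: (boolP (x \in `[a, a + n.+1%:R]%classic)) => [xa|_]; last by rewrite abse0 abse_ge0.
    by rewrite ifT//; move: xa; rewrite !inE/= !in_itv/= => /andP[-> _].
have H3 : F (a + n.+1%:R) - F a @[n --> \oo] --> l - F a.
  apply: cvgB; last exact: cvg_cst.
  have cN : (fun n : nat => a + n.+1%:R) @ \oo --> +oo.
    apply/cvgryPge => A; exists (Num.bound `|A - a|) => // k /= mk.
    rewrite -lerBlDl ltW// (le_lt_trans (ler_norm _))// (lt_le_trans (archi_boundP _))//.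
    by rewrite ler_nat (leq_trans mk).
  exact: (cvg_comp _ _ cN Fl).
apply: (cvg_unique _ H2); first by [].
by apply: cvg_trans H3; apply: near_eq_cvg; apply: nearW => n.
Unshelve. all: by end_near. Qed.

Lemma integrable_affine (s c : R) (f : R -> R) : s = 1 \/ s = -1 ->
  mu.-integrable setT (EFin \o f) -> mu.-integrable setT (EFin \o (fun x => f (s * x + c))).
Proof.
move=> s1 /integrableP[mf lt]; apply/integrableP; split.
  exact: (measurableT_comp mf (measurable_affine s c)).
rewrite (integral_affine c s1 (f := fun x => `|(f x)%:E|%E))//.
exact: measurableT_comp.
Qed.

Lemma Rintegral_split0 (f : R -> R) : mu.-integrable setT (EFin \o f) ->
  \int[mu]_x f x = \int[mu]_(x in `[0, +oo[) (f x + f (- x)).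
Proof.
move=> itf.
have mf : measurable_fun setT f by apply/measurable_EFinP; exact: measurable_int itf.
have itfN : mu.-integrable setT (EFin \o (fun x => f (- x))).
  have := integrable_affine 0 (or_intror erefl : -1 = 1 \/ -1 = -1) itf.
  by rewrite /comp; under eq_fun do rewrite mulN1r addr0.
have ih (g : R -> R) : mu.-integrable setT (EFin \o g) -> mu.-integrable `[0, +oo[ (EFin \o g).
  by move=> ig; apply: integrableS ig.
rewrite RintegralD//; [|exact: ih|exact: ih].
have TE : (setT : set RT) = `]-oo, 0[ `|` `[0, +oo[.
  by apply/seteqP; split => x // _; rewrite /= !in_itv/= andbT; case: (ltP x 0); [left|right].
rewrite [in LHS]TE Rintegral_setU//; last 2 first.
- by rewrite -TE.
- by apply/disj_setPS => x [] /=; rewrite !in_itv/= andbT; lra.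
rewrite addrC; congr (_ + _).
rewrite Rintegral_mkcond.
rewrite -(Rintegral_affine (s := -1) 0 (or_intror erefl)); last first.
  by apply/(measurable_restrictT _ _).1 => //; exact: measurable_funTS.
rewrite -Rintegral_itv_obnd_cbnd; last by apply: integrableS itfN.
rewrite [RHS]Rintegral_mkcond; apply: eq_Rintegral => x _.
rewrite !patchE mulN1r addr0; congr (if _ then _ else _).
by apply/idP/idP; rewrite !inE/= !in_itv/= ?andbT oppr_lt0.
Qed.

Lemma Rintegral_even (f : R -> R) : mu.-integrable setT (EFin \o f) ->
  (forall x, f (- x) = f x) -> \int[mu]_x f x = 2 * \int[mu]_(x in `[0, +oo[) f x.
Proof.
move=> itf fN; rewrite Rintegral_split0// -RintegralZl//.
  by apply: eq_Rintegral => x _; rewrite fN; ring.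
by apply: integrableS itf.
Qed.

Lemma Rintegral_odd (f : R -> R) : mu.-integrable setT (EFin \o f) ->
  (forall x, f (- x) = - f x) -> \int[mu]_x f x = 0.
Proof.
move=> itf fN; rewrite Rintegral_split0//.
under eq_Rintegral do rewrite fN subrr.
by rewrite Rintegral_cst ?mul0r.
Qed.

(** Folding the line at 0: F(x) - F(-x) is a primitive of f(x) + f(-x) and vanishes at 0. *)
Lemma Rintegral_FTC_line (f F : R -> R) (l l' : R) : continuous f ->
  (forall x : R, is_derive x 1 F (f x)) -> mu.-integrable setT (EFin \o f) ->
  F x @[x --> +oo] --> l -> F (- x) @[x --> +oo] --> l' -> \int[mu]_x f x = l - l'.
Proof.
move=> cf dF itf Fl Fl'; rewrite Rintegral_split0//.
have itfN : mu.-integrable setT (EFin \o (fun x => f (- x))).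
  have := integrable_affine 0 (or_intror erefl : -1 = 1 \/ -1 = -1) itf.
  by rewrite /comp; under eq_fun do rewrite mulN1r addr0.
have cN : continuous (fun x : R => - x) by exact: opp_continuous.
suff -> : \int[mu]_(x in `[0, +oo[) (f x + f (- x)) = (l - l') - (F 0 - F (- 0)).
  by rewrite oppr0 subrr subr0.
apply: (@Rintegral_FTC_half _ (fun x => F x - F (- x)) 0 (l - l')).
- move=> x; apply: cvgD; first exact: cf.
  by apply: (@continuous_comp _ _ _ (fun x : R => - x) f); [exact: cN|exact: cf].
- move=> x.
  have d1 := dF x.
  have d0 : is_derive x (1 : R) (fun x : R => - x) (-1).
    by apply: is_derive_eq.
  have d2 : is_derive x 1 (fun x => F (- x)) (f (- x) * -1).
    exact: (is_derive1_comp (f := F) (g := fun x : R => - x)).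
  by apply: is_derive_eq; rewrite mulrN1 opprK.
- apply: (integrableS (E := setT)) => //.
  by rewrite /comp; under eq_fun do rewrite EFinD; exact: integrableD.
- exact: cvgB.
Qed.

End half_line.

(** * Abel factors and the Poisson kernel *)

Section poisson.
Context {R : realType}.
Local Notation mu := (@lebesgue_measure R).
Local Notation C := R[i].
Local Notation RT := (measurableTypeR R).

Lemma set_ge0E : [set x : R | 0 <= x] = `[0, +oo[%classic.
Proof. by apply/seteqP; split => x /=; rewrite in_itv/= andbT. Qed.

Lemma continuous_of_derive (f : R -> R) (df : R -> R) :
  (forall x : R, is_derive x 1 f (df x)) -> continuous f.
Proof.
move=> H x; apply: differentiable_continuous; apply/derivable1_diffP.
exact: ex_derive.
Qed.

Lemma cvg_expNM (e : R) : 0 < e -> expR (- (e * x)) @[x --> +oo] --> (0 : R).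
Proof.
move=> e0; apply: (cvg_comp (fun x => e * x) (fun x => expR (- x))); last exact: cvgr_expR.
by apply: gt0_cvgMry => //; exact: cvg_id.
Qed.

Lemma continuous_expNabs (e : R) : continuous (fun x : R => expR (- (e * `|x|))).
Proof.
move=> x; apply: (@continuous_comp _ _ _ (fun x => - (e * `|x|)) expR); last exact: continuous_expR.
apply: continuousN; apply: continuousM; first exact: cvg_cst.
exact: norm_continuous.
Qed.

Lemma integrable_expNabs (e : R) : 0 < e ->
  mu.-integrable setT (EFin \o (fun x => expR (- (e * `|x|)))).
Proof.
move=> e0; apply/integrableP; split.
  by apply/measurable_EFinP; apply: continuous_measurable_fun; exact: continuous_expNabs.
under eq_integral do rewrite /= ger0_norm ?expR_ge0//.
rewrite ge0_symfun_integralT; last 3 first.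
- by move=> x; exact: expR_ge0.
- exact: continuous_expNabs.
- by move=> x /=; rewrite normrN.
rewrite set_ge0E.
rewrite (_ : integral _ _ _ = (\int[mu]_(x in `[0%R, +oo[) (expR (- (e * x)))%:E)%E); last first.
  by apply: eq_integral => x; rewrite inE/= in_itv/= andbT => x0; rewrite ger0_norm.
have d x : is_derive x (1 : R) (fun x => - e^-1 * expR (- (e * x))) (expR (- (e * x))).
  by apply: is_derive_eq; rewrite /GRing.scale/=; field; rewrite gt_eqF.
rewrite (@ge0_continuous_FTC2y _ _ (fun x => - e^-1 * expR (- (e * x))) 0 0).
- by rewrite -EFinB -EFinM ltry.
- by move=> x _; exact: expR_ge0.
- apply: continuous_subspaceT; apply: (@continuous_of_derive _ (fun x => - e * expR (- (e * x)))) => x.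
  by apply: is_derive_eq; rewrite /GRing.scale/=; ring.
- rewrite -(mulr0 (- e^-1)); apply: cvgM; [exact: cvg_cst|exact: cvg_expNM].
- by move=> x _; exact: ex_derive.
- apply: cvg_at_right_filter; exact: (continuous_of_derive d).
- by move=> x _; rewrite derive1E; exact: derive_val.
Qed.

(** Normalized to be exactly the integral of exp(-e|x|) against cos(t x), so its total mass is 2 pi
    and the factor 1/(2 pi) is carried separately. *)
Definition poisson (e t : R) : R := 2 * e / (e ^+ 2 + t ^+ 2).

Lemma poisson_den_gt0 (e t : R) : 0 < e -> 0 < e ^+ 2 + t ^+ 2.
Proof. by move=> e0; rewrite ltr_pwDl ?sqr_ge0// exprn_gt0. Qed.

Lemma poisson_ge0 e t : 0 < e -> 0 <= poisson e t.
Proof. by move=> e0; rewrite divr_ge0 ?mulr_ge0 ?ltW// poisson_den_gt0. Qed.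

Lemma continuous_poisson (e : R) : 0 < e -> continuous (poisson e).
Proof.
move=> e0 x; rewrite /poisson; apply: cvgM; first exact: cvg_cst.
apply: cvgV; first by rewrite gt_eqF// poisson_den_gt0.
by apply: cvgD; [exact: cvg_cst|apply: exprn_continuous].
Qed.

Lemma is_derive_atan_div (e : R) : 0 < e -> forall t : R,
  is_derive t 1 (fun t => 2 * atan (t / e)) (poisson e t).
Proof.
move=> e0 t.
have d0 : is_derive t (1 : R) (fun t : R => t / e) (e^-1).
  by apply: is_derive_eq; rewrite /GRing.scale/=; ring.
have d1 := is_derive1_comp (f := atan) (g := fun t : R => t / e) (is_derive1_atan (t / e)) d0.
have d2 : is_derive t (1 : R) (fun t => 2 * (atan \o (fun t : R => t / e)) t) (2 * ((1 + (t / e) ^+ 2)^-1 * e^-1)).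
  by apply: is_derive_eq.
apply: (is_derive_eq d2); rewrite /poisson.
have := poisson_den_gt0 t e0; have : 1 + (t / e) ^+ 2 != 0.
  by rewrite gt_eqF// ltr_pwDl ?sqr_ge0.
by move=> h1 h2; field; rewrite !gt_eqF// addrC.
Qed.

Lemma integral_poisson (e : R) : 0 < e -> (\int[mu]_t (poisson e t)%:E = (2 * pi)%:E)%E.
Proof.
move=> e0; rewrite ge0_symfun_integralT; last 3 first.
- by move=> t; exact: poisson_ge0.
- exact: continuous_poisson.
- by move=> t /=; rewrite /poisson sqrrN.
rewrite set_ge0E (@ge0_continuous_FTC2y _ _ (fun t => 2 * atan (t / e)) 0 pi).
- by rewrite mul0r atan0 mulr0 sube0 -EFinM.
- by move=> x _; exact: poisson_ge0.
- by apply: continuous_subspaceT; exact: continuous_poisson.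
- rewrite -[X in _ --> X](_ : 2 * (pi / 2) = _); last by field.
  apply: cvgM; first exact: cvg_cst.
  apply: (cvg_comp (fun x => x / e) atan); last exact: cvgy_atan.
  apply: gt0_cvgMly; [by rewrite invr_gt0|exact: cvg_id].
- by move=> x _; have := is_derive_atan_div e0 x => ?; exact: ex_derive.
- apply: cvg_at_right_filter; exact: (continuous_of_derive (is_derive_atan_div e0)).
- by move=> x _; rewrite derive1E; have := is_derive_atan_div e0 x => ?; exact: derive_val.
Qed.

Lemma Rintegral_expNabs_cos (e t : R) : 0 < e ->
  \int[mu]_x (expR (- (e * `|x|)) * cos (t * x)) = poisson e t.
Proof.
move=> e0.
have mc : measurable_fun setT (fun x : R => expR (- (e * `|x|)) * cos (t * x)).
  apply: measurable_funM; first exact: (continuous_measurable_fun (@continuous_expNabs e)).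
  apply: measurableT_comp; first exact: (continuous_measurable_fun (@continuous_cos R)).
  exact: measurable_funM.
have itf : mu.-integrable setT (EFin \o (fun x => expR (- (e * `|x|)) * cos (t * x))).
  apply: le_integrable (integrable_expNabs e0) => //; first exact/measurable_EFinP.
  move=> x _; rewrite /= lee_fin normrM ler_piMr//.
  by rewrite ler_norml cos_geN1 cos_le1.
rewrite Rintegral_even//; last by move=> x; rewrite normrN mulrN cosN.
(* The real part of exp((-e + i t) x) / (-e + i t). *)
pose F x := expR (- (e * x)) * (t * sin (t * x) - e * cos (t * x)) / (e ^+ 2 + t ^+ 2).
rewrite (@eq_Rintegral _ _ _ mu _ (fun x => expR (- (e * x)) * cos (t * x))); last first.
  by move=> x; rewrite inE/= in_itv/= andbT => x0; rewrite ger0_norm.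
have den := poisson_den_gt0 t e0.
suff -> : \int[mu]_(x in `[0, +oo[) (expR (- (e * x)) * cos (t * x)) = 0 - F 0.
  by rewrite /F /poisson !mulr0 oppr0 expR0 sin0 cos0; field; rewrite gt_eqF.
apply: (@Rintegral_FTC_half _ _ F).
- apply: (@continuous_of_derive _ (fun x => - e * expR (- (e * x)) * cos (t * x) - expR (- (e * x)) * (t * sin (t * x)))) => x.
  by apply: is_derive_eq; rewrite /GRing.scale/=; ring.
- move=> x; apply: is_derive_eq; rewrite /GRing.scale/=; field; rewrite gt_eqF//.
- apply: eq_integrable (integrableS (E := setT) _ _ _ itf) => // x.
  by rewrite inE/= in_itv/= andbT => x0; rewrite ger0_norm.
- have H : expR (- (e * x)) * ((`|t| + e) / (e ^+ 2 + t ^+ 2)) @[x --> +oo] --> (0 : R).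
    rewrite -(mul0r ((`|t| + e) / (e ^+ 2 + t ^+ 2))).
    by apply: cvgM; [exact: cvg_expNM|exact: cvg_cst].
  apply/norm_cvg0P; apply: (squeeze_cvgr _ (cvg_cst 0) H); apply: nearW => x.
  rewrite normr_ge0/= /F -mulrA normrM ger0_norm ?expR_ge0// ler_wpM2l ?expR_ge0//.
  rewrite normrM [X in _ * X]ger0_norm ?invr_ge0 ?(ltW den)// ler_wpM2r ?invr_ge0 ?(ltW den)//.
  rewrite (le_trans (ler_normB _ _))// !normrM lerD//.
    by rewrite ler_piMr// ler_norml sin_geN1 sin_le1.
  by rewrite (gtr0_norm e0) ler_piMr ?(ltW e0)// ler_norml cos_geN1 cos_le1.
Qed.

Lemma cInt_expNabs (e t : R) : 0 < e ->
  cInt mu setT (fun x : R => (expR (- (e * `|x|)))%:C * cexp (0 +i* (t * x))) = (poisson e t)%:C.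
Proof.
move=> e0; apply: complexP; rewrite ?Re_cInt ?Im_cInt.
  rewrite -(Rintegral_expNabs_cos t e0); apply: eq_Rintegral => x _.
  by rewrite !ReImE /cexp/= expR0; ring.
rewrite (@eq_Rintegral _ _ _ mu _ (fun x => expR (- (e * `|x|)) * sin (t * x))); last first.
  by move=> x _; rewrite !ReImE /cexp/= expR0; ring.
apply: Rintegral_odd => [|x]; last by rewrite normrN mulrN sinN mulrN.
apply: le_integrable (integrable_expNabs e0) => //.
  apply/measurable_EFinP; apply: measurable_funM.
    exact: (continuous_measurable_fun (@continuous_expNabs e)).
  apply: measurableT_comp; first exact: (continuous_measurable_fun (@continuous_sin R)).
  exact: measurable_funM.
move=> x _; rewrite /= lee_fin normrM ler_piMr//.
by rewrite ler_norml sin_geN1 sin_le1.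
Qed.

End poisson.

(** * The Fourier transform on L^2 *)

Section fourier_L1.
Context {R : realType}.
Local Notation mu := (@lebesgue_measure R).
Local Notation C := R[i].
Local Notation RT := (measurableTypeR R).

Definition cis (t : R) : C := cexp (0 +i* t).

Lemma conjcM (z w : C) : (z * w)^* = z^* * w^*.
Proof. by rewrite rmorphM. Qed.

Lemma cabs_cis t : cabs (cis t) = 1.
Proof. by rewrite cabs_cexp /= expR0. Qed.

Lemma cisD s t : cis (s + t) = cis s * cis t.
Proof. by rewrite /cis -cexpD; congr cexp; apply: complexP => /=; rewrite ?addr0. Qed.

Lemma cisJ t : (cis t)^* = cis (- t).
Proof. by rewrite /cis cexpJ. Qed.

Lemma cmeas_cis d (T : measurableType d) (D : set T) (f : T -> R) :
  measurable_fun D f -> cmeas D (fun x => cis (f x)).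
Proof. by move=> mf; apply: cmeas_cexp; split => //=; exact: measurable_cst. Qed.

Definition isq : R := (Num.sqrt (2 * pi))^-1.

Lemma isq_ge0 : 0 <= isq.
Proof. by rewrite invr_ge0 sqrtr_ge0. Qed.

Lemma sqr_isq : isq ^+ 2 = (2 * pi)^-1.
Proof. by rewrite exprVn sqr_sqrtr// mulr_ge0// pi_ge0. Qed.

(** The integral itself, defined at every point when [u] is integrable, whereas [fourier] is
    determined only almost everywhere. *)
Definition ft (u : R -> C) (xi : R) : C :=
  isq%:C * cInt mu setT (fun x => u x * cis (- (x * xi))).

Lemma fourier_integral_restrict (D : set RT) (u : R -> C) :
  fourier_integral D u = ft (fun x => if (x : RT) \in D then u x else 0).
Proof.
apply/funext => xi; rewrite /fourier_integral /ft; congr (_ * _).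
by apply: complexP; rewrite /= Rintegral_mkcond; apply: eq_Rintegral => x _;
  rewrite !patchE; case: ifP => _ //; rewrite mul0r.
Qed.

Lemma cintegrable_cis u (f : R -> R) : measurable_fun setT f -> cintegrable mu setT u ->
  cintegrable mu setT (fun x => u x * cis (f x)).
Proof.
move=> mf iu; under eq_fun do rewrite mulrC.
have c1 (x : RT) : setT x -> cabs (cis (f x)) <= 1 by rewrite cabs_cis.
exact: (cintegrable_bM (T := RT) measurableT (cmeas_cis mf) c1 iu).
Qed.

Lemma measurable_mulN (xi : R) : measurable_fun setT (fun x : R => - (x * xi)).
Proof. by apply: measurableT_comp => //; exact: measurable_funM. Qed.

Lemma measurable_mulN2 : measurable_fun setT (fun z : RT * RT => - (z.1 * z.2)).
Proof.
apply: measurableT_comp => //; apply: measurable_funM.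
  exact: measurable_fst.
exact: measurable_snd.
Qed.

Lemma le_cabs_ft u xi : cintegrable mu setT u ->
  cabs (ft u xi) <= isq * \int[mu]_x cabs (u x).
Proof.
move=> iu; rewrite /ft cabsM cabsC ger0_norm ?isq_ge0// ler_wpM2l ?isq_ge0//.
have := le_cabs_cInt (T := RT) measurableT (cintegrable_cis (measurable_mulN xi) iu).
by under eq_Rintegral do rewrite cabsM cabs_cis mulr1.
Qed.

(** The multiplication formula: the kernel exp(-i x xi) is bounded and symmetric in its two
    variables. *)
Lemma ft_fubini u w : cintegrable mu setT u -> cintegrable mu setT w ->
  cintegrable mu setT (fun xi => ft u xi * w xi) /\
  cInt mu setT (fun xi => ft u xi * w xi) = cInt mu setT (fun x => u x * ft w x).
Proof.
move=> iu iw.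
have [|i1 i2 e] := fubini_kernel (K := 1) iu iw (cmeas_cis measurable_mulN2).
  by move=> z; rewrite cabs_cis.
have E1 xi : ft u xi * w xi =
    isq%:C * (w xi * cInt mu setT (fun x : RT => cis (- (x * xi)) * u x)).
  rewrite /ft -mulrA; congr (_ * _); rewrite mulrC; congr (_ * _).
  by apply: eq_cInt => x _; rewrite mulrC.
have E2 x : u x * ft w x =
    isq%:C * (u x * cInt mu setT (fun y : RT => cis (- (x * y)) * w y)).
  rewrite /ft mulrCA; congr (_ * (_ * _)).
  by apply: eq_cInt => y _; rewrite mulrC (mulrC x).
have -> : (fun xi => ft u xi * w xi) = _ := funext E1.
have -> : (fun x => u x * ft w x) = _ := funext E2.
split; first by apply: (cintegrableZ (T := RT)).
transitivity (isq%:C * cInt mu setT (fun x => w x * cInt mu setT (fun y : RT => cis (- (y * x)) * u y))).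
  exact: (cIntZ (T := RT) measurableT _ i2).
rewrite -e; apply/esym; exact: (cIntZ (T := RT) measurableT _ i1).
Qed.

Lemma cintegrable_expNabs (e : R) : 0 < e ->
  cintegrable mu setT (fun x : R => (expR (- (e * `|x|)))%:C).
Proof.
move=> e0; split.
  by apply: cmeas_real; exact: (continuous_measurable_fun (@continuous_expNabs R e)).
by under eq_fun do rewrite cabsC ger0_norm ?expR_ge0//; exact: integrable_expNabs.
Qed.

(** Fubini gives the measurability of [ft u] times an integrable exponential; the exponential is
    then divided out. *)
Lemma cmeas_ft u : cintegrable mu setT u -> cmeas (setT : set RT) (ft u).
Proof.
move=> iu; have [[mf _] _] := ft_fubini iu (cintegrable_expNabs ltr01).
have -> : ft u = fun xi => (ft u xi * (expR (- (1 * `|xi|)))%:C) * (expR (1 * `|xi|))%:C.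
  by apply/funext => xi; rewrite -mulrA -rmorphM -expRD addNr expR0 mulr1.
apply: cmeasM => //; apply: cmeas_real; apply: measurableT_comp => //.
by apply: measurable_funM => //; exact: measurableT_comp.
Qed.

Lemma cintegrable_ft_exp u (e : R) : 0 < e -> cintegrable mu setT u ->
  cintegrable mu setT (fun xi => (expR (- (e * `|xi|)))%:C * (ft u xi)^*).
Proof.
move=> e0 iu; under eq_fun do rewrite mulrC.
have b (xi : RT) : setT xi -> cabs (ft u xi)^* <= isq * \int[mu]_x cabs (u x).
  by move=> _; rewrite cabsJ; exact: le_cabs_ft.
exact: (cintegrable_bM (T := RT) measurableT (cmeasJ (cmeas_ft iu)) b (cintegrable_expNabs e0)).
Qed.

(* Abel summation of the inversion integral produces the Poisson kernel. *)
Lemma ft_expNabs_ft u (e : R) x : 0 < e -> cintegrable mu setT u ->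
  ft (fun xi => (expR (- (e * `|xi|)))%:C * (ft u xi)^*) x =
  ((2 * pi)^-1)%:C * cInt mu setT (fun y => (u y)^* * (poisson e (x - y))%:C).
Proof.
move=> e0 iu.
have mk : cmeas setT (fun z : RT * RT => cis (z.2 * z.1)).
  apply: cmeas_cis; apply: measurable_funM; [exact: measurable_snd|exact: measurable_fst].
have ie : cintegrable mu setT (fun xi => (expR (- (e * `|xi|)))%:C * cis (- (xi * x))).
  exact: cintegrable_cis (measurable_mulN x) (cintegrable_expNabs e0).
have [|i1 i2 ee] := fubini_kernel (K := 1) ie (cintegrableJ (T := RT) iu) mk.
  by move=> z; rewrite cabs_cis.
have E1 xi : (expR (- (e * `|xi|)))%:C * (ft u xi)^* * cis (- (xi * x)) =
    isq%:C * ((expR (- (e * `|xi|)))%:C * cis (- (xi * x)) *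
      cInt mu setT (fun y : RT => cis (y * xi) * (u y)^*)).
  rewrite mulrAC [RHS]mulrCA; congr (_ * _).
  rewrite /ft conjcM conjcR; congr (_ * _).
  rewrite -(cIntJ (T := RT) measurableT (cintegrable_cis (measurable_mulN xi) iu)).
  by apply: eq_cInt => y _; rewrite conjcM cisJ opprK mulrC.
rewrite {1}/ft (funext E1) (cIntZ (T := RT) measurableT _ i1) ee mulrA -rmorphM -expr2 sqr_isq.
congr (_ * _); apply: eq_cInt => y _; congr (_ * _).
rewrite (_ : poisson e (x - y) = poisson e (y - x)); last first.
  by rewrite /poisson -(opprB y x) sqrrN.
rewrite -cInt_expNabs//; apply: eq_cInt => xi _.
rewrite -[cexp _]/(cis ((y - x) * xi)) mulrCA; congr (_ * _).
by rewrite -cisD; congr cis => /=; ring.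
Qed.

End fourier_L1.

(** * Contractivity of the Fourier integral *)

Section plancherel.
Context {R : realType}.
Local Notation mu := (@lebesgue_measure R).
Local Notation C := R[i].
Local Notation RT := (measurableTypeR R).

Lemma rcM (x y : R) : (x * y)%:C = x%:C * y%:C.
Proof. by rewrite rmorphM. Qed.

Lemma cintegrable_fin (f : R -> C) : cintegrable mu setT f ->
  (\int[mu]_x (cabs (f x))%:E)%E = (\int[mu]_x cabs (f x))%:E.
Proof. by move=> [_ itf]; rewrite /Rintegral fineK//; exact: integrable_fin_num itf. Qed.

(** Schur's test: a b <= a^2/2 + b^2/2 separates the variables, and the integral of p(x - y) over
    either variable is the mass of [p]. *)
Lemma schur_convolution (a b p : R -> R) :
  measurable_fun setT a -> measurable_fun setT b -> measurable_fun setT p ->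
  (forall x, 0 <= a x) -> (forall x, 0 <= b x) -> (forall x, 0 <= p x) ->
  (\int[mu]_x \int[mu]_y (a x * b y * p (x - y))%:E <=
   (\int[mu]_x (a x ^+ 2 / 2)%:E + \int[mu]_x (b x ^+ 2 / 2)%:E) *
     \int[mu]_x (p x)%:E)%E.
Proof.
move=> ma mb mp a0 b0 p0.
have mpx : measurable_fun setT (fun z : RT * RT => p (z.1 - z.2)).
  apply: measurableT_comp => //; apply: measurable_funB.
    exact: measurable_fst.
  exact: measurable_snd.
have ma1 : measurable_fun setT (fun z : RT * RT => a z.1).
  by apply: measurableT_comp => //; exact: measurable_fst.
have mb2 : measurable_fun setT (fun z : RT * RT => b z.2).
  by apply: measurableT_comp => //; exact: measurable_snd.
pose A (z : RT * RT) : \bar R := (a z.1 ^+ 2 / 2 * p (z.1 - z.2))%:E.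
pose B (z : RT * RT) : \bar R := (b z.2 ^+ 2 / 2 * p (z.1 - z.2))%:E.
have mA : measurable_fun setT A.
  apply/measurable_EFinP; apply: measurable_funM => //.
  by apply: measurable_funM => //; exact: measurable_funX.
have mB : measurable_fun setT B.
  apply/measurable_EFinP; apply: measurable_funM => //.
  by apply: measurable_funM => //; exact: measurable_funX.
have A0 z : (0 <= A z)%E by rewrite lee_fin mulr_ge0// divr_ge0// sqr_ge0.
have B0 z : (0 <= B z)%E by rewrite lee_fin mulr_ge0// divr_ge0// sqr_ge0.
have mf : measurable_fun setT (fun z : RT * RT => (a z.1 * b z.2 * p (z.1 - z.2))%:E).
  by apply/measurable_EFinP; apply: measurable_funM => //; exact: measurable_funM.
pose F (z : RT * RT) : \bar R := (a z.1 * b z.2 * p (z.1 - z.2))%:E.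
have f0 (z : RT * RT) : (0 <= (a z.1 * b z.2 * p (z.1 - z.2))%:E)%E.
  by rewrite lee_fin !mulr_ge0.
have EA : (\int[mu]_x \int[mu]_y A (x, y) =
    \int[mu]_x (a x ^+ 2 / 2)%:E * \int[mu]_x (p x)%:E)%E.
  under eq_integral => x _.
    rewrite /A /=; under eq_integral do rewrite EFinM.
    rewrite ge0_integralZl//; first last.
    - by rewrite lee_fin divr_ge0// sqr_ge0.
    - by move=> y _; rewrite lee_fin.
    - apply/measurable_EFinP; apply: measurableT_comp => //.
      exact: measurable_funB.
    rewrite (_ : (\int[mu]_y (p (x - y))%:E)%E = (\int[mu]_y (p y)%:E)%E); last first.
      rewrite -(@ge0_integral_affine _ (-1) x (fun t => (p t)%:E))//.
      + by apply: eq_integral => y _; rewrite mulN1r addrC.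
      + by right.
      + exact/measurable_EFinP.
    over.
  rewrite ge0_integralZr//.
  - by apply/measurable_EFinP; apply: measurable_funM => //; exact: measurable_funX.
  - by move=> x _; rewrite lee_fin divr_ge0// sqr_ge0.
  - by apply: integral_ge0 => x _; rewrite lee_fin.
have EB : (\int[mu]_x \int[mu]_y B (x, y) =
    \int[mu]_x (b x ^+ 2 / 2)%:E * \int[mu]_x (p x)%:E)%E.
  rewrite (fubini_tonelli (m1 := mu) (m2 := mu) B)//.
  under eq_integral => y _.
    rewrite /B /=; under eq_integral do rewrite EFinM.
    rewrite ge0_integralZl//; first last.
    - by rewrite lee_fin divr_ge0// sqr_ge0.
    - by move=> x _; rewrite lee_fin.
    - apply/measurable_EFinP; apply: measurableT_comp => //.
      exact: measurable_funB.
    rewrite (_ : (\int[mu]_x (p (x - y))%:E)%E = (\int[mu]_y (p y)%:E)%E); last first.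
      rewrite -(@ge0_integral_affine _ 1 (- y) (fun t => (p t)%:E))//.
      + by apply: eq_integral => x _; rewrite mul1r.
      + by left.
      + exact/measurable_EFinP.
    over.
  rewrite ge0_integralZr//.
  - by apply/measurable_EFinP; apply: measurable_funM => //; exact: measurable_funX.
  - by move=> x _; rewrite lee_fin divr_ge0// sqr_ge0.
  - by apply: integral_ge0 => x _; rewrite lee_fin.
rewrite ge0_muleDl; [|by apply: integral_ge0 => x _; rewrite lee_fin divr_ge0// sqr_ge0..].
rewrite -EA -EB -ge0_integralD//; first last.
- exact: measurable_fun_fubini_tonelli_F.
- by move=> x _; apply: integral_ge0.
- exact: measurable_fun_fubini_tonelli_F.
- by move=> x _; apply: integral_ge0.
apply: ge0_le_integral => //.
- by move=> x _; apply: integral_ge0 => y _; exact: (f0 (x, y)).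
- have mF : measurable_fun setT F by [].
  have F0 z : (0 <= F z)%E := f0 z.
  exact: (@measurable_fun_fubini_tonelli_F _ _ _ _ _ mu F).
- by apply: emeasurable_funD; exact: measurable_fun_fubini_tonelli_F.
- move=> x _; rewrite -ge0_integralD//; first last.
  - exact: measurableT_comp mB (measurable_pair1 x).
  - exact: measurableT_comp mA (measurable_pair1 x).
  apply: ge0_le_integral => //.
  - by move=> y _; exact: (f0 (x, y)).
  - exact: measurableT_comp mf (measurable_pair1 x).
  - apply: emeasurable_funD.
    exact: measurableT_comp mA (measurable_pair1 x).
    exact: measurableT_comp mB (measurable_pair1 x).
  - move=> y _; rewrite /A /B /= -EFinD lee_fin -mulrDl ler_wpM2r//.
    by have := sqr_ge0 (a x - b y); rewrite !expr2; nra.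
Qed.

Lemma cintegrable_expNabs_sqr u (e : R) : 0 < e -> cintegrable mu setT u ->
  mu.-integrable setT (EFin \o (fun xi => expR (- (e * `|xi|)) * cabs (ft u xi) ^+ 2)).
Proof.
move=> e0 iu.
have b (xi : RT) : setT xi -> cabs (ft u xi) <= isq * \int[mu]_x cabs (u x).
  by move=> _; exact: le_cabs_ft.
have [_] := cintegrable_bM (T := RT) measurableT (cmeas_ft iu) b (cintegrable_ft_exp e0 iu).
apply: eq_integrable => // xi _; rewrite /comp; congr EFin.
by rewrite cabsM (cabsM _ (ft u xi)^*) cabsJ cabsC ger0_norm ?expR_ge0//; ring.
Qed.

Lemma cInt_ft_expNabs u (e : R) : 0 < e -> cintegrable mu setT u ->
  cInt mu setT (fun x => u x * ft (fun xi => (expR (- (e * `|xi|)))%:C * (ft u xi)^*) x) =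
  (\int[mu]_xi (expR (- (e * `|xi|)) * cabs (ft u xi) ^+ 2))%:C.
Proof.
move=> e0 iu; have [_ <-] := ft_fubini iu (cintegrable_ft_exp e0 iu).
have EE xi : ft u xi * ((expR (- (e * `|xi|)))%:C * (ft u xi)^*) =
    (expR (- (e * `|xi|)) * cabs (ft u xi) ^+ 2)%:C.
  by rewrite rcM -mulcJ mulrCA.
by rewrite (funext EE); apply: complexP => //=; rewrite /Rintegral integral0.
Qed.

(** The multiplication formula and Abel summation turn the left side into 1/(2 pi) times the double
    integral of u(x) against the conjugate of u(y) and the Poisson kernel at x - y. In Schur's bound
    the mass 2 pi cancels the prefactor exactly, so the constant is 1. *)
Lemma le_expNabs_ft u (e : R) : 0 < e -> cintegrable mu setT u -> L2 setT u ->
  \int[mu]_xi (expR (- (e * `|xi|)) * cabs (ft u xi) ^+ 2) <= nrm2 setT u.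
Proof.
move=> e0 iu Lu.
pose w xi := (expR (- (e * `|xi|)))%:C * (ft u xi)^*.
have iw : cintegrable mu setT w by exact: cintegrable_ft_exp.
have E := cInt_ft_expNabs e0 iu.
have mP : measurable_fun setT (poisson e).
  exact: (continuous_measurable_fun (continuous_poisson e0)).
have mcu : measurable_fun setT (fun x => cabs (u x)).
  exact: measurable_cabs iu.1.
rewrite -[leLHS]ger0_norm; last first.
  apply: Rintegral_ge0 => xi _; by rewrite mulr_ge0// ?expR_ge0// sqr_ge0.
rewrite -cabsC -E.
have iuw : cintegrable mu setT (fun x => u x * ft w x).
  under eq_fun do rewrite mulrC.
  have b (xi : RT) : setT xi -> cabs (ft w xi) <= isq * \int[mu]_x cabs (w x).
    by move=> _; exact: le_cabs_ft.
  exact: (cintegrable_bM (T := RT) measurableT (cmeas_ft iw) b iu).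
apply: le_trans (le_cabs_cInt (T := RT) measurableT iuw) _.
rewrite -lee_fin -cintegrable_fin//.
have c0 x y t : 0 <= cabs (u x) * cabs (u y) * poisson e t.
  by apply: mulr_ge0; [apply: mulr_ge0; exact: cabs_ge0|exact: poisson_ge0].
have p0 : 0 <= (2 * pi)^-1 :> R by rewrite invr_ge0 mulr_ge0// pi_ge0.
have uP (x : R) : cintegrable mu setT (fun y => (u y)^* * (poisson e (x - y))%:C).
  under eq_fun do rewrite mulrC.
  have mPx : cmeas setT (fun y : RT => (poisson e (x - y))%:C).
    by apply: cmeas_real; apply: measurableT_comp => //; exact: measurable_funB.
  have bP (y : RT) : setT y -> cabs (poisson e (x - y))%:C <= 2 / e.
    move=> _; rewrite cabsC ger0_norm ?poisson_ge0// /poisson -mulrA ler_wpM2l//.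
    rewrite ler_pdivrMr ?poisson_den_gt0// mulrDr expr2 mulKf ?gt_eqF// lerDl.
    by rewrite mulr_ge0 ?sqr_ge0// invr_ge0 ltW.
  exact: (cintegrable_bM (T := RT) measurableT mPx bP (cintegrableJ (T := RT) iu)).
have mF : measurable_fun setT (fun z : RT * RT =>
    (cabs (u z.1) * cabs (u z.2) * poisson e (z.1 - z.2))%:E).
  apply/measurable_EFinP; apply: measurable_funM.
    apply: measurable_funM.
      by apply: measurableT_comp mcu _; exact: measurable_fst.
    by apply: measurableT_comp mcu _; exact: measurable_snd.
  apply: measurableT_comp => //; apply: measurable_funB.
    exact: measurable_fst.
  exact: measurable_snd.
apply: (@le_trans _ _ (\int[mu]_x (((2 * pi)^-1)%:E *
    \int[mu]_y (cabs (u x) * cabs (u y) * poisson e (x - y))%:E))%E).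
  pose F (z : RT * RT) : \bar R := (cabs (u z.1) * cabs (u z.2) * poisson e (z.1 - z.2))%:E.
  have F0 z : (0 <= F z)%E by rewrite lee_fin c0.
  apply: ge0_le_integral => //.
  - by move=> x _; rewrite lee_fin cabs_ge0.
  - by apply/measurable_EFinP; exact: measurable_cabs iuw.1.
  - apply: measurable_funeM.
    exact: (@measurable_fun_fubini_tonelli_F _ _ _ _ _ mu F).
  move=> x _; rewrite /= cabsM ft_expNabs_ft// cabsM cabsC ger0_norm//.
  rewrite mulrCA EFinM lee_wpmul2l//.
  under eq_integral do rewrite -mulrA EFinM.
  rewrite ge0_integralZl//; first last.
  - by rewrite lee_fin cabs_ge0.
  - by move=> y _; rewrite lee_fin; apply: mulr_ge0; [exact: cabs_ge0|exact: poisson_ge0].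
  - apply/measurable_EFinP; apply: measurable_funM => //.
    by apply: measurableT_comp => //; exact: measurable_funB.
  rewrite EFinM lee_wpmul2l ?lee_fin ?cabs_ge0//.
  apply: (@le_trans _ _ (\int[mu]_y cabs ((u y)^* * (poisson e (x - y))%:C))%:E).
    by rewrite lee_fin; exact: (le_cabs_cInt (T := RT) measurableT (uP x)).
  rewrite -(cintegrable_fin (uP x)) le_eqVlt; apply/orP; left; apply/eqP.
  apply: eq_integral => y _.
  by rewrite cabsM cabsJ cabsC ger0_norm// poisson_ge0.
rewrite ge0_integralZl//; first last.
- by move=> x _; apply: integral_ge0 => y _; rewrite lee_fin c0.
- pose F (z : RT * RT) : \bar R := (cabs (u z.1) * cabs (u z.2) * poisson e (z.1 - z.2))%:E.
  by apply: (@measurable_fun_fubini_tonelli_F _ _ _ _ _ mu F) => //; move=> z; rewrite lee_fin c0.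
apply: (@le_trans _ _ (((2 * pi)^-1)%:E * ((nrm2 setT u)%:E * (2 * pi)%:E))%E).
  rewrite lee_wpmul2l// -(integral_poisson e0).
  apply: le_trans (schur_convolution _ _ _ _ _ _) _ => //.
  - by move=> x; exact: cabs_ge0.
  - by move=> x; exact: cabs_ge0.
  - by move=> x; exact: poisson_ge0.
  rewrite lee_wpmul2r//.
    by apply: integral_ge0 => x _; rewrite lee_fin poisson_ge0.
  rewrite -sqnorm2E// /sqnorm2 -ge0_integralD//.
  - rewrite le_eqVlt; apply/orP; left; apply/eqP.
    by apply: eq_integral => x _; rewrite -EFinD -splitr.
  - by move=> x _; rewrite lee_fin divr_ge0// sqr_ge0.
  - by apply/measurable_EFinP; apply: measurable_funM => //; exact: measurable_funX.
  - by move=> x _; rewrite lee_fin divr_ge0// sqr_ge0.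
  - by apply/measurable_EFinP; apply: measurable_funM => //; exact: measurable_funX.
by rewrite -!EFinM lee_fin mulrCA mulVf ?mulr1// gt_eqF// mulr_gt0// pi_gt0.
Qed.

Lemma cvg_expN_harmonic (c : R) : expR (- (n.+1%:R^-1 * c)) @[n --> \oo] --> (1 : R).
Proof.
rewrite -[X in _ --> X]expR0; apply: (cvg_comp (G := nbhs (0 : R)) _ expR); last first.
  exact: continuous_expR.
suff: - (n.+1%:R^-1 * c) @[n --> \oo] --> - (0 * c) by rewrite mul0r oppr0.
by apply: cvgN; apply: cvgMl; exact: cvg_harmonic.
Qed.

(** The Abel factor is removed by letting e = 1/(n+1) tend to 0; Fatou's lemma supplies square
    integrability and the bound together. *)
Lemma ft_contraction u : cintegrable mu setT u -> L2 setT u ->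
  L2 setT (ft u) /\ nrm2 setT (ft u) <= nrm2 setT u.
Proof.
move=> iu Lu.
(* The rate is halved so that the squared modulus carries the full Abel factor. *)
pose F (n : nat) xi := (expR (- (n.+1%:R^-1 / 2 * `|xi|)))%:C * ft u xi.
have n0 n : 0 < n.+1%:R^-1 :> R by rewrite invr_gt0.
have sF n xi : cabs (F n xi) ^+ 2 = expR (- (n.+1%:R^-1 * `|xi|)) * cabs (ft u xi) ^+ 2.
  rewrite /F cabsM cabsC ger0_norm ?expR_ge0// exprMn; congr (_ * _).
  by rewrite expr2 -expRD; congr expR; move: n.+1%:R^-1 => ?; field.
have mF n : cmeas (setT : set RT) (F n).
  apply: cmeasM; last exact: cmeas_ft.
  by apply: cmeas_real; exact: (continuous_measurable_fun (@continuous_expNabs R _)).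
have LF n : L2 setT (F n).
  apply: (le_L2 _ (g := fun xi => expR (- (n.+1%:R^-1 * `|xi|)) * cabs (ft u xi) ^+ 2)) => //.
    by move=> xi _; rewrite sF.
  exact: cintegrable_expNabs_sqr.
have lt : (sqnorm2 setT (ft u) <= (nrm2 setT u)%:E)%E.
  apply: (nrm_fatou (F := F)) => //.
  - exact: cmeas_ft.
  - apply: aeW => xi.
    have -> : (fun n => cabs (F n xi - ft u xi)) =
        (fun n => `|expR (- (n.+1%:R^-1 / 2 * `|xi|)) - 1| * cabs (ft u xi)).
      apply/funext => n; rewrite -cabsC -cabsM; congr cabs.
      by rewrite rmorphB /= mulrBl mul1r.
    rewrite -(mul0r (cabs (ft u xi))) -(normr0 R) -(subrr (1 : R)).
    apply: cvgMl; apply: cvg_norm; apply: cvgB; last exact: cvg_cst.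
    under eq_fun do rewrite -mulrA (mulrC 2^-1); exact: cvg_expN_harmonic.
  - move=> n; rewrite /nrm2; under eq_Rintegral do rewrite sF.
    exact: le_expNabs_ft.
have Lft : L2 setT (ft u).
  by split; [exact: cmeas_ft|exact: le_lt_trans lt (ltry _)].
by split => //; move: lt; rewrite sqnorm2E.
Qed.

End plancherel.

(** * Truncations and the L^2 distance *)

Section truncation.
Context {R : realType}.
Local Notation mu := (@lebesgue_measure R).
Local Notation C := R[i].
Local Notation RT := (measurableTypeR R).

Local Notation nn := (nrm (setT : set RT)).

(** The closing step of the density arguments below: [x] is a defect bounded by a fixed multiple of
    an arbitrarily small approximation error. *)
Lemma le0_eps (c x : R) : 0 <= c -> (forall e, 0 < e -> x <= c * e) -> x <= 0.
Proof.
move=> c0 H; rewrite leNgt; apply/negP => x0.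
have c1 : 0 < c + 1 by rewrite ltr_wpDl.
have := H (x / (c + 1)); rewrite divr_gt0// => /(_ isT).
by rewrite mulrA ler_pdivlMr// mulrDr mulr1 mulrC gerDl leNgt x0.
Qed.

Lemma nrmB_le0 (D : set RT) (mD : measurable D) f g : L2 D f -> L2 D g ->
  nrm D (fun x => f x - g x) <= 0 -> f = g %[ae mu in D].
Proof.
move=> Lf Lg H; apply: nrm2B_eq0 => //; rewrite -sqr_nrm.
by rewrite (_ : nrm _ _ = 0) ?expr0n//; apply/eqP; rewrite eq_le H nrm_ge0.
Qed.

Definition trunc (n : nat) (u : R -> C) : R -> C :=
  fun x => if (x : RT) \in (`[- n%:R, n%:R]%classic : set RT) then u x else 0.

Lemma truncE n u x : trunc n u x = (\1_(`[- n%:R, n%:R]%classic : set RT) x)%:C * u x.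
Proof. by rewrite /trunc indicE; case: ifP => _; rewrite ?mul1r ?mul0r. Qed.

Lemma cmeas_trunc n u : cmeas (setT : set RT) u -> cmeas (setT : set RT) (trunc n u).
Proof.
move=> mu_; rewrite (funext (truncE n u)); apply: cmeasM => //.
by apply: cmeas_real; exact: measurable_indic.
Qed.

Lemma L2_trunc n u : L2 setT u -> L2 setT (trunc n u).
Proof.
move=> Lu; rewrite (funext (truncE n u)).
pose I : set RT := `[- n%:R, n%:R]%classic.
have m1 : cmeas (setT : set RT) (fun x => (\1_I x : R)%:C).
  by apply: cmeas_real; rewrite /I; exact: measurable_indic.
have b1 (x : R) : (setT : set RT) x -> cabs (\1_I x : R)%:C <= 1.
  by move=> _; rewrite cabsC indicE; case: (_ \in _); rewrite /= ?normr1 ?normr0.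
exact: (L2_bM measurableT m1 b1 Lu).
Qed.

Lemma integrable_indic_itv (p q : bool) (a b : R) :
  mu.-integrable setT
    (EFin \o (\1_([set` Interval (BSide p a) (BSide q b)] : set RT) : RT -> R)).
Proof.
set I : set RT := [set` _]; have mI : measurable I by exact: measurable_itv.
apply/integrableP; split; first exact/measurable_EFinP/measurable_indic.
rewrite (eq_integral (fun x => (\1_I x)%:E)); last first.
  by move=> x _ /=; rewrite ger0_norm// indicE.
rewrite integral_indic// setIT.
suff : (mu [set` Interval (BSide p a) (BSide q b)] < +oo)%E by [].
by rewrite lebesgue_measure_itv/=; case: ifP => _; rewrite ?ltry// -EFinB ltry.
Qed.

(** On a bounded interval |u| <= 1 + |u|^2, and both terms are integrable there. *)
Lemma cintegrable_trunc n u : L2 setT u -> cintegrable mu setT (trunc n u).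
Proof.
move=> Lu; pose I : set RT := `[- n%:R, n%:R]%classic.
apply: (le_cintegrable (T := RT) measurableT
  (g := fun x => \1_I x + cabs (u x) ^+ 2)).
- exact: cmeas_trunc (L2_cmeas Lu).
- move=> x _; rewrite truncE cabsM cabsC indicE ger0_norm// -/I.
  have := cabs_ge0 (u x); case: (_ \in _) => /= c0; rewrite ?mul1r ?mul0r ?add0r ?sqr_ge0//.
  by have := sqr_ge0 (cabs (u x) - 1); rewrite !expr2; nra.
- rewrite /comp; under eq_fun do rewrite EFinD.
  apply: integrableD => //; first exact: integrable_indic_itv.
  exact: L2_int Lu.
Qed.

Definition dist (u v : R -> C) : R := nn (fun x => u x - v x).

Lemma dist_ge0 u v : 0 <= dist u v. Proof. exact: nrm_ge0. Qed.

Lemma dist_sym u v : dist u v = dist v u.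
Proof. exact: nrmB_sym. Qed.

Lemma dist_tri u v w : L2 setT u -> L2 setT v -> L2 setT w ->
  dist u w <= dist u v + dist v w.
Proof. exact: le_nrmB3. Qed.

Lemma distxx u : dist u u = 0.
Proof.
rewrite /dist /nrm /nrm2.
rewrite [X in Num.sqrt X](_ : _ = 0) ?sqrtr0//.
rewrite /Rintegral (eq_integral (fun=> 0%E)) ?integral0// => x _.
by rewrite subrr cabs0 expr0n.
Qed.

End truncation.

(* The reification of [lra] would unfold the distances. *)
Ltac dist_lra :=
  repeat match goal with H : context [dist _ _] |- _ => revert H end;
  repeat match goal with |- context [cabs ?a * dist ?f ?g] =>
    let t := fresh "t" in generalize (cabs a * dist f g); intro t end;
  repeat match goal with |- context [dist ?f ?g] =>
    let t := fresh "t" in generalize (dist f g); intro t end;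
  intros; lra.

(** * Extension of the Fourier transform to L^2 *)

Section fourier_L2.
Context {R : realType}.
Local Notation mu := (@lebesgue_measure R).
Local Notation C := R[i].
Local Notation RT := (measurableTypeR R).

Local Notation nn := (nrm (setT : set RT)).

Lemma cvg_trunc u : L2 setT u -> dist u (trunc n u) @[n --> \oo] --> (0 : R).
Proof.
move=> Lu; have mu_ := L2_cmeas Lu.
rewrite /dist; apply: (nrm_dct (G := fun x => cabs (u x) ^+ 2)) => //.
- by move=> n; exact: cmeas_trunc.
- move=> x _; have := archi_boundP (normr_ge0 x).
  set N := Num.bound _ => xN.
  apply/cvgrPdist_le => e e0; near=> n.
  rewrite /trunc mem_set ?subrr ?cabs0 ?subr0 ?normr0 ?ltW//=.
  have : `|x| <= n%:R by apply: le_trans (ltW xN) _; rewrite ler_nat; near: n; exact: nbhs_infty_ge.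
  by rewrite ler_norml in_itv /=.
- move=> n x _; rewrite /trunc; case: ifP => _; last by rewrite subr0.
  by rewrite subrr cabs0 expr0n sqr_ge0.
- exact: L2_int Lu.
Unshelve. all: by end_near. Qed.

Lemma L1_dense u (e : R) : L2 setT u -> 0 < e ->
  exists w, [/\ cintegrable mu setT w, L2 setT w & dist u w <= e].
Proof.
move=> Lu e0; have /cvgrPdist_le/(_ _ e0)[N _ H] := cvg_trunc Lu.
exists (trunc N u); split; [exact: cintegrable_trunc|exact: L2_trunc|].
by have := H N (leqnn N); rewrite sub0r normrN ger0_norm ?dist_ge0.
Qed.

Lemma ft_linear (a : C) f g : cintegrable mu setT f -> cintegrable mu setT g ->
  ft (fun x => a * f x + g x) = (fun x => a * ft f x + ft g x).
Proof.
move=> jf jg; apply/funext => xi; rewrite /ft.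
under eq_cInt do rewrite mulrDl -mulrA.
have c1 := cintegrable_cis (measurable_mulN xi) jf.
have c2 := cintegrable_cis (measurable_mulN xi) jg.
rewrite (cIntD (T := RT) measurableT (cintegrableZ (T := RT) measurableT a c1) c2).
by rewrite (cIntZ (T := RT) measurableT a c1) mulrDr mulrCA.
Qed.

Lemma ftB f g : cintegrable mu setT f -> cintegrable mu setT g ->
  (fun x => ft f x - ft g x) = ft (fun x => f x - g x).
Proof.
move=> jf jg; have := ft_linear (-1) jg jf.
under eq_fun do rewrite mulN1r addrC; move=> ->.
by apply/funext => x; rewrite mulN1r addrC.
Qed.

Lemma nrm_ft u : cintegrable mu setT u -> L2 setT u -> nn (ft u) <= nn u.
Proof. by move=> iu Lu; rewrite /nrm ler_wsqrtr//; case: (ft_contraction iu Lu). Qed.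

Lemma nrm_ftB f g : cintegrable mu setT f -> cintegrable mu setT g ->
  L2 setT f -> L2 setT g ->
  dist (ft f) (ft g) <= dist f g.
Proof.
move=> jf jg Lf Lg; rewrite /dist ftB//; apply: nrm_ft.
  exact: (cintegrableB (T := RT)).
exact: L2B.
Qed.

Lemma L2_ft u : cintegrable mu setT u -> L2 setT u -> L2 setT (ft u).
Proof. by move=> iu Lu; case: (ft_contraction iu Lu). Qed.

(** Contractivity makes the transforms of the truncations a Cauchy sequence, and completeness yields
    the function that [xget] is to select in [fourier]. *)
Lemma fourier_exists u : L2 setT u -> exists g, L2 setT g /\
  (fun n : nat => sqnorm2 (R := R) setT
       (fun xi => g xi - fourier_integral `[- n%:R, n%:R] u xi)) @ \oo --> 0%E.
Proof.
move=> Lu; pose F n := ft (trunc n u).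
have LF n : L2 setT (F n) by apply: L2_ft; [exact: cintegrable_trunc|exact: L2_trunc].
have [|g Lg Hg] := L2_complete LF.
  move=> e e0; have e20 : 0 < e / 2 by rewrite divr_gt0.
  have /cvgrPdist_le/(_ _ e20)[N _ H] := cvg_trunc Lu.
  exists N => m n Nm Nn.
  have {}H k : (N <= k)%N -> dist u (trunc k u) <= e / 2.
    by move=> /H; rewrite sub0r normrN ger0_norm ?dist_ge0.
  have it k := cintegrable_trunc k Lu; have Lt k := L2_trunc k Lu.
  apply: le_trans (nrm_ftB (it m) (it n) (Lt m) (Lt n)) _.
  apply: le_trans (dist_tri (Lt m) Lu (Lt n)) _.
  by rewrite (splitr e) lerD//; [rewrite dist_sym; exact: H|exact: H].
exists g; split => //.
have -> : (fun n : nat => sqnorm2 (R := R) setT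
    (fun xi => g xi - fourier_integral `[- n%:R, n%:R] u xi)) =
    (fun n => (dist g (F n) ^+ 2)%:E).
  apply/funext => n; have LB : L2 setT (fun xi => g xi - F n xi) by exact: L2B.
  rewrite /dist sqr_nrm -(sqnorm2E measurableT LB).
  by congr sqnorm2; apply/funext => xi; rewrite fourier_integral_restrict.
apply: cvg_EFin; first exact: nearW.
suff H : dist g (F n) @[n --> \oo] --> (0 : R).
  by have H2 := cvgM H H; rewrite mul0r in H2; exact: H2.
apply/cvgrPdist_le => e e0; have [N H] := Hg _ e0.
exists N => // n /= Nn; rewrite sub0r normrN ger0_norm ?dist_ge0//; exact: H.
Qed.

(** Here the [xget] in the definition of [fourier] is opened; later facts rest on this limit
    only. *)
Lemma fourier_spec u : L2 setT u -> L2 setT (fourier u) /\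
  dist (fourier u) (ft (trunc n u)) @[n --> \oo] --> (0 : R).
Proof.
move=> Lu; have [g Hg] := fourier_exists Lu.
have [Lfu cv] : L2 setT (fourier u) /\
  (fun n : nat => sqnorm2 (R := R) setT
       (fun xi => fourier u xi - fourier_integral `[- n%:R, n%:R] u xi)) @ \oo --> 0%E.
  by rewrite /fourier; case: xgetP => [g' _ //|/(_ g)].
split => //.
have H : (nrm2 setT (fun xi => fourier u xi - ft (trunc n u) xi))%:E @[n --> \oo] --> 0%:E.
  rewrite [X in X @ _](_ : _ = (fun n : nat => sqnorm2 (R := R) setT
       (fun xi => fourier u xi - fourier_integral `[- n%:R, n%:R] u xi)))//.
  apply/funext => n.
  have LB : L2 setT (fun xi => fourier u xi - ft (trunc n u) xi).
    by apply: L2B => //; apply: L2_ft; [exact: cintegrable_trunc|exact: L2_trunc].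
  rewrite -(sqnorm2E measurableT LB).
  by congr sqnorm2; apply/funext => xi; rewrite fourier_integral_restrict.
have {}H := fine_cvg H.
rewrite -(sqrtr0 R); apply: (cvg_comp (G := nbhs (0 : R)) _ Num.sqrt); first exact: H.
exact: sqrt_continuous.
Qed.

Lemma L2_fourier (u : R -> C) : L2 setT u -> L2 setT (fourier u).
Proof. by case/fourier_spec. Qed.

(** The bridge from [ft] to [fourier]. It is proved through truncations of [u], which are at once
    near [u] and have transforms near [fourier u], and it transfers each property of [ft] by
    approximation. *)
Lemma le_nrm_fourier_ft (u w : R -> C) : L2 setT u -> cintegrable mu setT w -> L2 setT w ->
  dist (fourier u) (ft w) <= dist u w.
Proof.
move=> Lu iw Lw; rewrite -subr_le0; apply: (@le0_eps _ 2) => // e e0.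
have [LT cv] := fourier_spec Lu.
have /cvgrPdist_le/(_ _ e0)[N _ H] := cvg_trunc Lu.
have /cvgrPdist_le/(_ _ e0)[M _ H'] := cv.
pose n := maxn N M.
have {H} := H n (leq_maxl _ _); rewrite sub0r normrN ger0_norm ?dist_ge0// => H.
have {H'} := H' n (leq_maxr _ _); rewrite sub0r normrN ger0_norm ?dist_ge0// => H'.
have it := cintegrable_trunc n Lu; have Lt := L2_trunc n Lu.
have h1 := dist_tri LT (L2_ft it Lt) (L2_ft iw Lw).
have h2 := nrm_ftB it iw Lt Lw.
have h3 := dist_tri Lt Lu Lw.
have h4 := dist_sym u (trunc n u).
by rewrite lerBlDr; dist_lra.
Qed.

Lemma fourier_L1 u : L2 setT u -> cintegrable mu setT u ->
  fourier u = ft u %[ae mu in (setT : set RT)].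
Proof.
move=> Lu iu; apply: nrmB_le0 => //; [exact: L2_fourier|exact: L2_ft|].
apply: le_trans (le_nrm_fourier_ft Lu iu Lu) _.
by rewrite distxx.
Qed.

Lemma nrm_fourierB (u v : R -> C) : L2 setT u -> L2 setT v ->
  dist (fourier u) (fourier v) <= dist u v.
Proof.
move=> Lu Lv; rewrite -subr_le0; apply: (@le0_eps _ 4) => // e e0.
have [w [iw Lw uw]] := L1_dense Lu e0.
have h1 := dist_tri (L2_fourier Lu) (L2_ft iw Lw) (L2_fourier Lv).
have h2 := le_nrm_fourier_ft Lu iw Lw.
have h3 := le_nrm_fourier_ft Lv iw Lw.
have h4 := dist_sym (fourier v) (ft w).
have h5 := dist_tri Lv Lu Lw.
have h6 := dist_sym u v.
by rewrite lerBlDr; dist_lra.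
Qed.

Lemma fourier_ae (u v : R -> C) : L2 setT u -> L2 setT v -> u = v %[ae mu in (setT : set RT)] ->
  fourier u = fourier v %[ae mu in (setT : set RT)].
Proof.
move=> Lu Lv uv; apply: nrmB_le0 => //; [exact: L2_fourier..|].
apply: le_trans (nrm_fourierB Lu Lv) _.
by rewrite /dist /nrm ae_eq_nrm2B// sqrtr0.
Qed.

Lemma dist_lin (a : C) u v u' v' : L2 setT u -> L2 setT v -> L2 setT u' -> L2 setT v' ->
  @dist R (fun x => a * u x + v x) (fun x => a * u' x + v' x) <=
  cabs a * dist u u' + dist v v'.
Proof.
move=> Lu Lv Lu' Lv'; rewrite /dist -nrmZ//; last exact: L2B.
rewrite [leLHS](_ : _ = nn (fun x => a * (u x - u' x) + (v x - v' x))).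
  apply: le_nrmD => //; last exact: L2B.
  by apply: L2Z => //; exact: L2B.
by congr nrm; apply/funext => x; ring.
Qed.

Lemma fourier_linear (a : C) f g : L2 setT f -> L2 setT g ->
  fourier (fun x => a * f x + g x) = (fun x => a * fourier f x + fourier g x)
    %[ae mu in (setT : set RT)].
Proof.
move=> Lf Lg.
have Lh u v : L2 setT u -> L2 setT v -> L2 setT (fun x => a * u x + v x).
  by move=> Lu Lv; apply: L2D => //; exact: L2Z.
have Lin := Lh _ _ Lf Lg; have Lout := Lh _ _ (L2_fourier Lf) (L2_fourier Lg).
apply: nrmB_le0 => //; first exact: L2_fourier.
have a0 := cabs_ge0 a.
apply: (@le0_eps _ (2 * cabs a + 2)); first by rewrite addr_ge0// mulr_ge0.
move=> e e0.
have [w [iw Lw fw]] := L1_dense Lf e0.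
have [z [iz Lz gz]] := L1_dense Lg e0.
pose wz : R -> C := fun x => a * w x + z x.
have E : (fun x => a * ft w x + ft z x) = ft wz := esym (ft_linear a iw iz).
have iwz : cintegrable mu setT wz.
  by apply: (cintegrableD (T := RT)) => //; exact: (cintegrableZ (T := RT)).
have Lwz : L2 setT wz := Lh _ _ Lw Lz.
have h1 := le_nrm_fourier_ft Lin iwz Lwz.
have h2 : @dist R _ wz <= _ := dist_lin a Lf Lg Lw Lz.
have h3 := dist_lin a (L2_ft iw Lw) (L2_ft iz Lz) (L2_fourier Lf) (L2_fourier Lg).
rewrite E in h3.
have h4 := dist_tri (L2_fourier Lin) (L2_ft iwz Lwz) Lout.
have h5 := le_nrm_fourier_ft Lf iw Lw.
have h6 := le_nrm_fourier_ft Lg iz Lz.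
rewrite dist_sym in h5; rewrite dist_sym in h6.
have h7 : cabs a * dist f w <= cabs a * e by rewrite ler_wpM2l.
have h8 : cabs a * dist (ft w) (fourier f) <= cabs a * e.
  by rewrite ler_wpM2l// (le_trans h5).
rewrite -/(@dist R (fourier _) (fun x => a * fourier f x + fourier g x)).
dist_lra.
Qed.

Lemma dist_ae u v : L2 setT u -> L2 setT v -> u = v %[ae mu in (setT : set RT)] ->
  dist u v = 0.
Proof. by move=> Lu Lv uv; rewrite /dist /nrm (ae_eq_nrm2B measurableT Lu Lv uv) sqrtr0. Qed.

End fourier_L2.

(** * Inversion and unitarity of the Fourier transform *)

Section inversion.
Context {R : realType}.
Local Notation mu := (@lebesgue_measure R).
Local Notation C := R[i].
Local Notation RT := (measurableTypeR R).

Local Notation nn := (nrm (setT : set RT)).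


Definition refl (u : R -> C) (x : R) : C := u (- x).

Lemma cmeas_refl u : cmeas (setT : set RT) u -> cmeas (setT : set RT) (refl u).
Proof.
move=> mu_; apply: (cmeas_comp (phi := fun x : RT => - x : RT)) => //.
exact: (@oppr_measurable R setT).
Qed.

Lemma sqnorm2_refl u : cmeas (setT : set RT) u ->
  sqnorm2 setT (refl u) = sqnorm2 setT u.
Proof.
move=> mu_; rewrite /sqnorm2.
rewrite -(@ge0_integral_affine _ (-1) 0 (fun x => (cabs (u x) ^+ 2)%:E)).
- by apply: eq_integral => x _; rewrite addr0 mulN1r.
- by right.
- exact: measurable_cabs2.
- by move=> x; rewrite lee_fin sqr_ge0.
Qed.

Lemma L2_refl u : L2 setT u -> L2 setT (refl u).
Proof.
by move=> Lu; split; [exact: cmeas_refl (L2_cmeas Lu)|rewrite sqnorm2_refl; case: Lu].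
Qed.

Lemma nrm_refl u : L2 setT u -> nn (refl u) = nn u.
Proof.
move=> Lu; rewrite /nrm; congr Num.sqrt; apply: EFin_inj.
by rewrite -!sqnorm2E//; [rewrite sqnorm2_refl//; case: Lu|exact: L2_refl].
Qed.

Lemma dist_refl u v : L2 setT u -> L2 setT v -> dist (refl u) (refl v) = dist u v.
Proof. by move=> Lu Lv; rewrite /dist -(nrm_refl (L2B measurableT Lu Lv)). Qed.

Lemma cintegrable_refl u : cintegrable mu setT u -> cintegrable mu setT (refl u).
Proof.
move=> iu; have := cintegrable_affine 0 (or_intror erefl : -1 = 1 \/ -1 = -1 :> R) iu.
by under eq_fun do rewrite addr0 mulN1r.
Qed.

Lemma ft_refl u : cintegrable mu setT u -> ft (refl u) = refl (ft u).
Proof.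
move=> iu; apply/funext => xi; rewrite /refl /ft; congr (_ * _).
have m := (cintegrable_cis (measurable_mulN (- xi)) iu).1.
rewrite -(cInt_affine 0 (or_intror erefl : -1 = 1 \/ -1 = -1 :> R) m).
by apply: eq_cInt => x _; rewrite addr0 mulN1r mulrNN.
Qed.

Lemma fourier_refl u : L2 setT u ->
  fourier (refl u) = refl (fourier u) %[ae mu in (setT : set RT)].
Proof.
move=> Lu; have LRu := L2_refl Lu.
apply: nrmB_le0 => //; [exact: L2_fourier|exact: L2_refl (L2_fourier Lu)|].
rewrite -/(dist (fourier (refl u)) (refl (fourier u))).
apply: (@le0_eps _ 2) => // e e0.
have [w [iw Lw uw]] := L1_dense Lu e0.
have h1 := le_nrm_fourier_ft LRu (cintegrable_refl iw) (L2_refl Lw).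
rewrite (dist_refl Lu Lw) ft_refl// in h1.
have h2 := le_nrm_fourier_ft Lu iw Lw.
rewrite -(dist_refl (L2_fourier Lu) (L2_ft iw Lw)) dist_sym in h2.
have h3 := dist_tri (L2_fourier LRu) (L2_refl (L2_ft iw Lw)) (L2_refl (L2_fourier Lu)).
dist_lra.
Qed.

Lemma nrm_dist0 u : nn u = dist u (fun=> 0).
Proof. by congr nrm; apply/funext => x; rewrite subr0. Qed.

Lemma nrm_fourier_le u : L2 setT u -> nn (fourier u) <= nn u.
Proof.
move=> Lu; rewrite !nrm_dist0 -subr_le0; apply: (@le0_eps _ 2) => // e e0.
have [w [iw Lw uw]] := L1_dense Lu e0.
have h1 := le_nrm_fourier_ft Lu iw Lw.
have h2 := dist_tri (L2_fourier Lu) (L2_ft iw Lw) (L20 measurableT).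
have h3 := nrm_ft iw Lw; rewrite !nrm_dist0 in h3.
have h4 := dist_tri Lw Lu (L20 measurableT).
have h5 := dist_sym u w.
by rewrite lerBlDr; dist_lra.
Qed.

Lemma dotJ f g : dotL2 setT f (fun x => (g x)^*) = cInt mu setT (fun x => f x * g x).
Proof. by apply: eq_cInt => x _; rewrite conjCK. Qed.

Lemma nrmJ g : nn (fun x => (g x)^*) = nn g.
Proof. by congr Num.sqrt; apply: eq_Rintegral => x _; rewrite cabsJ. Qed.

Lemma le_cabs_cIntM f g : L2 setT f -> L2 setT g ->
  cabs (cInt mu setT (fun x => f x * g x)) <= nn f * nn g.
Proof.
by move=> Lf Lg; rewrite -dotJ -(nrmJ g); apply: le_cabs_dot => //; exact: L2J.
Qed.

Lemma cIntMBl f g h : L2 setT f -> L2 setT g -> L2 setT h ->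
  cInt mu setT (fun x => f x * h x) - cInt mu setT (fun x => g x * h x) =
  cInt mu setT (fun x => (f x - g x) * h x).
Proof.
move=> Lf Lg Lh; rewrite -(cIntB (T := RT) measurableT).
- by apply: eq_cInt => x _; rewrite mulrBl.
- exact: cintegrable_L2M.
- exact: cintegrable_L2M.
Qed.

(** One factor is merely in L^2 now. Replacing it by an integrable approximant costs two errors, one
    on each side, both controlled by Cauchy-Schwarz and contractivity. *)
Lemma fourier_multiplication f g : L2 setT g -> cintegrable mu setT f -> L2 setT f ->
  cInt mu setT (fun x => fourier g x * f x) = cInt mu setT (fun x => g x * ft f x).
Proof.
move=> Lg jf Lf; apply/eqP; rewrite -subr_eq0; apply/eqP/cabs_eq0/le_anti.
rewrite cabs_ge0 andbT; apply: (@le0_eps _ (2 * nn f)).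
  by rewrite mulr_ge0// nrm_ge0.
move=> e e0; have [w [iw Lw gw]] := L1_dense Lg e0.
have [_ E] := ft_fubini iw jf.
have Lfg := L2_fourier Lg; have Lfw := L2_ft iw Lw; have Lff := L2_ft jf Lf.
rewrite (_ : _ - _ = cInt mu setT (fun x => (fourier g x - ft w x) * f x) +
  cInt mu setT (fun x => (w x - g x) * ft f x)); last first.
  by rewrite -!cIntMBl// E; ring.
apply: le_trans (cabsD _ _) _.
rewrite mulrAC mulr2n mulrDl mul1r mulrDl lerD//.
  apply: le_trans (le_cabs_cIntM (L2B measurableT Lfg Lfw) Lf) _.
  rewrite ler_wpM2r ?nrm_ge0//.
  by apply: le_trans gw; exact: le_nrm_fourier_ft.
apply: le_trans (le_cabs_cIntM (L2B measurableT Lw Lg) Lff) _.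
apply: ler_pM; [exact: nrm_ge0|exact: nrm_ge0| |exact: nrm_ft].
by rewrite -/(dist w g) dist_sym.
Qed.

Lemma Rintegral_FTC_itv (f F : R -> R) (a b : R) : a < b -> continuous f ->
  (forall x : R, is_derive x 1 F (f x)) -> \int[mu]_(x in `]a, b]) f x = F b - F a.
Proof.
move=> ab cf dF; have cF := continuous_of_derive dF.
rewrite Rintegral_itv_obnd_cbnd; last first.
  apply: (@integrableS _ _ _ mu `[a, b]%classic); [exact: measurable_itv|exact: measurable_itv| |].
    by apply: subset_itvr; rewrite bnd_simp.
  by apply: continuous_compact_integrable; [exact: segment_compact|exact: continuous_subspaceT].
rewrite /Rintegral (continuous_FTC2 ab (F := F)) //.
- exact: continuous_subspaceT.
- split.
  + by move=> x _; have [] := dF x.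
  + exact: cvg_at_right_filter (cF a).
  + exact: cvg_at_left_filter (cF b).
- by move=> x _; rewrite derive1E; have [_ ->] := dF x.
Qed.

Lemma Rintegral_poisson_itv (e a b x : R) : 0 < e -> a < b ->
  \int[mu]_(y in `]a, b]) poisson e (x - y) =
  2 * atan ((b - x) / e) + 2 * atan ((x - a) / e).
Proof.
move=> e0 ab.
have dF (y : R) : is_derive y 1 (fun y => 2 * atan ((y - x) / e)) (poisson e (x - y)).
  rewrite (_ : poisson e (x - y) = poisson e (y - x) * 1); last first.
    by rewrite mulr1 /poisson -(opprB y x) sqrrN.
  apply: (@is_derive1_comp _ (fun t => 2 * atan (t / e)) (fun y => y - x)).
    exact: is_derive_atan_div.
  by apply: is_derive_eq; rewrite subr0.
have cP : continuous (fun y => poisson e (x - y)).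
  move=> y; apply: (@cvg_comp _ _ _ (fun y => x - y) (poisson e)); last exact: continuous_poisson.
  by apply: cvgB; [exact: cvg_cst|exact: cvg_id].
rewrite (Rintegral_FTC_itv ab cP dF).
by rewrite -(opprB x a) mulNr atanN mulrN opprK.
Qed.

Lemma cvg_atan_harmonic (c : R) : 0 < c ->
  atan (c / n.+1%:R^-1) @[n --> \oo] --> (pi / 2 : R).
Proof.
move=> c0.
have H : c / n.+1%:R^-1 @[n --> \oo] --> +oo.
  under eq_fun do rewrite invrK mulrC.
  apply/cvgryPge => A; near=> n.
  rewrite -ler_pdivrMr//; apply: (@le_trans _ _ n%:R); last by rewrite ler_nat.
  by near: n; exact: nbhs_infty_ger.
exact: (cvg_comp _ _ H (@cvgy_atan R)).
Unshelve. all: by end_near. Qed.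

Definition ind (a b x : R) : C := (\1_(`]a, b]%classic : set RT) x : R)%:C.

Lemma cmeas_ind a b : cmeas (setT : set RT) (ind a b).
Proof. by apply: cmeas_real; exact: measurable_indic. Qed.

Lemma cabs_ind a b x : cabs (ind a b x) = \1_(`]a, b]%classic : set RT) x.
Proof. by rewrite cabsC ger0_norm// indicE. Qed.

Lemma cabs_ind2 a b x : cabs (ind a b x) ^+ 2 = \1_(`]a, b]%classic : set RT) x.
Proof. by rewrite cabs_ind indicE; case: (_ \in _); rewrite ?expr1n ?expr0n. Qed.

Lemma cintegrable_ind a b : cintegrable mu setT (ind a b).
Proof.
split; first exact: cmeas_ind.
under eq_fun do rewrite cabs_ind; exact: integrable_indic_itv.
Qed.

Lemma L2_ind a b : L2 setT (ind a b).
Proof.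
apply: (le_L2 measurableT (g := \1_(`]a, b]%classic : set RT))).
- exact: cmeas_ind.
- by move=> x _; rewrite cabs_ind2.
- exact: integrable_indic_itv.
Qed.

Lemma nrm2_ind a b : a < b -> nrm2 setT (ind a b) = b - a.
Proof.
move=> ab; rewrite /nrm2; under eq_Rintegral do rewrite cabs_ind2.
rewrite /Rintegral integral_indic// setIT.
have H : (mu `]a, b] = (b - a)%:E)%E.
  by rewrite lebesgue_measure_itv/= lte_fin ab -EFinB.
exact: (congr1 fine H).
Qed.

Lemma cInt_ind a b (f : R -> R) :
  cInt mu setT (fun x => ind a b x * (f x)%:C) = (\int[mu]_(x in `]a, b]) f x)%:C.
Proof.
have E x : ind a b x * (f x)%:C = ((f \_ (`]a, b]%classic : set RT)) x)%:C.
  rewrite -rcM patchE indicE; case: ifP => _; first by rewrite mul1r.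
  by rewrite mul0r.
rewrite (funext E); apply: complexP => /=; last by rewrite /Rintegral integral0.
by rewrite [RHS]Rintegral_mkcond.
Qed.

(** Abel summation leaves the Poisson kernel integrated over []a, b]], whose primitive is an
    arctangent. *)
Lemma expNabs_ft_ind (e a b : R) : 0 < e -> a < b ->
  \int[mu]_xi (expR (- (e * `|xi|)) * cabs (ft (ind a b) xi) ^+ 2) =
  \int[mu]_(x in `]a, b]) (pi^-1 * (atan ((b - x) / e) + atan ((x - a) / e))).
Proof.
move=> e0 ab; apply: (congr1 (@complex.Re R) (x := _%:C) (y := _%:C)).
rewrite -cInt_ft_expNabs//; last exact: cintegrable_ind.
rewrite -cInt_ind; apply: eq_cInt => x _; congr (_ * _).
rewrite ft_expNabs_ft//; last exact: cintegrable_ind.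
under eq_cInt do rewrite conjcR.
rewrite cInt_ind -rcM Rintegral_poisson_itv//; congr (_%:C).
by rewrite -mulrDr mulrA invfM (mulrC 2^-1) mulfVK.
Qed.

(** Inside the interval both arctangents tend to pi/2, so the integrand tends to 1; it is bounded by
    1 everywhere. *)
Lemma cvg_expNabs_ft_ind (a b : R) : a < b ->
  \int[mu]_xi (expR (- (n.+1%:R^-1 * `|xi|)) * cabs (ft (ind a b) xi) ^+ 2)
    @[n --> \oo] --> b - a.
Proof.
move=> ab.
have n0 n : 0 < n.+1%:R^-1 :> R by rewrite invr_gt0.
pose F n x : R := pi^-1 * (atan ((b - x) / n.+1%:R^-1) + atan ((x - a) / n.+1%:R^-1)).
have p0 : 0 < pi^-1 :> R by rewrite invr_gt0 pi_gt0.
have mF n : measurable_fun setT (F n).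
  apply: measurable_funM => //; apply: measurable_funD.
    apply: (@measurableT_comp _ _ _ _ _ _ (@atan R)); first exact: continuous_measurable_fun (@continuous_atan R).
    by apply: measurable_funM => //; exact: measurable_funB.
  apply: (@measurableT_comp _ _ _ _ _ _ (@atan R)); first exact: continuous_measurable_fun (@continuous_atan R).
  by apply: measurable_funM => //; exact: measurable_funB.
have Ib : mu.-integrable (`]a, b]%classic : set RT) (cst 1%:E).
  apply/integrableP; split=> //; rewrite (eq_integral (cst 1%:E)).
    rewrite integral_cst//= mul1e lebesgue_measure_itv/=.
    by case: ifP => _; rewrite ?ltry// -EFinB ltry.
  by move=> x _ /=; rewrite normr1.
have FE n : \int[mu]_xi (expR (- (n.+1%:R^-1 * `|xi|)) * cabs (ft (ind a b) xi) ^+ 2) =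
    fine (\int[mu]_(x in `]a, b]) (F n x)%:E)%E by rewrite expNabs_ft_ind.
under eq_fun do rewrite FE.
have ba : (\int[mu]_(x in `]a, b]) (cst 1%:E x) = (b - a)%:E)%E.
  by rewrite integral_cst//= mul1e lebesgue_measure_itv/= lte_fin ab -EFinB.
apply: fine_cvg; rewrite -ba.
have m1 n : measurable_fun `]a, b]%classic (fun x => (F n x)%:E).
  by apply/measurable_EFinP; apply: measurable_funTS; exact: mF.
have m3 : {ae mu, forall x, `]a, b]%classic x -> (F n x)%:E @[n --> \oo] --> cst 1%:E x}.
  (* At x = b one arctangent vanishes and the limit is 1/2 instead of 1; this point is discarded. *)
  have : {ae mu, forall x : R, x != b}.
    exists [set b]; split => //; first exact: lebesgue_measure_set1.
    by move=> x /= /negP; rewrite negbK => /eqP.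
  apply: ae_imply => x xb; rewrite /= in_itv /= => /andP[ax xb'].
  apply: cvg_EFin; first exact: nearW.
  have -> : (1 : R) = pi^-1 * (pi / 2 + pi / 2).
    by rewrite -splitr mulVf// gt_eqF// pi_gt0.
  apply: cvgMr; apply: cvgD; apply: cvg_atan_harmonic; rewrite subr_gt0//.
  by rewrite lt_neqAle xb.
have m5 : {ae mu, forall x n, `]a, b]%classic x -> (`|(F n x)%:E| <= cst 1%:E x)%E}.
  apply: aeW => x n _; rewrite /= lee_fin.
  rewrite /F normrM gtr0_norm// mulrC ler_pdivrMr ?pi_gt0// mul1r.
  apply: le_trans (ler_normD _ _) _; rewrite [leRHS]splitr lerD// ler_norml.
    by rewrite !ltW// (atan_ltpi2, atan_gtNpi2).
  by rewrite !ltW// (atan_ltpi2, atan_gtNpi2).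
by have [_ _] := @dominated_convergence _ _ R mu `]a, b]%classic (measurable_itv _)
  (fun n x => (F n x)%:E) (cst 1%:E) (cst 1%:E) m1 (measurable_cst _) m3 Ib m5.
Qed.

(** One inequality is contractivity. For the other, the Abel-regularized integrals lie below the
    squared norm of the transform and tend to b - a. *)
Lemma nrm2_ft_ind a b : a < b -> nrm2 setT (ft (ind a b)) = b - a.
Proof.
move=> ab; have iI := cintegrable_ind a b; have LI := L2_ind a b.
apply/le_anti/andP; split.
  by rewrite -(nrm2_ind ab); case: (ft_contraction iI LI).
have H := cvg_expNabs_ft_ind ab.
rewrite -(cvg_lim (@norm_hausdorff _ R) H); apply: limr_le; first by apply/cvg_ex; eexists; exact: H.
apply: nearW => n; apply: le_Rintegral => //.
- by apply: cintegrable_expNabs_sqr => //; rewrite invr_gt0.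
- exact: L2_int (L2_ft iI LI).
- move=> xi _; rewrite ler_piMl ?sqr_ge0// -expR0 ler_expR oppr_le0.

Qed.

Lemma ftJ_ind a b xi : (ft (ind a b) xi)^* = ft (ind a b) (- xi).
Proof.
have c := cintegrable_cis (measurable_mulN xi) (cintegrable_ind a b).
rewrite /ft conjcM conjcR -(cIntJ (T := RT) measurableT c); congr (_ * _).
by apply: eq_cInt => x _; rewrite conjcM conjcR cisJ mulrN.
Qed.

Definition ifourier (g : R -> C) := refl (fourier g).

Lemma L2_ifourier g : L2 setT g -> L2 setT (ifourier g).
Proof. by move=> Lg; exact/L2_refl/L2_fourier. Qed.

Lemma dist_ifourier f g : L2 setT f -> L2 setT g ->
  dist (ifourier f) (ifourier g) <= dist f g.
Proof.
by move=> Lf Lg; rewrite dist_refl; [exact: nrm_fourierB|exact: L2_fourier..].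
Qed.

Lemma le_nrm2 (f g : R -> C) : nn f <= nn g ->
  nrm2 (setT : set RT) f <= nrm2 (setT : set RT) g.
Proof.
have H h : nrm2 (setT : set RT) h = nn h ^+ 2 by rewrite sqr_nrm.
move: (H f) (H g) (nrm_ge0 (setT : set RT) f) (nrm_ge0 (setT : set RT) g) => -> ->.
by move: (nn f) (nn g) => p q p0 q0 pq; rewrite lerXn2r.
Qed.

(* With T the transform and R the reflection, contractivity gives
   |R T T f - f|^2 <= 2 |f|^2 - 2 |T f|^2, so the equality of norms suffices. *)
Lemma ifourierK_ind a b : a < b ->
  nrm2 setT (fun x => ifourier (fourier (ind a b)) x - ind a b x) <= 0.
Proof.
move=> ab; set f := ind a b.
have jf : cintegrable mu setT f := cintegrable_ind a b.
have Lf : L2 setT f := L2_ind a b.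
have LTf := L2_fourier Lf; have Lff := L2_ft jf Lf.
rewrite nrm2B//; last exact: L2_ifourier.
(* Since [f] is real, conjugating [ft f] amounts to reflecting it; the multiplication formula then
   turns the inner product into |T f|^2, which equals |f|^2 by [nrm2_ft_ind]. *)
have E : dotL2 setT (ifourier (fourier f)) f = (nrm2 setT f)%:C.
  have fJ : f = (fun x => (f x)^*) by apply/funext => x; rewrite conjcR.
  rewrite {2}fJ dotJ.
  have := fourier_multiplication (L2_refl LTf) jf Lf.
  rewrite -!dotJ.
  rewrite (ae_eq_dot measurableT (L2_fourier (L2_refl LTf)) (L2_ifourier LTf)
    (L2J measurableT Lf) (L2J measurableT Lf) (fourier_refl LTf)); last exact: aeW.
  move=> ->.
  have aeR : refl (fourier f) = refl (ft f) %[ae mu in (setT : set RT)].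
    apply: (nrmB_le0 measurableT (L2_refl LTf) (L2_refl Lff)).
    have h := le_nrm_fourier_ft Lf jf Lf; rewrite distxx in h.
    rewrite -/(dist (refl (fourier f)) (refl (ft f))) dist_refl//.
  rewrite (ae_eq_dot measurableT (L2_refl LTf) (L2_refl Lff)
    (L2J measurableT Lff) (L2J measurableT Lff) aeR); last exact: aeW.
  rewrite dotJ (_ : cInt _ _ _ = dotL2 setT (ft f) (ft f)); last first.
    by apply: eq_cInt => x _; rewrite /refl -ftJ_ind mulrC.
  transitivity ((nrm2 setT (ft (ind a b)))%:C); first exact: dotff.
  by rewrite nrm2_ft_ind// nrm2_ind.
rewrite E /=.
have : nrm2 setT (ifourier (fourier f)) <= nrm2 setT f.
  apply: le_nrm2; rewrite (nrm_refl (L2_fourier LTf)).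
  exact: le_trans (nrm_fourier_le LTf) (nrm_fourier_le Lf).
by move: (nrm2 _ _) (nrm2 _ _) => p q; lra.
Qed.

(** Transform and reflected transform are contractions, so the set of [f] with zero defect is a
    closed subspace; [L2_density_ind] reduces the claim to indicators. *)
Lemma ifourierK f : L2 setT f -> dist (ifourier (fourier f)) f <= 0.
Proof.
move=> Lf.
have DB : (setT : set RT) = \bigcup_n `](- n%:R : R), n%:R]%classic.
  apply/esym/seteqP; split=> // x _; have := archi_boundP (normr_ge0 x).
  set N := Num.bound _ => xN; exists N => //=.
  by move: xN; rewrite ltr_norml in_itv /= => /andP[-> /ltW].
apply: (@L2_density_ind R setT (fun n => - n%:R) (fun n => n%:R) DB _ _
  (fun f => dist (ifourier (fourier f)) f <= 0)) Lf.
- by move=> n; rewrite lerN2 ler_nat.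
- by move=> n; rewrite ler_nat.
- rewrite -(distxx (fun=> 0 : C)) -nrm_dist0.
  have L0 := L20 (measurableT : measurable (setT : set RT)).
  rewrite nrm_refl; last exact: L2_fourier (L2_fourier L0).
  apply: le_trans (nrm_fourier_le (L2_fourier L0)) _.
  by apply: le_trans (nrm_fourier_le L0) _; rewrite nrm_dist0.
- move=> c f1 g1 Lf1 Lg1 Kf1 Kg1.
  have LTf := L2_fourier Lf1; have LTg := L2_fourier Lg1.
  have LJf := L2_ifourier LTf; have LJg := L2_ifourier LTg.
  have Lh u v : L2 setT u -> L2 setT v -> L2 setT (fun x => c * u x + v x).
    by move=> Lu Lv; apply: L2D => //; exact: L2Z.
  have h1 := dist_ifourier (L2_fourier (Lh _ _ Lf1 Lg1)) (Lh _ _ LTf LTg).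
  have h2 := dist_ae (L2_fourier (Lh _ _ Lf1 Lg1)) (Lh _ _ LTf LTg) (fourier_linear c Lf1 Lg1).
  have h3 := dist_ae (L2_fourier (Lh _ _ LTf LTg)) (Lh _ _ (L2_fourier LTf) (L2_fourier LTg))
    (fourier_linear c LTf LTg).
  rewrite -(dist_refl (L2_fourier (Lh _ _ LTf LTg)) (Lh _ _ (L2_fourier LTf) (L2_fourier LTg))) in h3.
  have h4 := dist_lin c LJf LJg Lf1 Lg1.
  have h5 := dist_tri (L2_ifourier (L2_fourier (Lh _ _ Lf1 Lg1)))
    (L2_ifourier (Lh _ _ LTf LTg)) (Lh _ _ Lf1 Lg1).
  have h6 := dist_tri (L2_ifourier (Lh _ _ LTf LTg)) (Lh _ _ LJf LJg) (Lh _ _ Lf1 Lg1).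
  have h7 : cabs c * dist (ifourier (fourier f1)) f1 <= 0.
    by rewrite mulr_ge0_le0// cabs_ge0.
  apply: le_trans h5 _; apply: le_trans (lerD h1 h6) _.
  rewrite h2 add0r (_ : dist _ _ = 0) ?add0r//.
  by apply: le_trans h4 _; rewrite -(addr0 0) lerD.
- move=> f1 Lf1 Hf1; apply: (@le0_eps _ 2) => // e e0.
  have [g1 [Lg1 Kg1 fg]] := Hf1 _ e0; rewrite -/(dist f1 g1) in fg.
  have h1 := dist_ifourier (L2_fourier Lf1) (L2_fourier Lg1).
  have h2 := nrm_fourierB Lf1 Lg1; rewrite -/(dist _ _) in h2.
  have LJf := L2_ifourier (L2_fourier Lf1); have LJg := L2_ifourier (L2_fourier Lg1).
  have h3 := dist_tri LJf LJg Lf1.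
  have h4 := dist_tri LJg Lg1 Lf1.
  have h5 := dist_sym f1 g1.
  dist_lra.
- move=> n a b _ ab _; have := ifourierK_ind ab.
  rewrite -sqr_nrm -/(dist (ifourier (fourier (ind a b))) (ind a b)).
  rewrite -/(ind a b); have := dist_ge0 (ifourier (fourier (ind a b))) (ind a b).
  by move: (dist _ _) => t t0; rewrite le_eqVlt ltNge sqr_ge0 orbF sqrf_eq0 => /eqP ->.
Qed.

Lemma fourierK f : L2 setT f -> ifourier (fourier f) = f %[ae mu in (setT : set RT)].
Proof.
move=> Lf; apply: (nrmB_le0 measurableT (L2_ifourier (L2_fourier Lf)) Lf).
exact: ifourierK.
Qed.

(** With T the transform and R the reflection, |f| = |R T T f| <= |T f| <= |f| gives the isometry,
    and T R g is a preimage of g because T commutes with R. *)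
Theorem fourier_unitary : unitary_operator setT setT (@fourier R).
Proof.
split; first split.
- exact: L2_fourier.
- exact: fourier_ae.
- exact: fourier_linear.
- move=> f Lf; have LTf := L2_fourier Lf.
  rewrite (sqnorm2E measurableT LTf) (sqnorm2E measurableT Lf) -!sqr_nrm.
  congr (_ ^+ 2)%:E; apply/le_anti; rewrite nrm_fourier_le//=.
  have e1 : nn (refl (fourier (fourier f))) = nn f.
    by rewrite /nrm (ae_eq_nrm2 measurableT (L2_refl (L2_fourier LTf)) Lf (fourierK Lf)).
  apply: le_trans (nrm_fourier_le LTf).
  by have e2 := nrm_refl (L2_fourier LTf); rewrite -e1 e2.
- move=> g Lg; have LRg := L2_refl Lg.
  exists (fourier (refl g)); first exact: L2_fourier.
  have LTR := L2_fourier LRg; have LTg := L2_fourier Lg.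
  have LRTg := L2_refl LTg.
  apply: (nrmB_le0 measurableT (L2_fourier LTR) Lg).
  rewrite -/(dist (fourier (fourier (refl g))) g).
  have h1 := nrm_fourierB LTR LRTg.
  have h2 := dist_ae LTR LRTg (fourier_refl Lg).
  have h3 := dist_ae (L2_fourier LRTg) (L2_ifourier LTg) (fourier_refl LTg).
  have h4 := ifourierK Lg.
  have h5 := dist_tri (L2_fourier LTR) (L2_fourier LRTg) Lg.
  have h6 := dist_tri (L2_fourier LRTg) (L2_ifourier LTg) Lg.
  apply: le_trans h5 _; rewrite -(addr0 0) lerD//; first by rewrite -h2.
  by apply: le_trans h6 _; rewrite h3 add0r.
Qed.

End inversion.

(** * The Fourier integral of sech *)

Section sech.
Context {R : realType}.
Local Notation mu := (@lebesgue_measure R).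
Local Notation C := R[i].
Local Notation RT := (measurableTypeR R).
Implicit Types (x t : R).

Definition chh x : R := (expR (x / 2) + expR (- (x / 2))) / 2.
Definition shh x : R := (expR (x / 2) - expR (- (x / 2))) / 2.

Lemma chh_sqr x : chh x ^+ 2 = 1 + shh x ^+ 2.
Proof.
rewrite /chh /shh; have := expRxMexpNx_1 (x / 2).
move: (expR (x / 2)) (expR (- (x / 2))) => a b ab.
by rewrite -[X in _ = X + _]ab; field.
Qed.

Lemma chh_ge1 x : 1 <= chh x.
Proof.
have c0 : 0 <= chh x by rewrite /chh divr_ge0// addr_ge0// expR_ge0.
rewrite -(@ler_pXn2r _ 2%N)// ?nnegrE// expr1n chh_sqr lerDl sqr_ge0//.
Qed.

Lemma chh_gt0 x : 0 < chh x.
Proof. exact: lt_le_trans ltr01 (chh_ge1 x). Qed.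

Lemma le_shh x : `|shh x| <= chh x.
Proof.
have c0 := ltW (chh_gt0 x).
rewrite -(@ler_pXn2r _ 2%N)// ?nnegrE//.
by rewrite real_normK ?num_real// chh_sqr lerDr.
Qed.

Lemma is_derive_chh x : is_derive x 1 chh (shh x / 2).
Proof. by apply: is_derive_eq; rewrite /GRing.scale/= /shh; field. Qed.

Lemma is_derive_shh x : is_derive x 1 shh (chh x / 2).
Proof. by apply: is_derive_eq; rewrite /GRing.scale/= /chh; field. Qed.

Lemma chhN x : chh (- x) = chh x.
Proof. by rewrite /chh mulNr opprK addrC. Qed.

Lemma shhN x : shh (- x) = - shh x.
Proof. by rewrite /shh mulNr opprK; ring. Qed.

Lemma continuous_chh : continuous chh.
Proof. exact: continuous_of_derive is_derive_chh. Qed.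

Lemma continuous_shh : continuous shh.
Proof. exact: continuous_of_derive is_derive_shh. Qed.

Lemma le_invchh x : (chh x)^-1 <= 2 * expR (- (2^-1 * `|x|)).
Proof.
rewrite -lef_pV2 ?posrE ?invr_gt0 ?chh_gt0 ?mulr_gt0 ?expR_gt0//.
rewrite invrK invfM -expRN opprK /chh mulrC ler_wpM2r//.
have [x0|x0] := ger0P x.
  by rewrite mulrC lerDl expR_ge0.
by rewrite mulrN mulrC lerDr expR_ge0.
Qed.

Lemma integrable_invchh : mu.-integrable setT (EFin \o (fun x => (chh x)^-1)).
Proof.
have i2 : mu.-integrable setT (fun x : R => 2%:E * (expR (- (2^-1 * `|x|)))%:E)%E.
  by apply: integrableZl => //; apply: integrable_expNabs; rewrite invr_gt0.
apply: le_integrable i2 => //.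
  apply/measurable_EFinP; apply: continuous_measurable_fun => x.
  by apply: cvgV; [rewrite gt_eqF// chh_gt0|exact: continuous_chh].
move=> x _ /=; have c0 := ltW (chh_gt0 x).
rewrite lee_fin (ger0_norm (_ : 0 <= (chh x)^-1)) ?invr_ge0//.
by rewrite [leRHS]ger0_norm ?le_invchh// mulr_ge0// expR_ge0.
Qed.

(** With z = x + i t, [den] is |cosh(z/2)|^2, and [ker_re], [ker_im] are the real and imaginary
    parts of 1/cosh(z/2). [dker_re] and [dker_im] are their derivatives in [t]; by the
    Cauchy-Riemann equations [dker_im] is also the derivative of [ker_re] in [x], and - [dker_re]
    that of [ker_im]. *)
Definition den t x := shh x ^+ 2 + cos (t / 2) ^+ 2.
Definition ker_re t x := cos (t / 2) * chh x / den t x.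
Definition ker_im t x := - (sin (t / 2) * shh x) / den t x.
Definition dker_re t x :=
  chh x * sin (t / 2) * (cos (t / 2) ^+ 2 - shh x ^+ 2) / (2 * den t x ^+ 2).
Definition dker_im t x :=
  - (cos (t / 2) * shh x * (shh x ^+ 2 + 1 + sin (t / 2) ^+ 2)) / (2 * den t x ^+ 2).

(** * Bounds and Cauchy-Riemann equations in a closed strip below the pole *)

Section kernel.
Variable t1 : R.
Hypotheses (t10 : 0 < t1) (t1pi : t1 < pi).
(** For |t| <= t1 < pi the strip avoids the poles at i pi and - i pi, and cos(t/2) >= c1 > 0. All
    bounds below are uniform in such [t], with the integrable function 1/cosh(x/2) as majorant. *)
Let c1 := cos (t1 / 2).

Let c1_gt0 : 0 < c1.
Proof.
apply: cos_gt0_pihalf; apply/andP; split; last by rewrite ltr_pM2r.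
by rewrite ltrNl (@lt_trans _ _ 0)// ?oppr_lt0 divr_gt0// pi_gt0.
Qed.

Let cos_ge (t : R) : `|t| <= t1 -> c1 <= cos (t / 2).
Proof.
move=> tt1; have := normr_ge0 t => t0.
rewrite -(cos_norm (t / 2)) normrM (ger0_norm (_ : 0 <= 2^-1))//.
have p2 : t1 / 2 <= pi by rewrite ler_pdivrMr// mulr_natr mulr2n ltW// ltr_wpDr// pi_ge0.
have := @ltr_cos R (t1 / 2) (`|t| / 2).
rewrite !in_itv /= p2 !divr_ge0 ?(ltW t10)//= (le_trans _ p2) ?ler_pM2r//.
by move=> /(_ isT isT); rewrite !ltNge => /negb_inj ->; rewrite ler_pM2r.
Qed.

Let c1_le1 : c1 <= 1. Proof. exact: cos_le1. Qed.

Lemma le_den t x : `|t| <= t1 -> c1 ^+ 2 * chh x ^+ 2 <= den t x.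
Proof.
move=> /cos_ge h; rewrite chh_sqr /den mulrDr mulr1 addrC lerD//.
  by rewrite ler_piMl ?sqr_ge0// expr_le1// ltW.
by rewrite lerXn2r ?nnegrE// ?(ltW c1_gt0)// (le_trans (ltW c1_gt0)).
Qed.

Lemma den_gt0 t x : `|t| <= t1 -> 0 < den t x.
Proof.
move=> h; apply: lt_le_trans (le_den x h).
by rewrite mulr_gt0// exprn_gt0// chh_gt0.
Qed.

Let k := c1 ^- 2.
Let k0 : 0 <= k. Proof. by rewrite invr_ge0 sqr_ge0. Qed.
Let u x := (chh x)^-1.
Let u0 x : 0 <= u x. Proof. by rewrite invr_ge0 ltW// chh_gt0. Qed.

Let inv_den t x : `|t| <= t1 -> (den t x)^-1 <= k * u x ^+ 2.
Proof.
move=> h; rewrite /k /u exprVn -invfM lef_pV2 ?le_den// posrE ?den_gt0//.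
by rewrite mulr_gt0// exprn_gt0// chh_gt0.
Qed.

Let uE x : chh x * u x = 1. Proof. by rewrite divff// gt_eqF// chh_gt0. Qed.

Let bound1 t x (N : R) : `|t| <= t1 -> `|N| <= chh x -> `|N / den t x| <= k * u x.
Proof.
move=> h hN; have i0 : 0 <= (den t x)^-1 by rewrite invr_ge0 ltW// den_gt0.
rewrite normrM (ger0_norm i0); apply: le_trans (ler_pM _ _ hN (inv_den x h)) _ => //.
by rewrite expr2 mulrCA (mulrA (chh x)) uE mul1r.
Qed.

(** The squared denominator is at least of order [chh x ^+ 4], so a numerator of order [chh x ^+ 3]
    still leaves the decay of [u x]. *)
Let bound2 t x (N : R) : `|t| <= t1 -> `|N| <= 2 * chh x ^+ 3 ->
  `|N / (2 * den t x ^+ 2)| <= k ^+ 2 * u x.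
Proof.
move=> h hN; have i0 : 0 <= (den t x)^-1 by rewrite invr_ge0 ltW// den_gt0.
rewrite invfM normrM normrM (ger0_norm (_ : 0 <= 2^-1))// -exprVn (ger0_norm (sqr_ge0 (den t x)^-1)).
have h2 : (den t x)^-1 ^+ 2 <= (k * u x ^+ 2) ^+ 2.
  by rewrite lerXn2r ?nnegrE ?inv_den// mulr_ge0// sqr_ge0.
apply: (@le_trans _ _ (2 * chh x ^+ 3 * (2^-1 * (k * u x ^+ 2) ^+ 2))).
  by apply: ler_pM => //; [rewrite mulr_ge0// sqr_ge0|rewrite ler_wpM2l].
rewrite le_eqVlt; apply/orP; left; apply/eqP.
transitivity (k ^+ 2 * u x * (chh x * u x) ^+ 3); first by field.
by rewrite uE expr1n mulr1.
Qed.

Let le_sqr_shh x : shh x ^+ 2 <= chh x ^+ 2.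
Proof. by rewrite chh_sqr lerDr. Qed.

Let mulr_le1 (a b c : R) : `|a| <= 1 -> `|b| <= c -> `|a * b| <= c.
Proof. by move=> a1 bc; rewrite normrM -(mul1r c) ler_pM. Qed.

Lemma le_ker_re t x : `|t| <= t1 -> `|ker_re t x| <= k * u x.
Proof.
move=> h; apply: bound1 => //; apply: mulr_le1; first exact: cos_max.
by rewrite ger0_norm// ltW// chh_gt0.
Qed.

Lemma le_ker_im t x : `|t| <= t1 -> `|ker_im t x| <= k * u x.
Proof.
move=> h; apply: bound1 => //; rewrite normrN; apply: mulr_le1; first exact: sin_max.
exact: le_shh.
Qed.

Lemma le_dker_re t x : `|t| <= t1 -> `|dker_re t x| <= k ^+ 2 * u x.
Proof.
move=> h; apply: bound2 => //; rewrite mulrAC mulrC; apply: mulr_le1; first exact: sin_max.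
have c0 := chh_gt0 x; have := cos_max (t / 2) => cm.
have c2 : cos (t / 2) ^+ 2 <= 1 by rewrite cos2sin2 lerBlDr lerDl sqr_ge0.
have := le_sqr_shh x => s2; have := sqr_ge0 (cos (t / 2)) => cc.
have := chh_ge1 x => c1'; have ss := sqr_ge0 (shh x).
have c2' : 1 <= chh x ^+ 2 by rewrite exprn_ege1.
rewrite normrM (gtr0_norm c0) (exprS (chh x) 2) mulrCA ler_wpM2l ?(ltW c0)//.
by rewrite ler_norml; apply/andP; split; lra.
Qed.

Lemma le_dker_im t x : `|t| <= t1 -> `|dker_im t x| <= k ^+ 2 * u x.
Proof.
move=> h; apply: bound2 => //; rewrite normrN -mulrA; apply: mulr_le1; first exact: cos_max.
have c0 := chh_gt0 x.
have s2 : sin (t / 2) ^+ 2 <= 1 by rewrite sin2cos2 gerDl oppr_le0 sqr_ge0.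
have ss := sqr_ge0 (sin (t / 2)); have sh := sqr_ge0 (shh x).
have c2' : 1 <= chh x ^+ 2 by rewrite exprn_ege1// chh_ge1.
rewrite normrM (exprS (chh x) 2) mulrCA; apply: ler_pM => //; first exact: le_shh.
have := chh_sqr x => ->; rewrite ger0_norm; lra.
Qed.

Lemma is_derive_den_t (t x : R) : is_derive t 1 (den ^~ x) (- (cos (t / 2) * sin (t / 2))).
Proof. by apply: is_derive_eq; rewrite /GRing.scale/=; field. Qed.

Lemma is_derive_den_x (t x : R) : is_derive x 1 (den t) (shh x * chh x).
Proof.
have d := is_derive_shh x.
by apply: is_derive_eq; rewrite /GRing.scale/=; field.
Qed.

Lemma is_derive_quot (f g : R -> R) (x df dg : R) : g x != 0 ->
  is_derive x 1 f df -> is_derive x 1 g dg ->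
  is_derive x 1 (fun y => f y / g y) ((df * g x - f x * dg) / g x ^+ 2).
Proof.
move=> g0 hf hg; have hgi := is_deriveV g0 hg.
have h := is_deriveM hf hgi; apply: (is_derive_eq h).
by rewrite /GRing.scale/=; field.
Qed.

Lemma is_derive_ker_re_t (t x : R) : `|t| <= t1 ->
  is_derive t 1 (ker_re ^~ x) (dker_re t x).
Proof.
move=> h; have d0 : den t x != 0 by rewrite gt_eqF// den_gt0.
have hf : is_derive t 1 (fun t : R => cos (t / 2) * chh x) (- (sin (t / 2) * chh x / 2)).
  by apply: is_derive_eq; rewrite /GRing.scale/=; field.
apply: (is_derive_eq (@is_derive_quot _ (den ^~ x) _ _ _ d0 hf (is_derive_den_t t x))).
by rewrite /dker_re /den in d0 *; field.
Qed.

Lemma is_derive_ker_re_x (t x : R) : `|t| <= t1 ->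
  is_derive x 1 (ker_re t) (dker_im t x).
Proof.
move=> h; have d0 : den t x != 0 by rewrite gt_eqF// den_gt0.
have hf : is_derive x 1 (fun x : R => cos (t / 2) * chh x) (cos (t / 2) * shh x / 2).
  have d := is_derive_chh x.
  by apply: is_derive_eq; rewrite /GRing.scale/=; field.
apply: (is_derive_eq (is_derive_quot d0 hf (is_derive_den_x t x))).
rewrite /dker_im sin2cos2; have := chh_sqr x; rewrite /den in d0 *.
move: (chh x) (shh x) (cos (t / 2)) d0 => a b c d0 ab.
have -> : c * a * (b * a) = c * b * (1 + b ^+ 2) by rewrite -ab; ring.
by field.
Qed.

Lemma is_derive_ker_im_t (t x : R) : `|t| <= t1 ->
  is_derive t 1 (ker_im ^~ x) (dker_im t x).
Proof.
move=> h; have d0 : den t x != 0 by rewrite gt_eqF// den_gt0.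
have hf : is_derive t 1 (fun t : R => - (sin (t / 2) * shh x)) (- (cos (t / 2) * shh x / 2)).
  by apply: is_derive_eq; rewrite /GRing.scale/=; field.
apply: (is_derive_eq (@is_derive_quot _ (den ^~ x) _ _ _ d0 hf (is_derive_den_t t x))).
rewrite /dker_im sin2cos2.
have := sin2cos2 (t / 2); rewrite /den in d0 *.
move: (shh x) (cos (t / 2)) (sin (t / 2)) d0 => b c s d0 sc.
have -> : - (s * b) * - (c * s) = c * b * (1 - c ^+ 2) by rewrite -sc; ring.
by field.
Qed.

Lemma is_derive_ker_im_x (t x : R) : `|t| <= t1 ->
  is_derive x 1 (ker_im t) (- dker_re t x).
Proof.
move=> h; have d0 : den t x != 0 by rewrite gt_eqF// den_gt0.
have hf : is_derive x 1 (fun x : R => - (sin (t / 2) * shh x)) (- (sin (t / 2) * chh x / 2)).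
  have d := is_derive_shh x.
  by apply: is_derive_eq; rewrite /GRing.scale/=; field.
apply: (is_derive_eq (is_derive_quot d0 hf (is_derive_den_x t x))).
by rewrite /dker_re /den in d0 *; field.
Qed.

Lemma continuous_den t : continuous (den t).
Proof. by apply: continuous_of_derive => x; exact: is_derive_den_x. Qed.

Lemma continuous_dker_re t : `|t| <= t1 -> continuous (dker_re t).
Proof.
move=> h x; have d0 : den t x != 0 by rewrite gt_eqF// den_gt0.
have cs := @continuous_shh x; have cc := @continuous_chh x.
have cd := @continuous_den t x.
apply: cvgM; last first.
  apply: cvgV; first by rewrite mulf_neq0// expf_neq0.
  by apply: cvgM; [exact: cvg_cst|exact: (cvgM cd cd)].
apply: cvgM; first by apply: cvgM; [exact: cc|exact: cvg_cst].
by apply: cvgB; [exact: cvg_cst|exact: (cvgM cs cs)].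
Qed.

Lemma continuous_dker_im t : `|t| <= t1 -> continuous (dker_im t).
Proof.
move=> h x; have d0 : den t x != 0 by rewrite gt_eqF// den_gt0.
have cs := @continuous_shh x.
have cd := @continuous_den t x.
apply: cvgM; last first.
  apply: cvgV; first by rewrite mulf_neq0// expf_neq0.
  by apply: cvgM; [exact: cvg_cst|exact: (cvgM cd cd)].
apply: cvgN; apply: cvgM; first by apply: cvgM; [exact: cvg_cst|exact: cs].
apply: cvgD; last exact: cvg_cst.
by apply: cvgD; [exact: (cvgM cs cs)|exact: cvg_cst].
Qed.

Lemma continuous_ker_re t : `|t| <= t1 -> continuous (ker_re t).
Proof.
move=> h.
exact: (@continuous_of_derive _ _ (dker_im t) (fun x => is_derive_ker_re_x x h)).
Qed.

Lemma continuous_ker_im t : `|t| <= t1 -> continuous (ker_im t).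
Proof.
move=> h.
exact: (@continuous_of_derive _ _ (fun x => - dker_re t x) (fun x => is_derive_ker_im_x x h)).
Qed.

Variable xi : R.

(* Real and imaginary parts of [exp (i xi z) / cosh (z / 2)] at [z = x + i t];
   the Cauchy-Riemann equations make its integral in [x] independent of [t]. *)
Definition strip_re t x :=
  expR (- (xi * t)) * (ker_re t x * cos (xi * x) - ker_im t x * sin (xi * x)).
Definition strip_im t x :=
  expR (- (xi * t)) * (ker_re t x * sin (xi * x) + ker_im t x * cos (xi * x)).
(** One function plays two parts: the derivative of [strip_re] in [t] and that of [- strip_im] in
    [x]. *)
Definition dstrip_re t x :=
  expR (- (xi * t)) * ((dker_re t x - xi * ker_re t x) * cos (xi * x) -
    (dker_im t x - xi * ker_im t x) * sin (xi * x)).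

Lemma is_derive_strip_re (t x : R) : `|t| <= t1 ->
  is_derive t 1 (strip_re ^~ x) (dstrip_re t x).
Proof.
move=> h; have d1 := is_derive_ker_re_t x h; have d2 := is_derive_ker_im_t x h.
by apply: is_derive_eq; rewrite /GRing.scale/= /dstrip_re; ring.
Qed.

Lemma is_derive_strip_im (t x : R) : `|t| <= t1 ->
  is_derive x 1 (fun x => - strip_im t x) (dstrip_re t x).
Proof.
move=> h; have d1 := is_derive_ker_re_x x h; have d2 := is_derive_ker_im_x x h.
by apply: is_derive_eq; rewrite /GRing.scale/= /dstrip_re; ring.
Qed.

Let E := expR (`|xi| * pi).

Let leE t : `|t| <= t1 -> expR (- (xi * t)) <= E.
Proof.
move=> h; rewrite ler_expR; apply: le_trans (ler_norm _) _.
by rewrite normrN normrM ler_wpM2l// (le_trans h)// ltW.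
Qed.

Let le_trig (a b : R) (c s : R) : `|c| <= 1 -> `|s| <= 1 -> `|a * c - b * s| <= `|a| + `|b|.
Proof.
move=> hc hs; apply: le_trans (ler_normB _ _) _.
by rewrite !normrM lerD// ler_piMr.
Qed.

Let Kd := E * ((k ^+ 2 + `|xi| * k) + (k ^+ 2 + `|xi| * k)).

Lemma le_strip_re t x : `|t| <= t1 -> `|strip_re t x| <= E * (k + k) * u x.
Proof.
move=> h; rewrite normrM ger0_norm ?expR_ge0// -mulrA.
apply: ler_pM => //; first exact: leE.
apply: le_trans (le_trig _ _ (cos_max _) (sin_max _)) _.
by rewrite mulrDl lerD// ?le_ker_re ?le_ker_im.
Qed.

Lemma le_strip_im t x : `|t| <= t1 -> `|strip_im t x| <= E * (k + k) * u x.
Proof.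
move=> h; rewrite normrM ger0_norm ?expR_ge0// -mulrA.
apply: ler_pM => //; first exact: leE.
rewrite -[X in `|_ + X|]opprK -mulNr.
apply: le_trans (le_trig _ _ (sin_max _) (cos_max _)) _.
by rewrite mulrDl normrN lerD// ?le_ker_re ?le_ker_im.
Qed.

Lemma le_dstrip_re t x : `|t| <= t1 -> `|dstrip_re t x| <= Kd * u x.
Proof.
move=> h; rewrite normrM ger0_norm ?expR_ge0// /Kd -mulrA.
apply: ler_pM => //; first exact: leE.
apply: le_trans (le_trig _ _ (cos_max _) (sin_max _)) _.
have B (a b : R) : `|a| <= k ^+ 2 * u x -> `|b| <= k * u x ->
    `|a - xi * b| <= (k ^+ 2 + `|xi| * k) * u x.
  move=> ha hb; apply: le_trans (ler_normB _ _) _.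
  by rewrite mulrDl lerD// normrM -mulrA ler_wpM2l.
by rewrite mulrDl lerD// B ?le_ker_re ?le_ker_im ?le_dker_re ?le_dker_im.
Qed.

Let integrable_u (c : R) : mu.-integrable setT (EFin \o (fun x => c * u x)).
Proof.
rewrite /comp; under eq_fun do rewrite EFinM.
by apply: integrableZl => //; exact: integrable_invchh.
Qed.

Let continuous_trig (f g : R -> R) t : continuous f -> continuous g ->
  continuous (fun x => expR (- (xi * t)) * (f x * cos (xi * x) - g x * sin (xi * x))).
Proof.
move=> cf cg x; apply: cvgM; first exact: cvg_cst.
have cx : xi * y @[y --> x] --> xi * x by apply: cvgM; [exact: cvg_cst|exact: cvg_id].
apply: cvgB; apply: cvgM; [exact: cf| |exact: cg|].
  by apply: (cvg_comp _ _ cx); exact: continuous_cos.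
by apply: (cvg_comp _ _ cx); exact: continuous_sin.
Qed.

Lemma integrable_strip_re t : `|t| <= t1 -> mu.-integrable setT (EFin \o strip_re t).
Proof.
move=> h; apply: le_integrable (integrable_u (E * (k + k))) => //.
  apply/measurable_EFinP; apply: continuous_measurable_fun; apply: continuous_trig.
    exact: continuous_ker_re.
  exact: continuous_ker_im.
move=> x _ /=; rewrite lee_fin; apply: le_trans (le_strip_re x h) _.
exact: ler_norm.
Qed.

Lemma continuous_dstrip_re t : `|t| <= t1 -> continuous (dstrip_re t).
Proof.
move=> h; apply: continuous_trig => x.
  apply: cvgB; first exact: continuous_dker_re.
  by apply: cvgM; [exact: cvg_cst|exact: continuous_ker_re].
apply: cvgB; first exact: continuous_dker_im.
by apply: cvgM; [exact: cvg_cst|exact: continuous_ker_im].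
Qed.

Lemma cvg_invchh : u x @[x --> +oo] --> (0 : R).
Proof.
apply: (@squeeze_cvgr _ _ _ _ (fun=> 0) (fun x => 2 * expR (- (2^-1 * x)))).
- near=> x; rewrite u0/=; apply: le_trans (le_invchh x) _.
  by rewrite ger0_norm//; near: x; exact: nbhs_pinfty_ge.
- exact: cvg_cst.
- rewrite -(mulr0 2); apply: cvgM; first exact: cvg_cst.
  by apply: cvg_expNM; rewrite invr_gt0.
Unshelve. all: by end_near. Qed.

(** The integrand is an exact derivative in [x] of a function that vanishes at both ends of the
    line. *)
Lemma Rintegral_dstrip_re t : `|t| <= t1 -> \int[mu]_x dstrip_re t x = 0.
Proof.
move=> h.
have lim0 (f : R -> R) : (forall x, `|f x| <= E * (k + k) * u x) ->
    - f x @[x --> +oo] --> (0 : R).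
  move=> fb; rewrite -oppr0; apply: cvgN; apply: norm_cvg0.
  apply: (@squeeze_cvgr _ _ _ _ (fun=> 0) (fun x => E * (k + k) * u x)).
  - by apply: nearW => x; rewrite normr_ge0 fb.
  - exact: cvg_cst.
  - by rewrite -(mulr0 (E * (k + k))); apply: cvgM; [exact: cvg_cst|exact: cvg_invchh].
have itd : mu.-integrable setT (EFin \o dstrip_re t).
  apply: le_integrable (integrable_u Kd) => //.
    by apply/measurable_EFinP; apply: continuous_measurable_fun; exact: continuous_dstrip_re.
  move=> x _ /=; rewrite lee_fin; apply: le_trans (le_dstrip_re x h) _.
  exact: ler_norm.
have l1 := lim0 _ (fun x => le_strip_im x h).
have l2 : - strip_im t (- x) @[x --> +oo] --> (0 : R).
  apply: (lim0 (fun x => strip_im t (- x))) => x; apply: le_trans (le_strip_im _ h) _.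
  by rewrite /u chhN.
have := Rintegral_FTC_line (continuous_dstrip_re h) (fun x => is_derive_strip_im x h) itd l1 l2.
by rewrite subrr.
Qed.

(** Differentiation under the integral sign, the majorant [Kd * u] being uniform over the strip; the
    integral of the derivative is zero by the previous lemma. *)
Lemma is_derive_strip_integral t : `|t| < t1 ->
  is_derive t 1 (fun t => \int[mu]_x strip_re t x) 0.
Proof.
move=> h; have It : `]- t1, t1[%classic t by rewrite /= in_itv /= -ltr_norml.
have Ile s : `]- t1, t1[%classic s -> `|s| <= t1.
  by rewrite /= in_itv /= -ltr_norml => /ltW.
have d1 s x : `|s| <= t1 -> partial1of2 strip_re s x = dstrip_re s x.
  by move=> hs; rewrite partial1of2E; have [_ ->] := is_derive_strip_re x hs.
have Kd0 x : 0 <= Kd * u x.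
  by rewrite mulr_ge0// mulr_ge0 ?expR_ge0// !addr_ge0 ?mulr_ge0// sqr_ge0.
have H1 s : `]- t1, t1[%classic s -> mu.-integrable setT (EFin \o strip_re s).
  by move=> /Ile; exact: integrable_strip_re.
have H2 s x : `]- t1, t1[%classic s -> setT x -> derivable (strip_re ^~ x) s 1.
  by move=> /Ile hs _; have [] := is_derive_strip_re x hs.
have H3 s x : `]- t1, t1[%classic s -> setT x -> `|partial1of2 strip_re s x| <= Kd * u x.
  by move=> /Ile hs _; rewrite d1// le_dstrip_re.
split; first exact: (derivable_under_integral measurableT It H1 H2 Kd0 (integrable_u Kd) H3).
rewrite -derive1E.
rewrite (differentiation_under_integral measurableT It H1 H2 Kd0 (integrable_u Kd) H3).
rewrite -(Rintegral_dstrip_re (ltW h)); apply: eq_Rintegral => x _.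
by rewrite d1// ltW.
Qed.

End kernel.
End sech.

(** * Evaluation by letting the line of integration approach the pole *)

Section sech_fourier.
Context {R : realType}.
Local Notation mu := (@lebesgue_measure R).
Local Notation C := R[i].
Local Notation RT := (measurableTypeR R).
Implicit Types (x t xi : R).

Definition sech_int xi : R := \int[mu]_x (cos (xi * x) / chh x).

Lemma mean_value (f df : R -> R) (a b : R) : (forall x : R, is_derive x 1 f (df x)) ->
  exists c, f b - f a = df c * (b - a).
Proof.
move=> d; have cf := continuous_of_derive d.
have [ab|ba] := leP a b.
  have [|c _ e] := MVT_segment ab (fun x _ => d x); last by exists c.
  exact: continuous_subspaceT.
have [|c _ e] := MVT_segment (ltW ba) (fun x _ => d x).
  exact: continuous_subspaceT.
by exists c; rewrite -opprB e -mulrN opprB.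
Qed.

Lemma le_sin_norm (x : R) : `|sin x| <= `|x|.
Proof.
have [c] := @mean_value sin cos 0 x (fun x => is_derive_sin x).
rewrite sin0 !subr0 => ->; rewrite normrM -[leRHS]mul1r ler_wpM2r//.
exact: cos_max.
Qed.

(** Mean value theorem: the derivative cosh(x/2)/2 is at least 1/2. This trades powers of x for
    powers of [shh x], which the denominator of the kernel controls. *)
Lemma ge_shh_norm (x : R) : `|x| / 2 <= `|shh x|.
Proof.
have [c] := @mean_value (@shh R) _ 0 x (fun x => is_derive_shh x).
have -> : shh (0 : R) = 0 by rewrite /shh mul0r oppr0 subrr mul0r.
rewrite !subr0 => ->; rewrite normrM mulrC ler_wpM2r// ger0_norm.
  by rewrite ler_pdivlMr// mulVf// chh_ge1.
by rewrite divr_ge0// ltW// chh_gt0.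
Qed.

Lemma strip_integral_const xi t : 0 <= t -> t < pi ->
  \int[mu]_x strip_re xi t x = sech_int xi.
Proof.
(* Halfway between [t] and pi, so that the whole interval [[0, t]] lies inside the open strip. *)
move=> t0 tpi; pose t1 := (t + pi) / 2.
have pi0 := pi_gt0 R.
have t10 : 0 < t1 by rewrite divr_gt0// ltr_wpDl.
have t1pi : t1 < pi by rewrite ltr_pdivrMr// mulr_natr mulr2n ltrD2r.
have tt1 : t < t1 by rewrite ltr_pdivlMr// mulr_natr mulr2n ltrD2l.
have dI s : 0 <= s <= t -> is_derive s 1 (fun t => \int[mu]_x strip_re xi t x) 0.
  move=> /andP[s0 st]; apply: (is_derive_strip_integral t10 t1pi).
  by rewrite ger0_norm// (le_lt_trans st).
have h1 s : s \in `]0, t[%R -> is_derive s 1 (fun t => \int[mu]_x strip_re xi t x) 0.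
  by rewrite in_itv /= => /andP[s0 st]; apply: dI; rewrite !ltW.
have h2 : {within `[0, t], continuous (fun t => \int[mu]_x strip_re xi t x)}.
  apply: derivable_within_continuous => s; rewrite in_itv /= => h.
  by have [] := dI _ h.
have [c _] := MVT_segment t0 h1 h2.
rewrite mul0r => /eqP; rewrite subr_eq0 => /eqP ->; apply: eq_Rintegral => x _.
rewrite /strip_re /ker_re /ker_im /den !mulr0 oppr0 expR0 mul0r cos0 sin0 !mul0r oppr0 mul0r mul0r.
rewrite subr0 !mul1r expr1n addrC -chh_sqr expr2 invfM mulrA divff ?gt_eqF ?chh_gt0//.
by rewrite mul1r mulrC.
Qed.

Section limit.
Variable xi : R.
Variable t : R.
Hypotheses (t0 : 0 <= t) (tpi : t < pi).

Let t1 := (t + pi) / 2.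
Let t10 : 0 < t1. Proof. by rewrite divr_gt0// ltr_wpDl// pi_gt0. Qed.
Let t1pi : t1 < pi. Proof. by rewrite ltr_pdivrMr// mulr_natr mulr2n ltrD2r. Qed.
Let tt1 : `|t| <= t1.
Proof. by rewrite ger0_norm// ler_pdivlMr// mulr_natr mulr2n lerD2l ltW. Qed.

Let c := cos (t / 2).
Let c_gt0 : 0 < c.
Proof.
apply: cos_gt0_pihalf; apply/andP; split; last by rewrite ltr_pM2r.
by apply: (@lt_le_trans _ _ 0); rewrite ?divr_ge0// oppr_lt0 divr_gt0// pi_gt0.
Qed.

Let integrable_ker (f g : R -> R) : continuous f -> continuous g ->
  (forall x, `|g x| <= 1) ->
  (forall x, `|f x| <= cos (t1 / 2) ^- 2 * (chh x)^-1) ->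
  mu.-integrable setT (EFin \o (fun x => f x * g x)).
Proof.
move=> cf cg g1 fb.
have i2 : mu.-integrable setT (EFin \o (fun x : R => cos (t1 / 2) ^- 2 * (chh x)^-1)).
  rewrite /comp; under eq_fun do rewrite EFinM.
  by apply: integrableZl => //; exact: integrable_invchh.
apply: le_integrable i2 => //.
  apply/measurable_EFinP; apply: continuous_measurable_fun => x.
  by apply: cvgM; [exact: cf|exact: cg].
move=> x _ /=; rewrite lee_fin normrM; apply: le_trans (ler_norm _).
by rewrite -[leRHS]mulr1 ler_pM.
Qed.

Let cxi (x : R) : xi * y @[y --> x] --> xi * x.
Proof. by apply: cvgM; [exact: cvg_cst|exact: cvg_id]. Qed.

Let cont_cosM : continuous (fun x : R => cos (xi * x)).
Proof. by move=> x; rewrite /continuous_at; apply: (@cvg_comp _ _ _ (fun y => xi * y) cos); [exact: cxi|exact: continuous_cos]. Qed.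

Let cont_sinM : continuous (fun x : R => sin (xi * x)).
Proof. by move=> x; rewrite /continuous_at; apply: (@cvg_comp _ _ _ (fun y => xi * y) sin); [exact: cxi|exact: continuous_sin]. Qed.

Let itA : mu.-integrable setT (EFin \o (fun x => ker_re t x * cos (xi * x))).
Proof.
apply: integrable_ker => //; [by move=> x; exact: (continuous_ker_re t10 t1pi tt1)| |].
  by move=> x; exact: cos_max.
by move=> x; exact: (le_ker_re t10 t1pi).
Qed.

Let itB : mu.-integrable setT (EFin \o (fun x => ker_im t x * sin (xi * x))).
Proof.
apply: integrable_ker => //; [by move=> x; exact: (continuous_ker_im t10 t1pi tt1)| |].
  by move=> x; exact: sin_max.
by move=> x; exact: (le_ker_im t10 t1pi).
Qed.

Let itK : mu.-integrable setT (EFin \o ker_re t).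
Proof.
have c1 : continuous (fun _ : R => 1 : R) by move=> x; exact: cvg_cst.
have ck : continuous (ker_re t) by move=> x; exact: (continuous_ker_re t10 t1pi tt1).
have n1 (x : R) : `|1 : R| <= 1 by rewrite normr1.
have := integrable_ker ck c1 n1 (fun x => le_ker_re t10 t1pi x tt1).
by apply: eq_integrable => // x _; rewrite /comp mulr1.
Qed.

(** Constancy in [t], used at xi and at - xi, gives two linear equations in the cosine integral of
    [ker_re] and the sine integral of [ker_im]; the second unknown is eliminated. *)
Lemma ker_re_cos : 2 * \int[mu]_x (ker_re t x * cos (xi * x)) =
  sech_int xi * (expR (xi * t) + expR (- (xi * t))).
Proof.
have E1 := strip_integral_const xi t0 tpi.
have E2 := strip_integral_const (- xi) t0 tpi.
have PN : sech_int (- xi) = sech_int xi.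
  by apply: eq_Rintegral => x _; rewrite mulNr cosN.
rewrite PN in E2.
have {}E1 : expR (- (xi * t)) * (\int[mu]_x (ker_re t x * cos (xi * x)) -
    \int[mu]_x (ker_im t x * sin (xi * x))) = sech_int xi.
  have IB := RintegralB measurableT itA itB.
  have itAB := integrableB measurableT itA itB.
  have IZ := RintegralZl (expR (- (xi * t))) measurableT itAB.
  by rewrite -E1 -IB -IZ.
have {}E2 : expR (xi * t) * (\int[mu]_x (ker_re t x * cos (xi * x)) +
    \int[mu]_x (ker_im t x * sin (xi * x))) = sech_int xi.
  have IB := RintegralD measurableT itA itB.
  have itAB := integrableD measurableT itA itB.
  have IZ := RintegralZl (expR (xi * t)) measurableT itAB.
  rewrite -E2 -IB -IZ; apply: eq_Rintegral => x _.
  by rewrite /strip_re !mulNr opprK cosN sinN mulrN opprK.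
have := expRxMexpNx_1 (xi * t); move: E1 E2.
move: (expR (- (xi * t))) (expR (xi * t)) => b a.
move: (\int[mu]_x _) (\int[mu]_x _) (sech_int xi) => B A P E1 E2 ab.
have : a * (b * (A - B)) + b * (a * (A + B)) = a * P + b * P by rewrite E1 E2.
have -> : a * (b * (A - B)) + b * (a * (A + B)) = (a * b) * (2 * A) by ring.
by rewrite ab mul1r => ->; ring.
Qed.

Lemma is_derive_atan_shh x : is_derive x 1 (fun x => 2 * atan (shh x / c)) (ker_re t x).
Proof.
have d := is_derive_shh x.
have d1 : is_derive x 1 (fun x : R => shh x / c) (chh x / 2 / c).
  by apply: is_derive_eq; rewrite /GRing.scale/= mulr0 add0r mulrC.
have d2 := @is_derive1_comp R (@atan R) (fun x => shh x / c) x _ _ (is_derive1_atan _) d1.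
have d0 : shh x ^+ 2 + c ^+ 2 != 0 by rewrite gt_eqF// ltr_wpDl ?sqr_ge0// exprn_gt0.
apply: is_derive_eq; rewrite /GRing.scale/= /ker_re /den -/c.
by field; rewrite d0 gt_eqF.
Qed.

(** The primitive 2 atan(sinh(x/2) / cos(t/2)) runs from - pi to pi, whatever [t]. *)
Lemma Rintegral_ker_re : \int[mu]_x ker_re t x = 2 * pi.
Proof.
have cvgp : 2 * atan (shh x / c) @[x --> +oo] --> pi.
  have H : shh x / c @[x --> +oo] --> +oo.
    under eq_fun do rewrite mulrC; apply: gt0_cvgMry; first by rewrite invr_gt0.
    apply/cvgryPge => A; near=> x.
    rewrite /shh ler_pdivlMr// lerBrDr; apply: (@le_trans _ _ (1 + x / 2)); last exact: expR_ge1Dx.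
    rewrite addrC lerD//.
      by rewrite -expR0 ler_expR oppr_le0 divr_ge0//; near: x; exact: nbhs_pinfty_ge.
    by rewrite ler_pdivlMr//; near: x; exact: nbhs_pinfty_ge.
  rewrite -[X in _ --> X](_ : 2 * (pi / 2) = pi); last by rewrite mulrCA divff ?mulr1.
  apply: cvgM; first exact: cvg_cst.
  exact: (cvg_comp _ _ H (@cvgy_atan R)).
have cvgm : 2 * atan (shh (- x) / c) @[x --> +oo] --> - pi.
  under eq_fun do rewrite shhN mulNr atanN mulrN.
  exact: cvgN.
have := Rintegral_FTC_line (continuous_ker_re t10 t1pi tt1) is_derive_atan_shh itK cvgp cvgm.
by move=> ->; rewrite opprK -mulr2n mulr_natl.
Unshelve. all: by end_near. Qed.

(* As [t] tends to [pi], [ker_re t] concentrates at the origin with mass [2 * pi]. *)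
Lemma le_ker_re_cos : `|\int[mu]_x (ker_re t x * cos (xi * x)) - 2 * pi| <=
  c * ((2 + 2 * xi ^+ 2) * \int[mu]_x (chh x)^-1).
Proof.
have IB := RintegralB measurableT itA itK.
have itAB := integrableB measurableT itA itK.
rewrite -Rintegral_ker_re -IB mulrA.
have IZ := RintegralZl (c * (2 + 2 * xi ^+ 2)) measurableT (@integrable_invchh R).
rewrite -IZ; apply: le_trans (le_normr_Rintegral _ _) _ => //.
apply: le_Rintegral => //.
- by have := integrable_abse itAB; apply: eq_integrable.
- rewrite /comp; under eq_fun do rewrite EFinM.
  by apply: integrableZl => //; exact: integrable_invchh.
move=> x _; rewrite -[X in _ - X]mulr1 -mulrBr normrM.
have d0 : 0 < den t x by exact: (den_gt0 t10 t1pi).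
have C0 := chh_gt0 x.
have -> : `|ker_re t x| = c * chh x / den t x.
  by rewrite ger0_norm// divr_ge0 ?mulr_ge0// ?ltW.
rewrite mulrAC ler_pdivrMr// -subr_ge0.
(* Since chh^2 = 1 + shh^2, the claim becomes (1 + shh^2) m <= (2 + 2 xi^2) den. The bound m <= 2
   xi^2 shh^2 settles the term 1, the bound m <= 2 the term shh^2. *)
set m := `|cos (xi * x) - 1|.
have m2 : m <= 2.
  by apply: le_trans (ler_normB _ _) _; rewrite normr1 -[2]/(1 + 1) lerD// cos_max.
have mS : m <= 2 * xi ^+ 2 * shh x ^+ 2.
  have -> : m = 2 * sin (xi * x / 2) ^+ 2.
    rewrite /m; have {1}-> : xi * x = (xi * x / 2) *+ 2 by rewrite -mulr_natr divfK.
    rewrite cos_mulr2n cos2sin2; move: (sin _) => w.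
    have -> : (1 - w ^+ 2) *+ 2 - 1 - 1 = - (2 * w ^+ 2) by ring.
    by rewrite normrN ger0_norm// mulr_ge0// sqr_ge0.
  rewrite -[leRHS]mulrA ler_wpM2l// -exprMn -[leRHS]real_normK ?num_real//.
  rewrite -[X in X <= _]real_normK ?num_real// lerXn2r ?nnegrE//.
  apply: le_trans (le_sin_norm _) _; rewrite (normrM (xi * x)) (normrM xi x) (normrM xi (shh x)) (ger0_norm (_ : 0 <= 2^-1))// -mulrA.
  by rewrite ler_wpM2l// ge_shh_norm.
have -> : c * (2 + 2 * xi ^+ 2) / chh x * den t x - c * chh x * m =
   c / chh x * ((2 + 2 * xi ^+ 2) * den t x - (1 + shh x ^+ 2) * m).
  by rewrite -chh_sqr; field; rewrite gt_eqF.
apply: mulr_ge0; first by rewrite divr_ge0 ?ltW.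
have := sqr_ge0 (shh x); have := sqr_ge0 (cos (t / 2)); have := sqr_ge0 xi.
rewrite subr_ge0 mulrDl mul1r => a1 a2 a3.
apply: (@le_trans _ _ (2 * xi ^+ 2 * shh x ^+ 2 + shh x ^+ 2 * 2)).
  by rewrite lerD// ler_wpM2l.
rewrite /den -/c; nra.
Qed.

End limit.

Lemma sech_intE xi : sech_int xi = 2 * pi / cosh (pi * xi).
Proof.
have pi0 := pi_gt0 R.
have ch0 : 0 < cosh (pi * xi).
  by rewrite /cosh divr_gt0// addr_gt0// expR_gt0.
(* The two previous lemmas make [f] nonpositive on [0, pi[; being continuous, it is nonpositive at
   pi, where the factor cos(t/2) vanishes and the inequality becomes an equality. *)
pose f t : R := `|sech_int xi * (expR (xi * t) + expR (- (xi * t))) - 4 * pi| -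
  2 * (cos (t / 2) * ((2 + 2 * xi ^+ 2) * \int[mu]_x (chh x)^-1)).
have f0 t : 0 <= t -> t < pi -> f t <= 0.
  move=> t0 tpi; rewrite subr_le0 -ker_re_cos//.
  rewrite (_ : 4 * pi = 2 * (2 * pi)); last by rewrite mulrA -natrM.
  by rewrite -mulrBr normrM ger0_norm// ler_wpM2l// le_ker_re_cos.
have cf : f t @[t --> pi] --> f pi.
  have cx (a : R) : a * t @[t --> pi] --> a * pi.
    by apply: cvgM; [exact: cvg_cst|exact: cvg_id].
  apply: cvgB.
    apply: cvg_norm; apply: cvgB; last exact: cvg_cst.
    apply: cvgM; first exact: cvg_cst.
    apply: cvgD.
      by apply: (@cvg_comp _ _ _ (fun t => xi * t) expR); [exact: cx|exact: continuous_expR].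
    apply: (@cvg_comp _ _ _ (fun t => - (xi * t)) expR); last exact: continuous_expR.
    by apply: cvgN; exact: cx.
  apply: cvgM; first exact: cvg_cst.
  apply: cvgM; last exact: cvg_cst.
  apply: (@cvg_comp _ _ _ (fun t => t / 2) cos); last exact: continuous_cos.
  by apply: cvgM; [exact: cvg_id|exact: cvg_cst].
have : f pi <= 0.
  apply: (@cvgr_to_le _ _ _ _ f _ _ (cvg_at_left_filter cf)).
  near=> t; apply: f0; near: t.
    exact: nbhs_left_ge.
  exact: nbhs_left_lt.
rewrite /f cos_pihalf mul0r mulr0 subr0 normr_le0 subr_eq0 => /eqP H.
apply: (mulIf (lt0r_neq0 ch0)); rewrite divfK ?gt_eqF// /cosh (mulrC pi) mulrA H.
by field.
Unshelve. all: by end_near. Qed.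

End sech_fourier.

(** * The Gamma function on Re z = 1/2 *)

Section gamma_half.
Context {R : realType}.
Local Notation mu := (@lebesgue_measure R).
Local Notation C := R[i].
Local Notation RT := (measurableTypeR R).
Implicit Types (x t xi : R).

Definition gker x : R := expR (x / 2 - expR x).

Lemma continuous_gker : continuous gker.
Proof.
have d (x : R) : is_derive x 1 gker (gker x * (2^-1 - expR x)).
  by apply: is_derive_eq; rewrite /GRing.scale/= /gker; ring.
exact: continuous_of_derive d.
Qed.

Lemma measurable_gker : measurable_fun setT gker.
Proof. exact: (continuous_measurable_fun continuous_gker). Qed.

Lemma le_gker x : gker x <= expR (- (2^-1 * `|x|)).
Proof.
rewrite ler_expR; have [x0|x0] := ger0P x.
  by have := expR_ge1Dx x; lra.
by have := expR_ge0 x; lra.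
Qed.

Lemma le_gker1 x : gker x <= 1.
Proof.
by apply: le_trans (le_gker x) _; rewrite -expR0 ler_expR oppr_le0 mulr_ge0.
Qed.

Lemma integrable_gker : mu.-integrable setT (EFin \o gker).
Proof.
have h : (0 : R) < 2^-1 by rewrite invr_gt0.
apply: le_integrable (integrable_expNabs h) => //.
  by apply/measurable_EFinP; exact: measurable_gker.
by move=> x _ /=; rewrite lee_fin (ger0_norm (expR_ge0 _)) [leRHS]ger0_norm ?expR_ge0// le_gker.
Qed.

Lemma integral_gkerD (x : R) : (\int[mu]_y (gker (y + x))%:E = \int[mu]_y (gker y)%:E)%E.
Proof.
have mg : measurable_fun setT (fun y : RT => (gker y)%:E).
  by apply/measurable_EFinP; exact: measurable_gker.
have g0 (y : R) : (0 <= (gker y)%:E)%E by rewrite lee_fin expR_ge0.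
rewrite -(@ge0_integral_affine _ 1 x _ (or_introl erefl) mg g0).
by apply: eq_integral => y _; rewrite mul1r.
Qed.

Lemma cintegrable_gker : cintegrable mu setT (fun x => (gker x)%:C).
Proof.
split; first by apply: cmeas_real; exact: measurable_gker.
under eq_fun do rewrite cabsC ger0_norm ?expR_ge0//; exact: integrable_gker.
Qed.

Lemma cGamma_half xi : cGamma (2^-1 +i* xi) =
  cInt mu setT (fun x => (gker x)%:C * cis (xi * x)).
Proof.
rewrite /cGamma -[cintegral _ _]/(cInt mu Rpos _) cInt_expR.
  apply: eq_cInt => x _.
  rewrite expRK /gker /cis -!cexpC -!cexpD; congr cexp.
  rewrite cexpC; apply: complexP; rewrite /= ?oppr0 ?addr0 ?add0r ?mulr0 ?subr0 ?mul0r//; by field.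
have ml : measurable_fun Rpos (@ln R) by apply: measurable_funTS; exact: measurable_ln.
by apply: cmeas_cexp; split; rewrite /=; apply: measurable_funB => //;
  [apply: measurable_funB => //; exact: measurable_funM|
   apply: measurable_funD => //; exact: measurable_funM].
Qed.

(** Through [cmeas_ft] this yields the measurability of the Gamma function along the line. *)
Lemma cis_int_gker xi : cGamma (2^-1 +i* xi) =
  (Num.sqrt (2 * pi))%:C * ft (fun x => (gker x)%:C) (- xi).
Proof.
rewrite /ft mulrA -rcM /isq divff ?mul1r; last first.
  by rewrite gt_eqF// sqrtr_gt0 mulr_gt0// pi_gt0.
rewrite cGamma_half; apply: eq_cInt => x _; congr (_ * cis _); ring.
Qed.

(** The product of kernels is exp(x/2) e^y exp(-(1 + e^x) e^y), an exact derivative in y; its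
    integral e^{x/2} / (1 + e^x) is 1 / (2 cosh(x/2)). *)
Lemma gker_autocorrelation x :
  \int[mu]_y (gker y * gker (x + y)) = (2 * chh x)^-1.
Proof.
pose c := 1 + expR x.
have c0 : 0 < c by rewrite ltr_wpDl// expR_gt0.
pose f y := expR (x / 2) * (expR y * expR (- (c * expR y))).
have fE y : gker y * gker (x + y) = f y.
  rewrite /gker /f -!expRD; congr expR; rewrite expRD /c; by field.
pose F y := - (expR (x / 2) / c) * expR (- (c * expR y)).
have d (y : R) : is_derive y 1 F (f y).
  apply: is_derive_eq; rewrite /GRing.scale/= /f; field.
  by rewrite gt_eqF.
under eq_Rintegral do rewrite fE.
have cf : continuous f.
  have -> : f = fun y => gker y * gker (x + y) by apply/funext.
  move=> y; apply: cvgM; first exact: continuous_gker.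
  apply: (@cvg_comp _ _ _ (fun y => x + y) gker); last exact: continuous_gker.
  by apply: cvgD; [exact: cvg_cst|exact: cvg_id].
have fi : mu.-integrable setT (EFin \o f).
  apply: le_integrable integrable_gker => //.
    by apply/measurable_EFinP; exact: continuous_measurable_fun.
  move=> y _ /=; rewrite lee_fin -fE !ger0_norm ?mulr_ge0 ?expR_ge0//.
  by rewrite ler_piMr ?le_gker1// expR_ge0.
have l1 : F y @[y --> +oo] --> (0 : R).
  rewrite -(mulr0 (- (expR (x / 2) / c))); apply: cvgM; first exact: cvg_cst.
  apply: (@squeeze_cvgr _ _ _ _ (fun=> 0) (fun y => expR (- (c * y)))).
  - apply: nearW => y; rewrite expR_ge0/= ler_expR lerN2 ler_pM2l//.
    by have := expR_ge1Dx y; lra.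
  - exact: cvg_cst.
  - exact: cvg_expNM.
have l2 : F (- y) @[y --> +oo] --> - (expR (x / 2) / c).
  rewrite -[X in _ --> X]mulr1; apply: cvgM; first exact: cvg_cst.
  rewrite -expR0; apply: (@cvg_comp _ _ _ (fun y => - (c * expR (- y))) expR); last exact: continuous_expR.
  rewrite -oppr0 -(mulr0 c); apply: cvgN; apply: cvgM; first exact: cvg_cst.
  have := cvg_expNM (ltr01 : (0 : R) < 1).
  by under eq_fun do rewrite mul1r.
rewrite (Rintegral_FTC_line cf d fi l1 l2) sub0r opprK /c /chh.
have -> : expR x = expR (x / 2) * expR (x / 2) by rewrite -expRD -splitr.
have := expRxMexpNx_1 (x / 2); have := expR_gt0 (x / 2).
move: (expR (x / 2)) (expR (- (x / 2))) => a b a0 ab.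
have b0 : b = a^-1 by apply: (mulfI (lt0r_neq0 a0)); rewrite ab divff ?gt_eqF.
have an : a != 0 by rewrite gt_eqF.
have n1 : 1 + a * a != 0 by rewrite gt_eqF// ltr_wpDr// mulr_ge0// ltW.
by rewrite b0; field; rewrite an addrC.
Qed.

Lemma cintegrable_gkerM (y : R) : cintegrable mu setT (fun x => (gker x * gker (y + x))%:C).
Proof.
have mxy : measurable_fun setT (fun x : R => gker x * gker (y + x)).
  apply: measurable_funM; first exact: measurable_gker.
  apply: measurableT_comp; first exact: measurable_gker.
  exact: measurable_funD.
apply: (le_cintegrable (T := RT) measurableT (g := gker)).
- exact: cmeas_real.
- move=> x _; rewrite cabsC (ger0_norm (mulr_ge0 (expR_ge0 _) (expR_ge0 _))).
  by apply: ler_piMr; [exact: expR_ge0|exact: le_gker1].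
- exact: integrable_gker.
Qed.

Lemma integrable_cos_sech xi :
  mu.-integrable setT (EFin \o (fun x => cos (xi * x) / chh x)).
Proof.
apply: le_integrable (@integrable_invchh R) => //.
  apply/measurable_EFinP; apply: continuous_measurable_fun => x.
  apply: cvgM; last by apply: cvgV; [rewrite gt_eqF// chh_gt0|exact: continuous_chh].
  apply: (@cvg_comp _ _ _ (fun y => xi * y) cos); last exact: continuous_cos.
  by apply: cvgM; [exact: cvg_cst|exact: cvg_id].
by move=> x _; rewrite /= lee_fin normrM ler_piMl// cos_max.
Qed.

Lemma cInt_real (f : R -> R) :
  cInt mu setT (fun x : R => (f x)%:C) = (\int[mu]_x f x)%:C.
Proof. by apply: complexP => //=; rewrite /Rintegral integral0. Qed.

Lemma sqr_cabs_cGamma_half xi : cabs (cGamma (2^-1 +i* xi)) ^+ 2 = pi / cosh (pi * xi).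
Proof.
have -> : pi / cosh (pi * xi) = 2^-1 * sech_int xi.
  by rewrite sech_intE !mulrA mulVf// mul1r.
have k1 : cintegrable mu setT (fun x => (gker x)%:C) := cintegrable_gker.
have mcis : measurable_fun setT (fun x : R => xi * x) by exact: measurable_funM.
have mcis2 : measurable_fun setT (fun z : RT * RT => xi * z.2).
  by apply: measurable_funM => //; exact: measurable_snd.
have kc : cintegrable mu setT (fun x => (gker x)%:C * cis (xi * x)).
  exact: cintegrable_cis.
(* The integrand of Gamma times its conjugate, with the first variable of integration translated by
   the second so that the phase depends on their difference only. *)
pose F (z : RT * RT) : C := (gker z.1)%:C * ((gker (z.2 + z.1))%:C * cis (xi * z.2)).
have mF : cmeas setT F.
  apply: cmeasM.
    apply: cmeas_real; apply: measurableT_comp; first exact: measurable_gker.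
    exact: measurable_fst.
  apply: cmeasM; last exact: cmeas_cis.
  apply: cmeas_real; apply: measurableT_comp; first exact: measurable_gker.
  by apply: measurable_funD; [exact: measurable_snd|exact: measurable_fst].
have cF z : cabs (F z) = gker z.1 * gker (z.2 + z.1).
  rewrite /F cabsM cabsM cabs_cis mulr1 !cabsC.
  by rewrite (ger0_norm (expR_ge0 _)) (ger0_norm (expR_ge0 _)).
have iF : cintegrable (mu \x mu)%E setT F.
  apply: cintegrable_prod12 => //.
  have E (x : RT) : (\int[mu]_y (cabs (F (x, y)))%:E = (gker x)%:E * \int[mu]_y (gker y)%:E)%E.
    under eq_integral => y _.
      rewrite cF EFinM /=; over.
    have mgx : measurable_fun setT (fun y : RT => (gker (y + x))%:E).
      apply/measurable_EFinP; apply: measurableT_comp; first exact: measurable_gker.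
      exact: measurable_funD.
    have g0 (y : RT) : setT y -> (0 <= (gker (y + x))%:E)%E by rewrite lee_fin expR_ge0.
    have gx : (0 <= (gker x)%:E)%E by rewrite lee_fin expR_ge0.
    transitivity ((gker x)%:E * \int[mu]_y (gker (y + x))%:E)%E.
      exact: (ge0_integralZl mu measurableT mgx g0 gx).
    by rewrite integral_gkerD.
  under eq_integral do rewrite E.
  have fin : (\int[mu]_y (gker y)%:E \is a fin_num)%E := integrable_fin_num measurableT integrable_gker.
  have mg : measurable_fun setT (fun y : RT => (gker y)%:E).
    by apply/measurable_EFinP; exact: measurable_gker.
  have g0 (y : RT) : setT y -> (0 <= (gker y)%:E)%E by rewrite lee_fin expR_ge0.
  have I0 : (0 <= \int[mu]_y (gker y)%:E)%E by apply: integral_ge0.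
  have := ge0_integralZr mu measurableT mg g0 I0 => /= ->.
  by rewrite -(fineK fin) -EFinM ltry.
have [_ _ e] := cfubini iF.
have E1 : (cabs (cGamma (2^-1 +i* xi)) ^+ 2)%:C =
    cInt mu setT (fun x => cInt mu setT (fun y => F (x, y))).
  rewrite -mulcJ {2}cGamma_half -(cIntJ (T := RT) measurableT kc).
  have kcJ := cintegrableJ (T := RT) kc.
  rewrite -(cIntZ (T := RT) measurableT _ kcJ); apply: eq_cInt => y _.
  rewrite cGamma_half -(cInt_affine y (or_introl erefl : 1 = 1 \/ 1 = -1 :> R) kc.1).
  have ikc := cintegrable_affine y (or_introl erefl : 1 = 1 \/ 1 = -1 :> R) kc.
  rewrite -(cIntZr (T := RT) measurableT _ ikc); apply: eq_cInt => x _.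
  rewrite /F /= mul1r conjcM conjcR cisJ.
  have -> : cis (xi * x) = cis (xi * (x + y)) * cis (- (xi * y)).
    by rewrite -cisD; congr cis; ring.
  by ring.
have E2 : cInt mu setT (fun y => cInt mu setT (fun x => F (x, y))) =
    cInt mu setT (fun y => ((2 * chh y)^-1)%:C * cis (xi * y)).
  apply: eq_cInt => y _.
  have ic := cintegrable_gkerM y.
  have -> : ((2 * chh y)^-1)%:C = cInt mu setT (fun x => (gker x * gker (y + x))%:C).
    by rewrite cInt_real gker_autocorrelation.
  rewrite -(cIntZr (T := RT) measurableT _ ic); apply: eq_cInt => x _.
  by rewrite /F /= rcM mulrA.
have := congr1 (@complex.Re R) (etrans E1 (etrans e E2)).
rewrite /= => ->.
have iz := RintegralZl 2^-1 measurableT (integrable_cos_sech xi); rewrite /sech_int -iz.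
apply: eq_Rintegral => y _; rewrite /cis /cexp /= expR0 !mul1r mul0r subr0.
rewrite invfM -mulrA (mulrC (chh y)^-1); reflexivity.
Qed.

Lemma cabs_cGamma_half xi :
  (cabs (cGamma (2^-1 +i* xi)))%:C = vfun xi.
Proof.
have ch0 : 0 < cosh (pi * xi) by rewrite /cosh divr_gt0// addr_gt0// expR_gt0.
rewrite /vfun -sqrtrV ?ltW// -sqrtrM ?pi_ge0// -sqr_cabs_cGamma_half.
by rewrite sqrtr_sqr ger0_norm ?cabs_ge0.
Qed.

Lemma cis_carg (z : C) : (cabs z)%:C * cis (carg z) = z.
Proof.
have [->|z0] := eqVneq z 0; first by rewrite cabs0 mul0r.
have a0 : 0 < cabs z by rewrite lt_neqAle cabs_ge0 eq_sym andbT; apply: contra_neq z0 => /cabs_eq0.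
have b : -1 <= Re z / cabs z <= 1.
  rewrite -ler_norml normrM normfV (gtr0_norm a0) ler_pdivrMr// mul1r.
  exact: le_normRe.
have s : sin (acos (Re z / cabs z)) = `|Im z| / cabs z.
  rewrite sin_acos// -(ger0_norm (_ : 0 <= `|Im z| / cabs z)); last by rewrite divr_ge0// ltW.
  rewrite -sqrtr_sqr; congr Num.sqrt.
  rewrite !exprMn real_normK ?num_real// exprVn.
  have := sqr_cabs z => h; have h0 : cabs z ^+ 2 != 0 by rewrite expf_neq0// gt_eqF.
  by rewrite -(divff h0) -mulrBl {1}h addrAC subrr add0r.
apply: complexP; rewrite /cis /cexp /= expR0 !mul1r !mul0r ?subr0 ?addr0 /carg.
  have -> : cos (if 0 <= Im z then acos (Re z / cabs z) else - acos (Re z / cabs z)) =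
      Re z / cabs z.
    by case: ifP => _; rewrite ?cosN acosK.
  by rewrite mulrCA divff ?mulr1// gt_eqF.
have -> : sin (if 0 <= Im z then acos (Re z / cabs z) else - acos (Re z / cabs z)) =
      Im z / cabs z.
  case: ifP => h; rewrite ?sinN s; first by rewrite ger0_norm.
  by rewrite ler0_norm ?mulNr ?opprK// ltW// ltNge h.
by rewrite mulrCA divff ?mulr1// gt_eqF.
Qed.

End gamma_half.

(** * Unitary operators and the Mellin transform *)

Section L2_operators.
Context {R : realType}.
Local Notation mu := (@lebesgue_measure R).
Local Notation C := R[i].
Local Notation RT := (measurableTypeR R).

Definition meas (D : set R) := measurable (D : set RT).

Lemma meas_setT : meas setT. Proof. exact: measurableT. Qed.

Lemma meas_Rpos : meas (@Rpos R). Proof. exact: measurable_Rpos. Qed.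

Section one_operator.
Variables (D E : set R) (mD : meas D) (mE : meas E) (T : @operator R).
Hypothesis UT : unitary_operator D E T.

Lemma L2_unitary f : L2 D f -> L2 E (T f).
Proof. by case: UT => -[h _ _] _ _; exact: h. Qed.

Lemma unitary_ae f g : L2 D f -> L2 D g ->
  f = g %[ae mu in D] -> T f = T g %[ae mu in E].
Proof. by case: UT => -[_ h _] _ _; exact: h. Qed.

Lemma nrm2_unitary f : L2 D f -> nrm2 E (T f) = nrm2 D f.
Proof.
move=> Lf; apply: EFin_inj; rewrite -(sqnorm2E mD Lf) -(sqnorm2E mE (L2_unitary Lf)).
by case: UT => _ -> .
Qed.

(** Polarization: |a T u + T v|^2 is compared with |a u + v|^2. The values a = 1 and a = i will give
    the real and imaginary parts of the inner product. *)
Lemma Re_dot_unitary (a : C) u v : L2 D u -> L2 D v ->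
  Re (a * dotL2 E (T u) (T v)) = Re (a * dotL2 D u v).
Proof.
move=> Lu Lv; have LTu := L2_unitary Lu; have LTv := L2_unitary Lv.
have Lau := L2Z mD a Lu; have LTau := L2Z mE a LTu.
rewrite -(dotZl mE a LTu LTv) -(dotZl mD a Lu Lv).
have h1 := nrm2D mE LTau LTv; have h2 := nrm2D mD Lau Lv.
have h3 : nrm2 E (fun x => a * T u x + T v x) = nrm2 D (fun x => a * u x + v x).
  rewrite -(nrm2_unitary (L2D mD Lau Lv)); apply: (ae_eq_nrm2 mE).
  - exact: L2D.
  - exact: L2_unitary (L2D mD Lau Lv).
  - by case: UT => -[_ _ lin] _ _; apply: ae_eq_sym; exact: lin.
move: h1; rewrite h3 h2 (nrm2Z mE a LTu) (nrm2Z mD a Lu) !nrm2_unitary//.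
have t20 : (2 : R) != 0 by [].
by move=> /addrI/(mulfI t20) ->.
Qed.

Lemma dot_unitary u v : L2 D u -> L2 D v -> dotL2 E (T u) (T v) = dotL2 D u v.
Proof.
move=> Lu Lv; have := Re_dot_unitary 1 Lu Lv; have := Re_dot_unitary (0 +i* 1) Lu Lv.
rewrite !ReImE /= !mul0r !mul1r !sub0r !subr0 => /oppr_inj h2 h1.
exact: complexP.
Qed.

(** A preimage of [g] under [T] satisfies the relation defining the adjoint, so [xget] selects a
    function that satisfies it too; two such functions have a difference orthogonal to itself and
    agree almost everywhere. *)
Lemma adjoint_unitary g : L2 E g ->
  [/\ L2 D (adjoint D E T g), T (adjoint D E T g) = g %[ae mu in E] &
   forall u, L2 D u -> dotL2 E (T u) g = dotL2 D u (adjoint D E T g)].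
Proof.
move=> Lg; have [_ _ /(_ g Lg)[f0 Lf0 Tf0]] := UT.
have adj0 u : L2 D u -> dotL2 E (T u) g = dotL2 D u f0.
  move=> Lu; rewrite -dot_unitary//; have LTu := L2_unitary Lu.
  apply: (ae_eq_dot mE LTu LTu Lg (L2_unitary Lf0)); first exact: ae_eq_refl.
  exact: ae_eq_sym.
have [Lf adj] : L2 D (adjoint D E T g) /\
    forall u, L2 D u -> dotL2 E (T u) g = dotL2 D u (adjoint D E T g).
  by rewrite /adjoint; case: xgetP => [f _ //|/(_ f0)/=]; case; split.
split=> //; set f := adjoint D E T g in Lf adj *.
have Lff := L2B mD Lf Lf0.
have ff0 : f = f0 %[ae mu in D].
  apply: (nrm2B_eq0 mD Lf Lf0); apply: (@complexI R).
  transitivity (dotL2 D (fun x => f x - f0 x) (fun x => f x - f0 x)); first exact/esym/dotff.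
  by rewrite (dotBr mD Lf Lf0 Lff) -adj// adj0// subrr.
exact: ae_eq_trans (unitary_ae Lf Lf0 ff0) Tf0.
Qed.

Lemma unitary_inj u v : L2 D u -> L2 D v ->
  T u = T v %[ae mu in E] -> u = v %[ae mu in D].
Proof.
move=> Lu Lv Tuv; have LTu := L2_unitary Lu; have LTv := L2_unitary Lv.
apply: (nrm2B_eq0 mD Lu Lv); have := ae_eq_nrm2B mE LTu LTv Tuv.
rewrite (nrm2B mE LTu LTv) (nrm2B mD Lu Lv) !nrm2_unitary//.
by rewrite dot_unitary.
Qed.

Lemma unitary_bounded : bounded_operator D E T.
Proof.
split; first by case: UT.
by exists 1 => f Lf; rewrite expr1n mul1e; case: UT => _ -> .
Qed.

(** Every identity is checked after applying [T], which is injective up to null sets and sends the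
    adjoint of [g] back to [g]. *)
Lemma unitary_adjoint : unitary_operator E D (adjoint D E T).
Proof.
have Ladj g : L2 E g -> L2 D (adjoint D E T g) by move=> /adjoint_unitary[].
have Tadj g : L2 E g -> T (adjoint D E T g) = g %[ae mu in E].
  by move=> /adjoint_unitary[].
have linT : forall (a : C) f g, L2 D f -> L2 D g ->
    T (fun x => a * f x + g x) = (fun x => a * T f x + T g x) %[ae mu in E].
  by case: UT => -[].
split; first split.
- exact: Ladj.
- move=> f g Lf Lg fg; apply: unitary_inj; [exact: Ladj|exact: Ladj|].
  apply: ae_eq_trans (Tadj _ Lf) _; apply: ae_eq_trans fg _.
  exact/ae_eq_sym/Tadj.
- move=> a f g Lf Lg.
  have L1 := Ladj _ Lf; have L2' := Ladj _ Lg.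
  have Lafg : L2 E (fun x => a * f x + g x) by apply: L2D => //; exact: L2Z.
  apply: unitary_inj; [exact: Ladj|by apply: L2D => //; exact: L2Z|].
  apply: ae_eq_trans (Tadj _ Lafg) _; apply: ae_eq_sym.
  apply: ae_eq_trans (linT a _ _ L1 L2') _.
  by apply: ae_imply2 (Tadj _ Lf) (Tadj _ Lg) => x h1 h2 Ex; rewrite h1// h2.
- move=> g Lg; have [_ iso _] := UT; rewrite -iso; last exact: Ladj.
  rewrite (sqnorm2E mE Lg) (sqnorm2E mE (L2_unitary (Ladj _ Lg))).
  by rewrite (ae_eq_nrm2 mE (L2_unitary (Ladj _ Lg)) Lg (Tadj _ Lg)).
- move=> u Lu; exists (T u); first exact: L2_unitary.
  by apply: unitary_inj => //; [exact/Ladj/L2_unitary|exact/Tadj/L2_unitary].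
Qed.

End one_operator.

Lemma linear_comp (D E F : set R) (mD : meas D) (mE : meas E) (S T : @operator R) :
  linear_operator D E T -> linear_operator E F S -> linear_operator D F (S \o T).
Proof.
move=> [LT aT linT] [LS aS linS]; split.
- by move=> f Lf; exact/LS/LT.
- by move=> f g Lf Lg fg; apply: aS; [exact: LT|exact: LT|exact: aT].
- move=> a f g Lf Lg; have Lc : L2 D (fun x => a * f x + g x).
    by apply: L2D => //; exact: L2Z.
  apply: ae_eq_trans (linS a _ _ (LT _ Lf) (LT _ Lg)).
  apply: aS; [exact: LT| |exact: linT].
  by apply: L2D; [exact: mE|apply: L2Z => //; exact: LT|exact: LT].
Qed.

Lemma unitary_comp (D E F : set R) (mD : meas D) (mE : meas E) (S T : @operator R) :
  unitary_operator D E T -> unitary_operator E F S -> unitary_operator D F (S \o T).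
Proof.
move=> [linT isoT surT] [linS isoS surS].
have [LT _ _] := linT; have [_ aS _] := linS.
split; first exact: linear_comp mD mE _ _ linT linS.
- by move=> f Lf /=; rewrite isoS ?isoT//; exact: LT.
- move=> g Lg; have [u Lu Su] := surS g Lg; have [f Lf Tf] := surT u Lu.
  by exists f => //=; apply: ae_eq_trans Su; apply: aS => //; exact: LT.
Qed.

Lemma bounded_comp (D E F : set R) (mD : meas D) (mE : meas E) (S T : @operator R) :
  bounded_operator D E T -> bounded_operator E F S -> bounded_operator D F (S \o T).
Proof.
move=> [linT [K TK]] [linS [K' SK']]; have [LT _ _] := linT.
split; first exact: linear_comp mD mE _ _ linT linS.
exists (K' * K) => f Lf; apply: le_trans (SK' _ (LT _ Lf)) _.
rewrite exprMn (EFinM (K' ^+ 2)) -muleA; apply: lee_wpmul2l; first by rewrite lee_fin sqr_ge0.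
exact: TK.
Qed.

Lemma bounded_mulop (D : set R) (mD : meas D) (m : R -> C) (K : R) :
  cmeas (D : set RT) m -> {ae mu, forall x, D x -> cabs (m x) <= K} ->
  bounded_operator D D (mulop m).
Proof.
move=> mm mK.
have bd f : L2 D f -> (sqnorm2 D (mulop m f) <= (K ^+ 2)%:E * sqnorm2 D f)%E.
  move=> Lf; have mf := L2_cmeas Lf.
  rewrite /sqnorm2 -ge0_integralZl//; first last.
  - by rewrite lee_fin sqr_ge0.
  - by move=> x _; rewrite lee_fin sqr_ge0.
  - exact: measurable_cabs2.
  apply: ae_ge0_le_integral => //.
  - by move=> x _; rewrite lee_fin sqr_ge0.
  - by apply: measurable_cabs2 => //; exact: cmeasM.
  - by move=> x _; rewrite -EFinM lee_fin mulr_ge0// sqr_ge0.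
  - by apply: measurable_funeM; exact: measurable_cabs2.
  - apply: ae_imply mK => x h Dx; rewrite /mulop cabsM exprMn -EFinM lee_fin.
    rewrite ler_wpM2r ?sqr_ge0// lerXn2r ?nnegrE ?cabs_ge0 ?h//.
    exact: le_trans (cabs_ge0 _) (h Dx).
have Lm f : L2 D f -> L2 D (mulop m f).
  move=> Lf; split; first exact: cmeasM mm (L2_cmeas Lf).
  apply: le_lt_trans (bd f Lf) _.
  by rewrite (sqnorm2E mD Lf) -EFinM ltry.
split; last by exists K.
split => //.
- move=> f g Lf Lg; apply: ae_imply => x h Dx; by rewrite /mulop h.
- move=> a f g Lf Lg; apply: aeW => x _; rewrite /mulop; ring.
Qed.

Lemma unitary_mulop (D : set R) (mD : meas D) (m : R -> C) :
  cmeas (D : set RT) m -> (forall x, cabs (m x) = 1) ->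
  unitary_operator D D (mulop m).
Proof.
move=> mm m1.
have [lin _] : bounded_operator D D (mulop m).
  by apply: (bounded_mulop mD (K := 1) mm); apply: aeW => x _; rewrite m1.
have iso (n : R -> C) f : (forall x, cabs (n x) = 1) -> sqnorm2 D (mulop n f) = sqnorm2 D f.
  by move=> n1; apply: eq_integral => x _; rewrite cabsM n1 mul1r.
split => //; first by move=> f _; exact: iso.
move=> g Lg; exists (mulop (fun x => (m x)^*) g).
  split; first exact: cmeasM (cmeasJ mm) (L2_cmeas Lg).
  by rewrite iso; [case: Lg|move=> x; rewrite cabsJ].
by apply: aeW => x _; rewrite /mulop mulrA mulcJ m1 expr1n mul1r.
Qed.

Lemma sqnorm2_Uop f : cmeas (@Rpos R : set RT) f ->
  sqnorm2 setT (Uop f) = sqnorm2 Rpos f.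
Proof.
move=> mf; rewrite /sqnorm2 ge0_integral_expR.
- apply: eq_integral => x _; rewrite /Uop cabsM cabsC ger0_norm ?expR_ge0//.
  rewrite exprMn -EFinM mulrC; congr (_ * _)%:E.
  by rewrite expr2 -expRD -splitr.
- exact: measurable_cabs2.
- by move=> x _; rewrite lee_fin sqr_ge0.
Qed.

Lemma L2_Uop (f : R -> C) : L2 Rpos f -> L2 setT (Uop f).
Proof.
move=> Lf; have mf := L2_cmeas Lf; split; last by rewrite sqnorm2_Uop//; case: Lf.
suff : cmeas (setT : set RT) (fun x => (expR (x / 2))%:C * f (expR x)) by [].
apply: cmeasM.
  apply: cmeas_real; apply: measurableT_comp => //; exact: measurable_funM.
exact: cmeas_expR.
Qed.

(** No null set has to be transported through the logarithm: U preserves the norm of f - g, which is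
    zero. *)
Lemma Uop_ae (f g : R -> C) : L2 Rpos f -> L2 Rpos g -> f = g %[ae mu in Rpos] ->
  Uop f = Uop g %[ae mu in setT].
Proof.
move=> Lf Lg fg; have Lfg := L2B measurable_Rpos Lf Lg.
apply: (nrm2B_eq0 measurableT (L2_Uop Lf) (L2_Uop Lg)).
rewrite -(ae_eq_nrm2B measurable_Rpos Lf Lg fg); apply: EFin_inj.
rewrite -(sqnorm2E measurable_Rpos Lfg) -(sqnorm2_Uop (L2_cmeas Lfg)).
rewrite -(sqnorm2E measurableT (L2B measurableT (L2_Uop Lf) (L2_Uop Lg))).
by congr sqnorm2; apply/funext => x; rewrite /Uop mulrBr.
Qed.

Lemma Uop_surj (g : R -> C) : L2 setT g -> exists2 f, L2 Rpos f & Uop f = g.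
Proof.
move=> Lg; pose f (t : R) := (expR (- (ln t / 2)))%:C * g (ln t).
have Uf : Uop f = g.
  apply/funext => x; rewrite /Uop /f expRK mulrA -rcM -expRD addrN expR0.
  by rewrite mul1r.
exists f => //.
have mln : measurable_fun (@Rpos R) (@ln R) by apply: measurable_funTS; exact: measurable_ln.
have mf : cmeas (@Rpos R : set RT) f.
  apply: cmeasM.
    apply: cmeas_real; apply: measurableT_comp => //; apply: measurableT_comp => //.
    exact: measurable_funM.
  have [m1 m2] := L2_cmeas Lg.
  by split; [exact: (measurableT_comp m1 mln)|exact: (measurableT_comp m2 mln)].
by split=> //; rewrite -sqnorm2_Uop// Uf; case: Lg.
Qed.

Lemma Uop_unitary : unitary_operator Rpos setT (@Uop R).
Proof.
split; first split.
- exact: L2_Uop.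
- exact: Uop_ae.
- by move=> a f g Lf Lg; apply: aeW => x _; rewrite /Uop; ring.
- by move=> f Lf; apply: sqnorm2_Uop; exact: L2_cmeas Lf.
- by move=> g /Uop_surj[f Lf <-]; exists f => //; exact: ae_eq_refl.
Qed.

Lemma mellin_unitary : unitary_operator Rpos setT (@mellin R).
Proof. exact: (unitary_comp meas_Rpos meas_setT Uop_unitary (@fourier_unitary R)). Qed.

Let Gam (xi : R) : C := cGamma (2^-1 +i* xi).

Lemma cmeas_cGamma_half : cmeas (setT : set RT) Gam.
Proof.
have -> : Gam = fun xi => (Num.sqrt (2 * pi))%:C * refl (ft (fun x => (gker x)%:C)) xi.
  by apply/funext => xi; rewrite /Gam cis_int_gker.
apply: cmeasM; first exact: cmeas_cst.
by apply: cmeas_refl; apply: cmeas_ft; exact: cintegrable_gker.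
Qed.

Lemma cabs_cGamma_half_gt0 (xi : R) : 0 < cabs (Gam xi).
Proof.
have h : 0 < cabs (Gam xi) ^+ 2.
  by rewrite sqr_cabs_cGamma_half divr_gt0 ?pi_gt0// /cosh divr_gt0// addr_gt0// expR_gt0.
rewrite lt0r cabs_ge0 andbT; apply: contraTneq h => ->.
by rewrite expr0n ltxx.
Qed.

Lemma bmellin_unitary : unitary_operator Rpos setT (@bmellin R).
Proof.
have U := unitary_mulop meas_setT.
have := unitary_comp meas_Rpos meas_setT mellin_unitary (U (fun xi => cis (carg (Gam xi))) _ _).
apply.
  (* The phase is Gamma / |Gamma|, whose measurability does not involve the branches of the
     argument. *)
  have -> : (fun xi => cis (carg (Gam xi))) = fun xi => ((cabs (Gam xi))^-1)%:C * Gam xi.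
    apply/funext => xi; rewrite -{3}(cis_carg (Gam xi)) mulrA -rcM mulVf ?mul1r//.
    by rewrite gt_eqF// cabs_cGamma_half_gt0.
  apply: cmeasM; last exact: cmeas_cGamma_half.
  apply: cmeas_real.
  (* From |Gamma|^2 = pi / cosh(pi xi), the inverse modulus is |Gamma| cosh(pi xi) / pi, a product
     of measurable factors. *)
  have -> : (fun xi => (cabs (Gam xi))^-1) =
      fun xi => cabs (Gam xi) * ((expR (pi * xi) + expR (- (pi * xi))) / 2 / pi).
    apply/funext => xi; have g0 := cabs_cGamma_half_gt0 xi.
    have := sqr_cabs_cGamma_half xi; rewrite /cosh -[cGamma _]/(Gam xi) => h.
    have p0 := pi_gt0 R; have e0 := addr_gt0 (expR_gt0 (pi * xi)) (expR_gt0 (- (pi * xi))).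
    move: (cabs _) (expR _ + _) g0 e0 h => g E g0 e0 h.
    apply: (mulfI (lt0r_neq0 g0)); rewrite divff ?gt_eqF//.
    transitivity (g ^+ 2 * (E / 2 / pi)); last by ring.
    move: (@pi R) p0 h => q p0 ->; field.
    by rewrite !gt_eqF.
  apply: measurable_funM; first exact: measurable_cabs cmeas_cGamma_half.
  apply: measurable_funM => //; apply: measurable_funM => //.
  apply: measurable_funD; first by apply: measurableT_comp => //; exact: measurable_funM.
  by apply: measurableT_comp => //; apply: measurableT_comp => //; exact: measurable_funM.
by move=> x; rewrite cabs_cis.
Qed.

Lemma vfun_bmellin f xi : vfun xi * bmellin f xi = Gam xi * mellin f xi.
Proof. by rewrite -cabs_cGamma_half mulrA cis_carg. Qed.

End L2_operators.

(** * Test functions *)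

Section smooth_functions.
Context {R : realType}.

Definition csmooth (f : R -> R) := forall n (x : R), derivable (derive1n n f) x 1.

(** Successive derivatives never leave [P], so that no formula for the n-th one is needed. *)
Lemma smooth_class (P : (R -> R) -> Prop) :
  (forall f, P f -> exists2 g, P g & forall x : R, is_derive x 1 f (g x)) ->
  forall f, P f -> csmooth f.
Proof.
move=> HP f Pf n; suff [g Pg ->] : exists2 g, P g & derive1n n f = g.
  by move=> x; have [h _ dg] := HP g Pg; have [] := dg x.
elim: n f Pf => [|n IHn] f Pf; first by exists f.
have [g Pg dg] := HP f Pf; have [h Ph e] := IHn g Pg; exists h => //.
rewrite derive1Sn -e; congr (derive1n n _).
by apply/funext => x; rewrite derive1E; have [_ ->] := dg x.
Qed.

Lemma csmooth_is_derive f : csmooth f -> forall x : R, is_derive x 1 f (derive1 f x).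
Proof. by move=> sf x; apply: DeriveDef; [exact: (sf 0%N)|rewrite derive1E]. Qed.

Lemma csmooth_derive f : csmooth f -> csmooth (derive1 f).
Proof. by move=> sf n x; have := sf n.+1 x; rewrite derive1Sn. Qed.

Lemma csmooth_continuous f : csmooth f -> continuous f.
Proof. by move=> sf; exact: continuous_of_derive (csmooth_is_derive sf). Qed.

Lemma csmoothN f : csmooth f -> csmooth (fun x => - f x).
Proof.
move=> sf; apply: (smooth_class (P := fun g => exists2 h, csmooth h & g = fun x => - h x)).
  move=> _ [h sh ->]; exists (fun x => - derive1 h x).
    by exists (derive1 h); [exact: csmooth_derive|].
  by move=> x; apply: is_deriveN; exact: csmooth_is_derive.
by exists f.
Qed.

Lemma csmooth0 : csmooth (fun=> 0 : R).
Proof.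
apply: (smooth_class (P := fun g => g = fun=> 0 : R)) => // _ ->.
by exists (fun=> 0) => // x; exact: is_derive_cst.
Qed.

Lemma csmooth_comb (a b : R) f g : csmooth f -> csmooth g ->
  csmooth (fun x => a * f x + b * g x).
Proof.
move=> sf sg; apply: (smooth_class (P := fun h => exists2 u : (R -> R) * (R -> R),
  csmooth u.1 /\ csmooth u.2 & h = fun x => a * u.1 x + b * u.2 x)); last by exists (f, g).
move=> _ [[u v] [/= su sv] ->]; exists (fun x => a * derive1 u x + b * derive1 v x).
  by exists (derive1 u, derive1 v); [split; exact: csmooth_derive|].
move=> x; have du := csmooth_is_derive su x; have dv := csmooth_is_derive sv x.
by apply: is_derive_eq; rewrite /GRing.scale/=; ring.
Qed.

Section flat_functions.
Variable c : R.
Hypothesis c0 : 0 < c.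

(** The case k = 0 is the classical exp(-c/t) extended by 0. The negative powers make the family
    stable under derivation up to linear combinations. As [c] tends to 0 the case k = 0 tends to 1
    for t > 0, which is what lets bumps approximate indicators. *)
Definition flat (k : nat) (t : R) : R := if 0 < t then t ^- k * expR (- (c / t)) else 0.

Lemma flat_ge0 k t : 0 <= flat k t.
Proof.
rewrite /flat; case: ifP => // t0.
by rewrite mulr_ge0 ?expR_ge0// invr_ge0 exprn_ge0// ltW.
Qed.

(** From e^s >= s with s = c / (t (k+2)), raised to the power k+2. Two powers of t survive, which
    makes the derivative at 0 vanish. *)
Lemma le_flat k t : flat k t <= (k.+2%:R / c) ^+ k.+2 * t ^+ 2.
Proof.
rewrite /flat; case: ifP => t0; last by rewrite mulr_ge0 ?sqr_ge0// exprn_ge0// divr_ge0// ltW.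
have k0 : 0 < k.+2%:R :> R by [].
have -> : c / t = (c / t / k.+2%:R) *+ k.+2 by rewrite -mulr_natr divfK.
have -> : expR (- (c / t / k.+2%:R *+ k.+2)) = expR (- (c / t / k.+2%:R)) ^+ k.+2.
  by rewrite -expRM_natl mulr_natl mulNrn.
rewrite -exprVn.
have h : expR (- (c / t / k.+2%:R)) <= k.+2%:R / c * t.
  rewrite expRN -lef_pV2 ?posrE ?invr_gt0 ?expR_gt0// ?mulr_gt0 ?invr_gt0//.
  rewrite invrK !invfM invrK; apply: le_trans (expR_ge1Dx _).
  by rewrite (_ : _ * _ * _ = c / t / k.+2%:R) ?lerDr//; field; rewrite !gt_eqF.
apply: (@le_trans _ _ (t^-1 ^+ k * (k.+2%:R / c * t) ^+ k.+2)).
  rewrite ler_wpM2l ?exprn_ge0 ?invr_ge0 ?(ltW t0)//.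
  by rewrite lerXn2r ?nnegrE ?expR_ge0// mulr_ge0 ?(ltW t0)// divr_ge0// ltW.
rewrite exprMn mulrCA ler_wpM2l ?exprn_ge0 ?divr_ge0// ?(ltW c0)//.
by rewrite -addn2 exprD mulrA -exprMn mulVf ?gt_eqF// expr1n mul1r.
Qed.

Lemma is_derive_invX k (t : R) : t != 0 ->
  is_derive t 1 (fun t : R => t^-1 ^+ k) (- k%:R * t^-1 ^+ k.+1).
Proof.
move=> t0; elim: k => [|k IHk]; first by rewrite mulNr mul0r oppr0; exact: is_derive_cst.
have d1 : is_derive t 1 (fun t : R => t^-1) (- t ^- 2).
  have tn0 : (id : R -> R) t != 0 by [].
  apply: (is_derive_eq (is_deriveV tn0 (is_derive_id t 1))).
  by rewrite /GRing.scale/= mulr1.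
have -> : (fun t : R => t^-1 ^+ k.+1) = fun t => t^-1 * t^-1 ^+ k.
  by apply/funext => s; rewrite exprS.
apply: (is_derive_eq (is_deriveM d1 IHk)).
by rewrite /GRing.scale/= -exprVn !exprS -[k.+1%:R]natr1; ring.
Qed.

Lemma is_derive_flat k (t : R) :
  is_derive t 1 (flat k) (- k%:R * flat k.+1 t + c * flat k.+2 t).
Proof.
have [t0|t0|->] := ltgtP t 0.
- rewrite /flat ltNge (ltW t0) /= !mulr0 addr0.
  apply: (near_eq_is_derive (f := fun=> 0 : R)) => //.
    by near=> s; rewrite ltNge ltW//; near: s; exact: lt_nbhsl.
- apply: (near_eq_is_derive (f := fun t : R => t^-1 ^+ k * expR (- (c * t^-1)))) => //.
    near=> s; rewrite /flat (_ : 0 < s) ?exprVn//; near: s; exact: lt_nbhsr.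
  have d1 : is_derive t 1 (fun t : R => t^-1) (- t ^- 2).
    have tn0 : (id : R -> R) t != 0 by rewrite gt_eqF.
    apply: (is_derive_eq (is_deriveV tn0 (is_derive_id t 1))).
    by rewrite /GRing.scale/= mulr1.
  have dk := is_derive_invX k (lt0r_neq0 t0).
  have d2 : is_derive t 1 (fun t : R => expR (- (c * t^-1))) (c * t ^- 2 * expR (- (c * t^-1))).
    by apply: is_derive_eq; rewrite /GRing.scale/=; ring.
  apply: (is_derive_eq (is_deriveM dk d2)).
  rewrite /GRing.scale/= /flat t0 -!exprVn !exprS; ring.
- rewrite /flat ltxx !mulr0 addr0.
  (* By [le_flat] the difference quotient at 0 is at most K |h|, from either side. *)
  have lim : h^-1 *: (flat k (h *: 1 + 0) - flat k 0) @[h --> (0:R)^'] --> (0 : R).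
    pose K := (k.+2%:R / c) ^+ k.+2.
    apply: norm_cvg0; apply: (@squeeze_cvgr _ _ _ _ (fun=> 0) (fun h => K * `|h|)).
    - near=> h; have h0 : h != 0 by near: h; exact: nbhs_dnbhs_neq.
      rewrite normr_ge0 /= {2}/flat ltxx subr0 addr0 /GRing.scale/= mulr1 normrM normfV.
      rewrite (ger0_norm (flat_ge0 k h)) mulrC ler_pdivrMr ?normr_gt0//.
      apply: le_trans (le_flat k h) _.
      by rewrite -[leRHS]mulrA -expr2 real_normK ?num_real.
    - exact: cvg_cst.
    - have H : K * `|h| @[h --> (0 : R)^'] --> K * `|0 : R|.
        apply: cvgM; first exact: cvg_cst.
        by apply: cvg_norm; apply: cvg_within_filter; exact: cvg_id.
      by rewrite normr0 mulr0 in H.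
  apply: DeriveDef; first by apply/cvg_ex; exists 0.
  exact/cvg_lim.
Unshelve. all: by end_near. Qed.

Lemma flat0_le1 t : flat 0 t <= 1.
Proof.
rewrite /flat expr0 invr1 mul1r; case: ifP => t0 //.
by rewrite -expR0 ler_expR oppr_le0 divr_ge0// ltW.
Qed.

(** A class containing [bump] and stable under derivation, as [smooth_class] demands. *)
Inductive bumps (a b : R) : (R -> R) -> Prop :=
| bumps_gen r k j : bumps a b (fun x => r * (flat k (x - a) * flat j (b - x)))
| bumps_add f g : bumps a b f -> bumps a b g -> bumps a b (fun x => f x + g x).

Lemma csmooth_bumps a b f : bumps a b f -> csmooth f.
Proof.
apply: smooth_class => {}f; elim=> [r k j|f1 g1 _ [df1 Bf1 d1] _ [dg1 Bg1 d2]]; last first.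
  exists (fun x => df1 x + dg1 x); first exact: bumps_add.
  by move=> x; have h1 := d1 x; have h2 := d2 x; exact: is_deriveD.
pose u k j r x := r * (flat k (x - a) * flat j (b - x)).
exists (fun x => (u k.+1 j (- k%:R * r) x + u k.+2 j (c * r) x) +
                 (u k j.+1 (j%:R * r) x + u k j.+2 (- c * r) x)).
  by do 2![apply: bumps_add]; exact: bumps_gen.
move=> x.
have d1 : is_derive x 1 (fun x => flat k (x - a))
    ((- k%:R * flat k.+1 (x - a) + c * flat k.+2 (x - a)) * 1).
  apply: (@is_derive1_comp R (flat k) (fun x => x - a)); first exact: is_derive_flat.
  by apply: is_derive_eq; rewrite subr0.
have d2 : is_derive x 1 (fun x => flat j (b - x))
    ((- j%:R * flat j.+1 (b - x) + c * flat j.+2 (b - x)) * -1).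
  apply: (@is_derive1_comp R (flat j) (fun x => b - x)); first exact: is_derive_flat.
  apply: (is_derive_eq (is_deriveB (is_derive_cst b x 1) (is_derive_id x 1))).
  by rewrite sub0r.
apply: (is_derive_eq (is_deriveM (is_derive_cst r x 1) (is_deriveM d1 d2))).
by rewrite /GRing.scale/= /u; ring.
Qed.

Definition bump (a b x : R) : R := flat 0 (x - a) * flat 0 (b - x).

Lemma csmooth_bump a b : csmooth (bump a b).
Proof.
have -> : bump a b = fun x => 1 * (flat 0 (x - a) * flat 0 (b - x)).
  by apply/funext => x; rewrite mul1r.
exact: csmooth_bumps (bumps_gen a b 1 0 0).
Qed.

Lemma bump_ge0 a b x : 0 <= bump a b x.
Proof. by rewrite mulr_ge0// flat_ge0. Qed.

Lemma bump_le1 a b x : bump a b x <= 1.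
Proof. by rewrite -(mulr1 1) ler_pM// ?flat_ge0// flat0_le1. Qed.

Lemma bump_out a b x : ~~ (a < x < b) -> bump a b x = 0.
Proof.
rewrite negb_and /bump /flat !subr_gt0 => /orP[|] /negbTE ->; rewrite ?mul0r ?mulr0//.
Qed.

End flat_functions.

End smooth_functions.

(** * Density of test functions in L^2 *)

Section test_functions.
Context {R : realType}.
Local Notation mu := (@lebesgue_measure R).
Local Notation C := R[i].
Local Notation RT := (measurableTypeR R).
Implicit Types F G : R -> C.

Lemma rcB (x y : R) : (x - y)%:C = x%:C - y%:C.
Proof. by rewrite rmorphB. Qed.

Lemma test_funP F : test_fun F <->
  [/\ csmooth (fun x => Re (F x)), csmooth (fun x => Im (F x)) &
      exists a b : R, 0 < a /\ supported_in a b F].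
Proof.
split=> [[sF supp]|[s1 s2 supp]]; split=> //.
- by move=> n x; have [] := sF n x.
- by move=> n x; have [] := sF n x.
Qed.

Lemma supported_in_widen (a b a' b' : R) F : a' <= a -> b <= b' ->
  supported_in a b F -> supported_in a' b' F.
Proof.
move=> aa bb sF x nx; apply: sF; apply: contra_not nx => /andP[ax xb].
by rewrite (le_trans aa ax) (le_trans xb bb).
Qed.

Lemma test_comb (c : C) F G : test_fun F -> test_fun G ->
  test_fun (fun x => c * F x + G x).
Proof.
move=> /test_funP[F1 F2 [a [b [a0 sF]]]] /test_funP[G1 G2 [a' [b' [a0' sG]]]].
apply/test_funP; split.
- have -> : (fun x => Re (c * F x + G x)) =
      fun x => 1 * (Re c * Re (F x) + - Im c * Im (F x)) + 1 * Re (G x).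
    by apply/funext => x; rewrite !ReImE; ring.
  exact: (@csmooth_comb R _ _ _ _ (@csmooth_comb R _ _ _ _ F1 F2) G1).
- have -> : (fun x => Im (c * F x + G x)) =
      fun x => 1 * (Re c * Im (F x) + Im c * Re (F x)) + 1 * Im (G x).
    by apply/funext => x; rewrite !ReImE; ring.
  exact: (@csmooth_comb R _ _ _ _ (@csmooth_comb R _ _ _ _ F2 F1) G2).
- exists (Num.min a a'), (Num.max b b'); split; first by rewrite lt_min a0.
  move=> x nx.
  rewrite (supported_in_widen (a := a) (b := b) _ _ sF nx) ?ge_min ?le_max ?lexx//.
  rewrite (supported_in_widen (a := a') (b := b') _ _ sG nx) ?ge_min ?le_max ?lexx ?orbT//.
  by rewrite mulr0 addr0.
Qed.

Lemma testJ F : test_fun F -> test_fun (fun x => (F x)^*).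
Proof.
move=> /test_funP[F1 F2 [a [b [a0 sF]]]]; apply/test_funP; split.
- have -> : (fun x => Re (F x)^*) = fun x => Re (F x) by apply/funext => x; rewrite ReJ.
  exact: F1.
- have -> : (fun x => Im (F x)^*) = fun x => - Im (F x) by apply/funext => x; rewrite ImJ.
  exact: csmoothN F2.
- by exists a, b; split => // x nx; rewrite sF// conjC0.
Qed.

Lemma test_bump (c a b : R) : 0 < c -> 0 < a -> test_fun (fun x => (bump c a b x)%:C).
Proof.
move=> c0 a0; apply/test_funP; split => /=.
- exact: csmooth_bump.
- exact: csmooth0.
- exists a, b; split => // x nx; rewrite bump_out//; apply/negP => /andP[ax xb].
  by apply: nx; rewrite !ltW.
Qed.

Lemma bounded_support (f : R -> R) (a b : R) : continuous f ->
  (forall x, ~ (a <= x <= b) -> f x = 0) -> exists M, forall x, `|f x| <= M.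
Proof.
move=> cf sf; have [ab|ba] := leP a b; last first.
  exists 0 => x; rewrite sf ?normr0// => /andP[ax xb].
  by have := le_trans ax xb; rewrite leNgt ba.
have cn : {within `[a, b], continuous (fun x => `|f x|)}.
  by apply: continuous_subspaceT => x; apply: cvg_norm; exact: cf.
have [c _ Hc] := EVT_max ab cn; exists `|f c| => x.
have [xab|nx] := boolP (a <= x <= b); first by apply: Hc; rewrite in_itv.
by rewrite sf ?normr0//; exact/negP.
Qed.

Lemma test_cmeas F : test_fun F -> cmeas (setT : set RT) F.
Proof.
by move=> /test_funP[F1 F2 _]; split; apply: continuous_measurable_fun; exact: csmooth_continuous.
Qed.

Lemma test_bounded F : test_fun F -> exists M, forall x, cabs (F x) <= M.
Proof.
move=> /test_funP[F1 F2 [a [b [a0 sF]]]].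
have [M1 H1] := bounded_support (csmooth_continuous F1) (fun x nx => congr1 (@complex.Re R) (sF x nx)).
have [M2 H2] := bounded_support (csmooth_continuous F2) (fun x nx => congr1 (@complex.Im R) (sF x nx)).
by exists (M1 + M2) => x; apply: le_trans (le_cabs_ReIm _) _; rewrite lerD.
Qed.

Lemma bounded_support_cintegrable (F : R -> C) (a b M : R) :
  cmeas (setT : set RT) F -> supported_in a b F -> (forall x, cabs (F x) <= M) ->
  cintegrable mu setT F /\ L2 setT F.
Proof.
move=> mF sF FM.
have M0 : 0 <= M := le_trans (cabs_ge0 (F 0)) (FM 0).
have I (k : R) : mu.-integrable setT (EFin \o (fun x : R => k * \1_(`[a, b]%classic : set RT) x)).
  rewrite /comp; under eq_fun do rewrite EFinM.
  by apply: integrableZl => //; exact: integrable_indic_itv.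
have bd x : cabs (F x) <= M * \1_(`[a, b]%classic : set RT) x.
  rewrite indicE; have [xab|nx] := boolP (a <= x <= b).
    by rewrite mem_set ?mulr1 ?FM//= in_itv.
  by rewrite sF ?cabs0 ?mulr_ge0//; exact/negP.
split; first exact: (le_cintegrable (T := RT) measurableT mF (fun x _ => bd x) (I M)).
apply: (le_L2 measurableT mF _ (I (M ^+ 2))) => x _.
apply: (@le_trans _ _ ((M * \1_(`[a, b]%classic : set RT) x) ^+ 2)).
  by rewrite lerXn2r ?nnegrE ?cabs_ge0 ?mulr_ge0.
by rewrite exprMn ler_wpM2l ?sqr_ge0// indicE; case: (_ \in _); rewrite ?expr1n ?expr0n.
Qed.

Lemma test_cintegrable F : test_fun F -> cintegrable mu setT F.
Proof.
move=> tF; have [M FM] := test_bounded tF; have mF := test_cmeas tF.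
have [_ [a [b [_ sF]]]] := tF.
by case: (bounded_support_cintegrable mF sF FM).
Qed.

Lemma L2_subset (D : set R) F : meas D -> L2 setT F -> L2 D F.
Proof.
move=> mD LF; have [[m1 m2] i] := (L2P setT F).1 LF.
apply/L2P; split; first by split; exact: measurable_funTS.
exact: (@integrableS _ _ _ mu setT).
Qed.

Lemma test_L2 F : test_fun F -> L2 Rpos F.
Proof.
move=> tF; have [M FM] := test_bounded tF; have mF := test_cmeas tF.
have [_ [a [b [_ sF]]]] := tF.
by apply: (L2_subset meas_Rpos); case: (bounded_support_cintegrable mF sF FM).
Qed.

(** Bumps with parameter 1/(n+1) tend pointwise to the indicator of the open interval while staying
    between 0 and 1, so dominated convergence applies. *)
Lemma bump_dense (a b e : R) : 0 < a -> a < b -> 0 < e ->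
  exists2 F, test_fun F & nrm Rpos (fun x => ind a b x - F x) <= e.
Proof.
move=> a0 ab e0.
(* The bumps vanish at [b], hence the open interval; it differs from []a, b]] by a null set. *)
pose indo x : C := (\1_(`]a, b[%classic : set RT) x : R)%:C.
have mindo : cmeas (setT : set RT) indo by apply: cmeas_real; exact: measurable_indic.
have n0 n : 0 < n.+1%:R^-1 :> R by rewrite invr_gt0.
pose f_ n x : C := (bump n.+1%:R^-1 a b x)%:C.
have tf n : test_fun (f_ n) by exact: test_bump.
have fo n x : ~~ (a < x < b) -> indo x - f_ n x = 0.
  move=> nx; rewrite /indo /f_ bump_out// indicE memNset ?subrr//=.
  by rewrite in_itv /=; exact/negP.
have fi n x : a < x < b -> cabs (indo x - f_ n x) = 1 - bump n.+1%:R^-1 a b x.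
  move=> nx; rewrite /indo /f_ -rcB cabsC indicE mem_set; last by rewrite /= in_itv.
  by rewrite ger0_norm// subr_ge0 bump_le1.
have cv : nrm Rpos (fun x => indo x - f_ n x) @[n --> \oo] --> (0 : R).
  apply: (nrm_dct (G := \1_(`[a, b]%classic : set RT))) => //.
  - exact: measurable_Rpos.
  - by move=> n; have [m1 m2] := test_cmeas (tf n); split; exact: measurable_funTS.
  - by have [m1 m2] := mindo; split; exact: measurable_funTS.
  - move=> x _; have [xab|nx] := boolP (a < x < b); last first.
      by under eq_fun do rewrite fo// cabs0; exact: cvg_cst.
    under eq_fun do rewrite fi//.
    rewrite -(subrr (1 : R)); apply: cvgB; first exact: cvg_cst.
    move: xab => /andP[ax xb].
    rewrite -[X in _ --> X](mulr1 1); apply: cvgM.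
      rewrite /flat subr_gt0 ax; under eq_fun do rewrite expr0 invr1 mul1r.
      exact: cvg_expN_harmonic.
    rewrite /flat subr_gt0 xb; under eq_fun do rewrite expr0 invr1 mul1r.
    exact: cvg_expN_harmonic.
  - move=> n x _; rewrite indicE; have [xab|nx] := boolP (a < x < b).
      rewrite fi// mem_set; last by rewrite /= in_itv /=; move: xab => /andP[/ltW -> /ltW].
      by rewrite expr_le1// ?subr_ge0 ?bump_le1// gerBl bump_ge0.
    by rewrite fo// cabs0 expr0n.
  - by apply: (@integrableS _ _ _ mu setT) => //; [exact: measurable_Rpos|exact: integrable_indic_itv].
have Lindo : L2 Rpos indo.
  apply: (L2_subset meas_Rpos).
  have := @bounded_support_cintegrable indo a b 1 mindo; case=> //.
    move=> x nx; rewrite /indo indicE memNset//= in_itv /= => /andP[ax xb].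
    by apply: nx; rewrite !ltW.
  by move=> x; rewrite cabsC ger0_norm ?indicE//; case: (_ \in _).
have Lind : L2 Rpos (ind a b) := L2_subset meas_Rpos (L2_ind a b).
have ii : ind a b = indo %[ae mu in Rpos].
  exists [set b]; split => //; first exact: lebesgue_measure_set1.
  move=> x /= H; apply: contra_notP H => xb _; rewrite /ind /indo !indicE.
  congr (_ %:R)%:C; congr nat_of_bool; apply/idP/idP; rewrite !inE /= !in_itv /=.
    by move=> /andP[-> h]; rewrite lt_neqAle h andbT; apply/eqP.
  by move=> /andP[-> /ltW].
have /cvgrPdist_le/(_ _ e0)[N _ H] := cv.
exists (f_ N) => //.
have := H N (leqnn N); rewrite sub0r normrN ger0_norm ?nrm_ge0//; apply: le_trans.
apply: le_trans (le_nrmB3 measurable_Rpos Lind Lindo (test_L2 (tf N))) _.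
by rewrite /nrm (ae_eq_nrm2B measurable_Rpos Lind Lindo ii) sqrtr0 add0r.
Qed.

Lemma test_dense f (e : R) : L2 Rpos f -> 0 < e ->
  exists2 F, test_fun F & nrm Rpos (fun x => f x - F x) <= e.
Proof.
move=> Lf; move: e.
pose K f := forall e : R, 0 < e -> exists2 F, test_fun F & nrm Rpos (fun x => f x - F x) <= e.
have t0 : test_fun (fun=> 0 : C).
  apply/test_funP; split=> /=; [exact: csmooth0|exact: csmooth0|].
  by exists 1, 1.
have DB : (@Rpos R) = \bigcup_n `](n.+1%:R^-1 : R), n.+1%:R]%classic.
  apply/seteqP; split=> x /=.
    rewrite /Rpos /= in_itv /= andbT => x0.
    (* The bound exceeds x + 1/x, hence both x and 1/x, which places x in the window of that
       index. *)
    have := archi_boundP (addr_ge0 (ltW x0) (ltW (_ : 0 < x^-1))).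
    rewrite invr_gt0 x0 => /(_ isT); set N := Num.bound _ => xN.
    have xi0 : 0 < x^-1 by rewrite invr_gt0.
    have N1 : N%:R <= N.+1%:R :> R by rewrite ler_nat.
    exists N => //=; rewrite in_itv /= -[X in _ < X]invrK ltf_pV2 ?posrE//; last first.
    by apply/andP; split; lra.
  by move=> [n _] /=; rewrite /Rpos /= !in_itv /= andbT => /andP[+ _]; apply: lt_trans; rewrite invr_gt0.
apply: (@L2_density_ind R Rpos (fun n => n.+1%:R^-1) (fun n => n.+1%:R) DB _ _ K) Lf.
- by move=> n; rewrite lef_pV2 ?posrE// ler_nat.
- by move=> n; rewrite ler_nat.
- move=> e e0; exists (fun=> 0) => //.
  have L0 := L20 (measurable_Rpos (R := R)).
  by rewrite /nrm (ae_eq_nrm2B measurable_Rpos L0 L0) ?sqrtr0 ?(ltW e0)//; exact: ae_eq_refl.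
- move=> c f1 g1 Lf1 Lg1 Kf Kg e e0.
  have c1 : 0 < cabs c + 1 by rewrite ltr_wpDl// cabs_ge0.
  have e1 : 0 < e / 2 / (cabs c + 1) by rewrite !divr_gt0.
  have e2 : 0 < e / 2 by rewrite divr_gt0.
  have [F tF fF] := Kf _ e1; have [G tG gG] := Kg _ e2.
  exists (fun x => c * F x + G x); first exact: test_comb.
  have LfF := L2B measurable_Rpos Lf1 (test_L2 tF).
  have LgG := L2B measurable_Rpos Lg1 (test_L2 tG).
  have -> : (fun x => c * f1 x + g1 x - (c * F x + G x)) =
      fun x => c * (f1 x - F x) + (g1 x - G x) by apply/funext => x; ring.
  apply: le_trans (le_nrmD measurable_Rpos (L2Z measurable_Rpos c LfF) LgG) _.
  rewrite (nrmZ measurable_Rpos c LfF) (splitr e) lerD//.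
  apply: (@le_trans _ _ ((cabs c + 1) * (e / 2 / (cabs c + 1)))); last first.
    by rewrite mulrC divfK// gt_eqF.
  by apply: ler_pM => //; [exact: cabs_ge0|exact: nrm_ge0|rewrite lerDl].
- move=> f1 Lf1 Hf1 e e0; have e2 : 0 < e / 2 by rewrite divr_gt0.
  have [g [Lg Kg fg]] := Hf1 _ e2; have [F tF gF] := Kg _ e2.
  exists F => //; apply: le_trans (le_nrmB3 measurable_Rpos Lf1 Lg (test_L2 tF)) _.
  by rewrite (splitr e) lerD.
- move=> n a b na ab _ e e0; apply: bump_dense => //.
  by apply: lt_le_trans na; rewrite invr_gt0.
Qed.

End test_functions.

(** * Convolution and the Laplace transform *)

Section convolution.
Context {R : realType}.
Local Notation mu := (@lebesgue_measure R).
Local Notation C := R[i].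
Local Notation RT := (measurableTypeR R).

Definition cconv (u v : R -> C) (x : R) : C := cInt mu setT (fun y : RT => u y * v (x - y)).

Lemma integral_cabs_shift (v : R -> C) (y : R) : cmeas (setT : set RT) v ->
  (\int[mu]_x (cabs (v (x - y)))%:E = \int[mu]_x (cabs (v x))%:E)%E.
Proof.
move=> mv; have mc : measurable_fun setT (fun x : RT => (cabs (v x))%:E).
  by apply/measurable_EFinP; exact: measurable_cabs mv.
have c0 (x : R) : (0 <= (cabs (v x))%:E)%E by rewrite lee_fin cabs_ge0.
rewrite -(@ge0_integral_affine _ 1 (- y) _ (or_introl erefl) mc c0).
by apply: eq_integral => x _; rewrite mul1r.
Qed.

Lemma cintegrable_conv_kernel u v : cintegrable mu setT u -> cintegrable mu setT v ->
  cintegrable (mu \x mu)%E setT (fun z : RT * RT => u z.2 * v (z.1 - z.2)).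
Proof.
move=> iu iv; have mu_ := iu.1; have mv := iv.1.
have mF : cmeas setT (fun z : RT * RT => u z.2 * v (z.1 - z.2)).
  apply: cmeasM; first exact: cmeas_snd.
  apply: (cmeas_comp (phi := fun z : RT * RT => z.1 - z.2 : RT) mv).
  by apply: measurable_funB; [exact: measurable_fst|exact: measurable_snd].
apply: cintegrable_prod21 => //.
have E (y : RT) : (\int[mu]_x (cabs (u y * v (x - y)))%:E =
    (cabs (u y))%:E * (\int[mu]_x cabs (v x))%:E)%E.
  under eq_integral do rewrite cabsM EFinM.
  have mvy : measurable_fun setT (fun x : RT => (cabs (v (x - y)))%:E).
    apply/measurable_EFinP.
    have := cmeas_comp (phi := fun x : RT => x - y : RT) mv.
    move=> /(_ _)/measurable_cabs; apply; exact: measurable_funB.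
  have c0 (x : RT) : setT x -> (0 <= (cabs (v (x - y)))%:E)%E by rewrite lee_fin cabs_ge0.
  have u0 : (0 <= (cabs (u y))%:E)%E by rewrite lee_fin cabs_ge0.
  rewrite (ge0_integralZl mu measurableT mvy c0 u0) integral_cabs_shift//.
  by rewrite cintegrable_fin.
under eq_integral do rewrite /= E.
have mcu : measurable_fun setT (fun y : RT => (cabs (u y))%:E).
  by apply/measurable_EFinP; exact: measurable_cabs mu_.
have c0 (x : RT) : setT x -> (0 <= (cabs (u x))%:E)%E by rewrite lee_fin cabs_ge0.
have N0 : (0 <= (\int[mu]_x cabs (v x))%:E)%E.
  by rewrite lee_fin; apply: Rintegral_ge0 => x _; exact: cabs_ge0.
rewrite (ge0_integralZr mu measurableT mcu c0 N0) cintegrable_fin//.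
by rewrite -EFinM ltry.
Qed.

Lemma cInt_conv u v : cintegrable mu setT u -> cintegrable mu setT v ->
  cintegrable mu setT (cconv u v) /\
  cInt mu setT (cconv u v) = cInt mu setT u * cInt mu setT v.
Proof.
move=> iu iv; have [i1 _ e] := cfubini (cintegrable_conv_kernel iu iv).
split; first exact: i1.
transitivity (cInt mu setT (fun y => cInt mu setT (fun x : RT => u y * v (x - y)))).
  exact: e.
rewrite -(cIntZr (T := RT) measurableT _ iu); apply: eq_cInt => y _.
have iv1 := cintegrable_affine (- y) (or_introl erefl : 1 = 1 \/ 1 = -1 :> R) iv.
rewrite -(cInt_affine (- y) (or_introl erefl : 1 = 1 \/ 1 = -1 :> R) iv.1).
rewrite -(cIntZ (T := RT) measurableT _ iv1); apply: eq_cInt => x _.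
by rewrite mul1r.
Qed.

Lemma bounded_L1_L2 u (M : R) : cintegrable mu setT u -> (forall x, cabs (u x) <= M) ->
  L2 setT u.
Proof.
move=> [mu_ iu] uM.
apply: (le_L2 measurableT (g := fun x => M * cabs (u x)) mu_).
  by move=> x _; rewrite expr2 ler_wpM2r// cabs_ge0.
rewrite /comp; under eq_fun do rewrite EFinM.
by apply: integrableZl.
Qed.

Definition rconv (f g : R -> R) (t : R) : R := \int[mu]_s (f s * g (t - s)).

Definition nice (g : R -> R) := csmooth g /\
  exists a b : R, forall x, ~ (a <= x <= b) -> g x = 0.

Lemma nice_bounded g : nice g -> exists M, forall x, `|g x| <= M.
Proof. by move=> [sg [a [b H]]]; exact: bounded_support (csmooth_continuous sg) H. Qed.

Lemma nice_derive g : nice g -> nice (derive1 g).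
Proof.
move=> [sg [a [b H]]]; split; first exact: csmooth_derive.
exists a, b => x nx; rewrite derive1E.
have : is_derive x 1 g 0; last by case.
apply: (near_eq_is_derive (f := fun=> 0 : R)) => //.
move: nx => /negP; rewrite negb_and -!ltNge => /orP[xa|bx].
- near=> y; rewrite H// => /andP[ay _].
  have : y < a by near: y; exact: lt_nbhsl.
  by rewrite ltNge ay.
- near=> y; rewrite H// => /andP[_ yb].
  have : b < y by near: y; exact: lt_nbhsr.
  by rewrite ltNge yb.
Unshelve. all: by end_near. Qed.

Lemma integrable_rconv f g (t : R) : mu.-integrable setT (EFin \o f) -> nice g ->
  mu.-integrable setT (EFin \o (fun s => f s * g (t - s))).
Proof.
move=> jf ng; have [M HM] := nice_bounded ng; have cg := csmooth_continuous ng.1.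
have mf : measurable_fun setT f by have /integrableP[/measurable_EFinP] := jf.
have i2 : mu.-integrable setT (fun s => M%:E * (f s)%:E)%E by apply: integrableZl.
apply: le_integrable i2 => //.
  apply/measurable_EFinP; apply: measurable_funM => //.
  apply: measurableT_comp; first exact: (continuous_measurable_fun cg).
  exact: measurable_funB.
move=> s _; rewrite /= lee_fin !normrM mulrC ler_wpM2r//.
by apply: le_trans (HM _) (ler_norm _).
Qed.

(** The derivative falls on the smooth factor [g], whose derivative is bounded; [f] need only be
    integrable, and M |f| is the majorant. *)
Lemma is_derive_rconv f g (t : R) : mu.-integrable setT (EFin \o f) -> nice g ->
  is_derive t 1 (rconv f g) (rconv f (derive1 g) t).
Proof.
move=> jf ng; have ndg := nice_derive ng; have [M HM] := nice_bounded ndg.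
pose F x s := f s * g (x - s).
have dF (x s : R) : is_derive x 1 (F ^~ s) (f s * derive1 g (x - s)).
  have d1 : is_derive x 1 (fun x => g (x - s)) (derive1 g (x - s) * 1).
    apply: (@is_derive1_comp R g (fun x => x - s)); first exact: csmooth_is_derive ng.1 _.
    by apply: is_derive_eq; rewrite subr0.
  apply: (is_derive_eq (is_deriveM (is_derive_cst (f s) x 1) d1)).
  by rewrite /GRing.scale/= mulr0 addr0 mulr1.
have It : `]t - 1, t + 1[%classic t by rewrite /= in_itv /= ltrBlDr ltrDl ltr01.
have p1 x s : partial1of2 F x s = f s * derive1 g (x - s).
  by rewrite partial1of2E; have [_ ->] := dF x s.
have G0 s : 0 <= `|f s| * M by rewrite mulr_ge0// (le_trans _ (HM 0)).
have iG : mu.-integrable setT (EFin \o (fun s => `|f s| * M)).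
  rewrite /comp; under eq_fun do rewrite EFinM.
  apply: integrableZr => //; have := integrable_abse jf; exact: eq_integrable.
have H1 x : `]t - 1, t + 1[%classic x -> mu.-integrable setT (EFin \o F x).
  by move=> _; exact: integrable_rconv.
have H2 x s : `]t - 1, t + 1[%classic x -> setT s -> derivable (F ^~ s) x 1.
  by move=> _ _; have [] := dF x s.
have H3 x s : `]t - 1, t + 1[%classic x -> setT s -> `|partial1of2 F x s| <= `|f s| * M.
  by move=> _ _; rewrite p1 normrM ler_wpM2l.
split; first exact: (derivable_under_integral measurableT It H1 H2 G0 iG H3).
rewrite -derive1E (differentiation_under_integral measurableT It H1 H2 G0 iG H3).
by apply: eq_Rintegral => s _; rewrite p1.
Qed.

(** Sums of two convolutions, because the real and imaginary parts of a complex convolution have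
    this shape; the class is stable under derivation. *)
Lemma csmooth_rconvD f1 f2 g1 g2 :
  mu.-integrable setT (EFin \o f1) -> mu.-integrable setT (EFin \o f2) ->
  nice g1 -> nice g2 -> csmooth (fun t => rconv f1 g1 t + rconv f2 g2 t).
Proof.
move=> j1 j2 n1 n2; apply: (smooth_class (P := fun F => exists g : (R -> R) * (R -> R),
  [/\ nice g.1, nice g.2 & F = fun t => rconv f1 g.1 t + rconv f2 g.2 t])).
  move=> _ [[u v] [/= nu nv ->]].
  exists (fun t => rconv f1 (derive1 u) t + rconv f2 (derive1 v) t).
    by exists (derive1 u, derive1 v); split; [exact: nice_derive|exact: nice_derive|].
  move=> t; apply: is_deriveD; exact: is_derive_rconv.
by exists (g1, g2); split.
Qed.

Section test_convolution.
Variables f g : R -> C.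
Hypotheses (tf : test_fun f) (tg : test_fun g).

(** Both factors vanish on the negative half-line, so the integrand is zero outside [[0, t]] and the
    results on the whole line apply. *)
Lemma half_convolutionE : half_convolution f g = cconv f g.
Proof.
have [_ [a [b [a0 sf]]]] := tf; have [_ [a' [b' [a0' sg]]]] := tg.
apply/funext => t; have out (s : R) : ~ (0 <= s <= t) -> f s * g (t - s) = 0.
  move=> /negP; rewrite negb_and -!ltNge => /orP[s0|ts].
    by rewrite sf ?mul0r// => /andP[as_ _]; have := lt_le_trans a0 (ltW (le_lt_trans as_ s0)); rewrite ltxx.
  rewrite sg ?mulr0// => /andP[h _]; have := lt_le_trans a0' h.
  by rewrite subr_gt0 ltNge (ltW ts).
rewrite /half_convolution /cconv; apply: complexP => /=.
  rewrite [LHS]Rintegral_mkcond; apply: eq_Rintegral => s _; rewrite patchE.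
  case: ifPn => //; rewrite notin_setE /= in_itv /= => h.
  by rewrite out.
rewrite [LHS]Rintegral_mkcond; apply: eq_Rintegral => s _; rewrite patchE.
case: ifPn => //; rewrite notin_setE /= in_itv /= => h.
by rewrite out.
Qed.

Lemma test_nice F : test_fun F -> nice (fun x => Re (F x)) /\ nice (fun x => Im (F x)).
Proof.
move=> /test_funP[F1 F2 [a [b [_ sF]]]].
by split; split=> //; exists a, b => x nx; rewrite sF.
Qed.

Lemma test_half_convolution : test_fun (half_convolution f g).
Proof.
have [_ [a [b [a0 sf]]]] := tf; have [_ [a' [b' [a0' sg]]]] := tg.
have itf := test_cintegrable tf; have itg := test_cintegrable tg.
have [ng1 ng2] := test_nice tg.
have jr : mu.-integrable setT (EFin \o (fun x => Re (f x))) := cintegrable_Re measurableT itf.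
have ji : mu.-integrable setT (EFin \o (fun x => Im (f x))) := cintegrable_Im measurableT itf.
have jn : mu.-integrable setT (EFin \o (fun x => - Im (f x))).
  by have := integrableN ji; apply: eq_integrable.
rewrite half_convolutionE; apply/test_funP; split.
- have -> : (fun x => Re (cconv f g x)) =
      fun t => rconv (fun x => Re (f x)) (fun x => Re (g x)) t +
               rconv (fun x => - Im (f x)) (fun x => Im (g x)) t.
    apply/funext => t; rewrite /cconv /= /rconv.
    rewrite -(RintegralD measurableT (integrable_rconv t jr ng1) (integrable_rconv t jn ng2)).
    by apply: eq_Rintegral => s _; rewrite ReImE mulNr.
  exact: csmooth_rconvD.
- have -> : (fun x => Im (cconv f g x)) =
      fun t => rconv (fun x => Re (f x)) (fun x => Im (g x)) t +
               rconv (fun x => Im (f x)) (fun x => Re (g x)) t.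
    apply/funext => t; rewrite /cconv /= /rconv.
    rewrite -(RintegralD measurableT (integrable_rconv t jr ng2) (integrable_rconv t ji ng1)).
    by apply: eq_Rintegral => s _; rewrite ReImE.
  exact: csmooth_rconvD.
- exists (a + a'), (b + b'); split; first exact: addr_gt0.
  move=> t nt; rewrite /cconv.
  have z (s : R) : f s * g (t - s) = 0.
    have [/andP[as_ sb]|/negP ns] := boolP (a <= s <= b); last by rewrite sf ?mul0r.
    have [/andP[h1 h2]|/negP ns] := boolP (a' <= t - s <= b'); last by rewrite sg ?mulr0.
    by exfalso; apply: nt; apply/andP; split; lra.
  transitivity (cInt mu setT (fun _ : RT => 0 : C)); first by apply: eq_cInt => s _; exact: z.
  by apply: complexP; rewrite /= /Rintegral integral0.
Qed.

End test_convolution.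

Lemma laplaceE F (l : R) : test_fun F ->
  laplace F l%:C = cInt mu setT (fun t => (expR (- (t * l)))%:C * F t).
Proof.
move=> [_ [a [b [a0 sF]]]]; rewrite /laplace.
have E (t : R) : cexp (- (t%:C * l%:C)) = (expR (- (t * l)))%:C.
  by rewrite -cexpC; congr cexp; apply: complexP => /=; ring.
have out (t : R) : ~ Rpos t -> F t = 0.
  rewrite /Rpos /= in_itv /= andbT => /negP; rewrite -leNgt => t0.
  by apply: sF => /andP[h _]; have := lt_le_trans a0 (le_trans h t0); rewrite ltxx.
apply: complexP => /=.
  rewrite [LHS]Rintegral_mkcond; apply: eq_Rintegral => t _; rewrite patchE E.
  by case: ifPn => //; rewrite notin_setE => /out ->; rewrite mulr0.
rewrite [LHS]Rintegral_mkcond; apply: eq_Rintegral => t _; rewrite patchE E.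
by case: ifPn => //; rewrite notin_setE => /out ->; rewrite mulr0.
Qed.

Lemma cintegrable_laplace F (l : R) : 0 <= l -> test_fun F ->
  cintegrable mu setT (fun t => (expR (- (t * l)))%:C * F t).
Proof.
move=> l0 tF; have itF := test_cintegrable tF; have [_ [a [b [a0 sF]]]] := tF.
apply: (le_cintegrable (T := RT) measurableT (g := fun t => cabs (F t))).
- apply: cmeasM; last exact: itF.1.
  apply: cmeas_real; apply: measurableT_comp => //; apply: measurableT_comp => //.
  exact: measurable_funM.
- move=> t _; have [t0|t0] := leP 0 t.
    rewrite cabsM cabsC ger0_norm ?expR_ge0// ler_piMl ?cabs_ge0//.
    by rewrite -expR0 ler_expR oppr_le0 mulr_ge0.
  by rewrite (sF t) ?mulr0// => /andP[h _]; have := lt_trans a0 (le_lt_trans h t0); rewrite ltxx.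
- exact: itF.2.
Qed.

Lemma laplace_half_convolution F G (l : R) : 0 <= l -> test_fun F -> test_fun G ->
  laplace (half_convolution F G) l%:C = laplace F l%:C * laplace G l%:C.
Proof.
move=> l0 tF tG; rewrite !laplaceE//; last exact: test_half_convolution.
have [_ <-] := cInt_conv (cintegrable_laplace l0 tF) (cintegrable_laplace l0 tG).
apply: eq_cInt => t _; rewrite half_convolutionE// /cconv.
have i : cintegrable mu setT (fun s : RT => F s * G (t - s)).
  have [M GM] := test_bounded tG.
  under eq_fun do rewrite mulrC.
  have mG : cmeas setT (fun s : RT => G (t - s)).
    apply: (cmeas_comp (phi := fun s : RT => t - s : RT) (test_cmeas tG)).
    exact: measurable_funB.
  exact: (cintegrable_bM (T := RT) measurableT mG (fun s _ => GM (t - s)) (test_cintegrable tF)).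
rewrite -(cIntZ (T := RT) measurableT _ i); apply: eq_cInt => s _.
have -> : - (t * l) = - (s * l) + - ((t - s) * l) by ring.
by rewrite expRD rcM; ring.
Qed.

Lemma laplaceJ F (l : R) : 0 <= l -> test_fun F ->
  laplace (fun t => (F t)^*) l%:C = (laplace F l%:C)^*.
Proof.
move=> l0 tF; rewrite !laplaceE//; last exact: testJ.
rewrite -(cIntJ (T := RT) measurableT (cintegrable_laplace l0 tF)).
by apply: eq_cInt => t _; rewrite conjcM conjcR.
Qed.

End convolution.

(** * The Hankel operator *)

Section main.
Context {R : realType}.
Local Notation mu := (@lebesgue_measure R).
Local Notation C := R[i].
Local Notation RT := (measurableTypeR R).

Let Gam (xi : R) : C := cGamma (2^-1 +i* xi).
Let rgker (t : R) : C := (gker (- t))%:C.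

(* [laplace f (exp (- x))], weighted so as to be square integrable in [x]. *)
Definition laplace_line (f : R -> C) (x : R) : C :=
  (expR (- x / 2))%:C * laplace f (expR (- x))%:C.

Lemma cintegrable_rgker : cintegrable mu setT rgker.
Proof.
have := cintegrable_affine 0 (or_intror erefl : -1 = 1 \/ -1 = -1 :> R) (@cintegrable_gker R).
by under eq_fun do rewrite addr0 mulN1r.
Qed.

Lemma cabs_rgker (t : R) : cabs (rgker t) <= 1.
Proof. by rewrite cabsC ger0_norm ?expR_ge0// le_gker1. Qed.

Lemma cInt_refl u : cmeas (setT : set RT) u -> cInt mu setT (refl u) = cInt mu setT u.
Proof.
move=> m; rewrite -(cInt_affine 0 (or_intror erefl : -1 = 1 \/ -1 = -1 :> R) m).
by apply: eq_cInt => x _; rewrite addr0 mulN1r.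
Qed.

Section one_test_function.
Variable f : R -> C.
Hypothesis tf : test_fun f.

Lemma cintegrable_Uop : cintegrable mu setT (Uop f) .
Proof.
have [M fM] := test_bounded tf; have [_ [a [b [a0 sf]]]] := tf.
have [L2U _] := L2_Uop (test_L2 tf).
have bd x : cabs (Uop f x) <= expR (ln b / 2) * M.
  rewrite /Uop cabsM cabsC ger0_norm ?expR_ge0//.
  have M0 : 0 <= M := le_trans (cabs_ge0 (f 0)) (fM 0).
  have [/andP[h1 h2]|/negP h] := boolP (a <= expR x <= b); last first.
    by rewrite sf// cabs0 mulr0 mulr_ge0// expR_ge0.
  rewrite ler_pM ?expR_ge0 ?cabs_ge0// ler_expR ler_pM2r//.
  by rewrite -(expRK x) ler_ln ?posrE ?expR_gt0// (lt_le_trans a0 (le_trans h1 h2)).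
have supp : supported_in (ln a) (ln b) (Uop f).
  move=> x nx; rewrite /Uop sf ?mulr0// => /andP[h1 h2]; apply: nx.
  have b0 : 0 < b := lt_le_trans a0 (le_trans h1 h2).
  by apply/andP; split; rewrite -(expRK x) ler_ln ?posrE ?expR_gt0.
by case: (bounded_support_cintegrable L2U supp bd).
Qed.

Lemma cintegrable_conv_slice (x : R) :
  cintegrable mu setT (fun y : RT => Uop f y * rgker (x - y)).
Proof.
under eq_fun do rewrite mulrC.
have m : cmeas setT (fun y : RT => rgker (x - y)).
  apply: (cmeas_comp (phi := fun y : RT => x - y : RT) cintegrable_rgker.1).
  exact: measurable_funB.
exact: (cintegrable_bM (T := RT) measurableT m (fun y _ => cabs_rgker (x - y)) cintegrable_Uop).
Qed.

(** After t = e^y the weights combine into e^{-x/2} e^y = e^{y/2} e^{(y-x)/2}, and the exponential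
    e^{-e^{y-x}} completes the kernel at y - x. *)
Lemma laplace_lineE : laplace_line f = cconv (Uop f) rgker.
Proof.
apply/funext => x; rewrite /laplace_line /laplace /cconv.
rewrite -[cintegral _ _]/(cInt mu Rpos _).
pose l := expR (- x).
have -> : cInt mu Rpos (fun t => cexp (- (t%:C * l%:C)) * f t) =
    cInt mu Rpos (fun t => (expR (- (t * l)))%:C * f t).
  apply: eq_cInt => t _; congr (_ * _); rewrite -cexpC; congr cexp.
  by apply: complexP => /=; ring.
rewrite cInt_expR; last first.
  have [m1 m2] := test_cmeas tf; apply: cmeasM; last by split; exact: measurable_funTS.
  apply: cmeas_real; apply: measurableT_comp => //; apply: measurableT_comp => //.
  exact: measurable_funM.
have E y : Uop f y * rgker (x - y) = (expR (- x / 2))%:C *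
    ((expR y)%:C * ((expR (- (expR y * l)))%:C * f (expR y))).
  rewrite /Uop /rgker /gker opprB /l -expRD.
  rewrite mulrAC -rcM -expRD !mulrA -!rcM -!expRD; congr ((expR _)%:C * _).
  by field.
rewrite -(cIntZ (T := RT) measurableT); first by apply: eq_cInt => y _; rewrite E.
have i := cintegrable_conv_slice x.
have -> : (fun y => (expR y)%:C * ((expR (- (expR y * l)))%:C * f (expR y))) =
    fun y => (expR (x / 2))%:C * (Uop f y * rgker (x - y)).
  apply/funext => y; rewrite E [RHS]mulrA -rcM -expRD (_ : x / 2 + - x / 2 = 0) ?expR0 ?mul1r//.
  by rewrite mulNr addrN.
exact: cintegrableZ.
Qed.

Lemma cintegrable_laplace_line : cintegrable mu setT (laplace_line f).
Proof.
rewrite laplace_lineE; have [i _] := cInt_conv cintegrable_Uop cintegrable_rgker.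
exact: i.
Qed.

(** An integrable function that is also bounded, here by the L^1 norm of [Uop f], since the kernel
    is at most 1. *)
Lemma L2_laplace_line : L2 setT (laplace_line f).
Proof.
apply: (bounded_L1_L2 (M := \int[mu]_x cabs (Uop f x)) cintegrable_laplace_line).
move=> x; rewrite laplace_lineE /cconv.
have i := cintegrable_conv_slice x.
apply: le_trans (le_cabs_cInt (T := RT) measurableT i) _.
apply: le_Rintegral => //; [exact: i.2|exact: cintegrable_Uop.2|].
by move=> y _; rewrite cabsM ler_piMr ?cabs_ge0// cabs_rgker.
Qed.

Lemma ft_laplace_line xi : ft (laplace_line f) xi = Gam xi * ft (Uop f) xi.
Proof.
rewrite /ft laplace_lineE mulrCA; congr (_ * _).
have i1 := cintegrable_cis (measurable_mulN xi) cintegrable_Uop.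
have i2 := cintegrable_cis (measurable_mulN xi) cintegrable_rgker.
have -> : Gam xi = cInt mu setT (fun x => rgker x * cis (- (x * xi))).
  rewrite /Gam cGamma_half.
  have m := (cintegrable_cis (measurable_mulN xi) cintegrable_rgker).1.
  rewrite -(cInt_affine 0 (or_intror erefl : -1 = 1 \/ -1 = -1 :> R) m).
  apply: eq_cInt => x _; rewrite addr0 mulN1r /rgker opprK; congr (_ * cis _); ring.
rewrite mulrC; have [_ <-] := cInt_conv i1 i2.
apply: eq_cInt => x _; rewrite /cconv.
have i := cintegrable_conv_slice x.
rewrite -(cIntZr (T := RT) measurableT _ i); apply: eq_cInt => y _.
have -> : cis (- (x * xi)) = cis (- (y * xi)) * cis (- ((x - y) * xi)).
  by rewrite -cisD; congr cis; ring.
by ring.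
Qed.

Lemma fourier_laplace_line :
  fourier (laplace_line f) = mulop (@vfun R) (bmellin f) %[ae mu in (setT : set RT)].
Proof.
have h1 := fourier_L1 L2_laplace_line cintegrable_laplace_line.
have h2 := fourier_L1 (L2_Uop (test_L2 tf)) cintegrable_Uop.
apply: ae_imply2 h1 h2 => xi /(_ I) e1 /(_ I) e2 _.
by rewrite e1 ft_laplace_line /mulop vfun_bmellin -e2.
Qed.

End one_test_function.

Lemma cmeas_vfun : cmeas (setT : set RT) (@vfun R).
Proof.
have -> : @vfun R = fun xi => (cabs (Gam xi))%:C.
  by apply/funext => xi; rewrite -cabs_cGamma_half.
by apply: cmeas_real; exact: measurable_cabs (@cmeas_cGamma_half R).
Qed.

Lemma Vop_bounded : bounded_operator setT setT (@Vop R).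
Proof.
(* The bound is Gamma(1/2): as [gker] is positive, |Gamma(1/2 + i xi)| is largest at xi = 0. *)
apply: (bounded_mulop meas_setT (K := \int[mu]_x gker x) cmeas_vfun).
apply: aeW => xi _; rewrite -cabs_cGamma_half cabsC ger0_norm ?cabs_ge0//.
rewrite cGamma_half.
have mxi : measurable_fun setT (fun x : R => xi * x) by exact: measurable_funM.
apply: le_trans (le_cabs_cInt (T := RT) measurableT (cintegrable_cis mxi (@cintegrable_gker R))) _.
apply: le_Rintegral => //.
- by have [] := cintegrable_cis mxi (@cintegrable_gker R).
- exact: integrable_gker.
- by move=> x _; rewrite cabsM cabs_cis mulr1 cabsC ger0_norm// expR_ge0.
Qed.

(** Needed because sigma is bounded only almost everywhere. The null set is transported through the
    norm of its indicator, which [Uop] and the reflection preserve; the weight they introduce is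
    positive, so the set can be recovered. *)
Lemma ae_exp_opp (P : R -> Prop) : {ae mu, forall x, Rpos x -> P x} ->
  {ae mu, forall x, P (expR (- x))}.
Proof.
move=> [N [mN N0 sub]]; pose f x : C := (\1_(N : set RT) x : R)%:C.
have mf : cmeas (setT : set RT) f by apply: cmeas_real; exact: measurable_indic.
have mfR : cmeas (@Rpos R : set RT) f by have [m1 m2] := mf; split; exact: measurable_funTS.
have f2 x : cabs (f x) ^+ 2 = \1_(N : set RT) x.
  by rewrite cabsC indicE; case: (_ \in _); rewrite /= ?normr1 ?normr0 ?expr1n ?expr0n.
have f0 : sqnorm2 Rpos f = 0%E.
  apply/eqP; rewrite eq_le sqnorm2_ge0 andbT /sqnorm2.
  under eq_integral do rewrite f2.
  rewrite integral_indic//; last exact: measurable_Rpos.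
  have : (mu (N `&` Rpos) <= mu N)%E.
    apply: le_measure; rewrite ?inE//; apply: measurableI => //; exact: measurable_Rpos.
  by rewrite N0.
have Lf : L2 Rpos f by split => //; rewrite f0.
have LU := L2_Uop Lf; have LR := L2_refl LU.
have : nrm2 setT (refl (Uop f)) = 0.
  apply: EFin_inj; rewrite -(sqnorm2E measurableT LR).
  by rewrite sqnorm2_refl ?sqnorm2_Uop//; exact: L2_cmeas LU.
move=> /(nrm2_eq0 measurableT LR); apply: ae_imply => x /(_ I).
move=> h; apply: contrapT => nP.
have xN : N (expR (- x)).
  by apply: sub => /= H; apply: nP; apply: H; rewrite /Rpos /= in_itv /= expR_gt0.
have := congr1 (@cabs R) h; rewrite /refl /Uop cabsM cabs0 /f !cabsC indicE mem_set//.
rewrite normr1 mulr1 (ger0_norm (expR_ge0 _)) => e0.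
by have := expR_gt0 (- x / 2); rewrite e0 ltxx.
Qed.

(** * The model operator and its quadratic form *)

Section symbol.
Variable sigma : R -> C.
Hypothesis Lsigma : Linfty Rpos sigma.

Let s x := sigma (expR (- x)).

Lemma cmeas_symbol : cmeas (setT : set RT) s.
Proof. exact: (cmeas_refl (cmeas_expR Lsigma.1)). Qed.

Lemma Sop_bounded : bounded_operator setT setT (Sop sigma).
Proof.
have [_ [K HK]] := Lsigma.
apply: (bounded_mulop meas_setT (K := K) cmeas_symbol).
by have := ae_exp_opp (P := fun t => cabs (sigma t) <= K) HK; apply: ae_imply.
Qed.

Lemma Aop_bounded : bounded_operator setT setT (Aop sigma).
Proof.
have U := @fourier_unitary R; have bF := unitary_bounded U.
have bF' := unitary_bounded (unitary_adjoint meas_setT meas_setT U).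
have c := @bounded_comp R setT setT setT meas_setT meas_setT.
exact: c Vop_bounded (c _ _ bF' (c _ _ Sop_bounded (c _ _ bF Vop_bounded))).
Qed.

(** The product is studied as an operator in its own right, so that its boundedness and its form
    also prove that a Hankel operator for [h] exists. *)
Definition hankel_model : @operator R :=
  adjoint Rpos setT bmellin \o Aop sigma \o bmellin.

Lemma hankel_model_bounded : bounded_operator Rpos Rpos hankel_model.
Proof.
have U := @bmellin_unitary R.
have bb := unitary_bounded U.
have bb' := unitary_bounded (unitary_adjoint meas_Rpos meas_setT U).
apply: (bounded_comp meas_Rpos meas_setT bb).
exact: (bounded_comp meas_setT meas_setT Aop_bounded bb').
Qed.

Lemma dotVop y b : dotL2 setT (@Vop R y) b = dotL2 setT y (Vop b).
Proof.
by apply: eq_cInt => x _; rewrite /Vop /mulop conjcM conjcR; ring.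
Qed.

(** The adjoint moves M onto f2 and V is self-adjoint, which leaves the inner product of Phi S Phi^*
    V M f1 with V M f2. Up to null sets each V M f is Phi G_f, so unitarity of Phi removes every
    transform. *)
Lemma hankel_model_form f1 f2 : test_fun f1 -> test_fun f2 ->
  dotL2 Rpos (hankel_model f1) f2 =
  cintegral Rpos (fun l => sigma l * (laplace f1 l%:C * (laplace f2 l%:C)^*)).
Proof.
move=> t1 t2; have L1 := test_L2 t1; have L2' := test_L2 t2.
have U := @bmellin_unitary R; have UF := @fourier_unitary R.
have Lb1 := L2_unitary U L1; have Lb2 := L2_unitary U L2'.
have [[LA _ _] _] := Aop_bounded; have LAb := LA _ Lb1.
have [Ladj _ adj] := adjoint_unitary meas_Rpos meas_setT U LAb.
have LG1 := L2_laplace_line t1; have LG2 := L2_laplace_line t2.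
have LFG1 := L2_fourier LG1; have LFG2 := L2_fourier LG2.
have [[LV _ _] _] := Vop_bounded; have LVb1 := LV _ Lb1; have LVb2 := LV _ Lb2.
have [[LS aeS _] _] := Sop_bounded.
have [Lw Fw _] := adjoint_unitary meas_setT meas_setT UF LVb1.
set w := adjoint setT setT fourier (Vop (bmellin f1)) in Lw Fw.
(* Phi is injective, and both functions have the image V M f1. *)
have wG : w = laplace_line f1 %[ae mu in setT].
  apply: (unitary_inj meas_setT meas_setT UF Lw LG1).
  apply: ae_eq_trans Fw _; apply: ae_eq_sym; exact: fourier_laplace_line.
have FSw : fourier (Sop sigma w) = fourier (Sop sigma (laplace_line f1)) %[ae mu in setT].
  by apply: fourier_ae; [exact: LS|exact: LS|exact: aeS].
transitivity (dotL2 setT (Aop sigma (bmellin f1)) (bmellin f2)).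
  rewrite (dotC measurable_Rpos L2' Ladj) -adj// -(dotC measurableT Lb2 LAb)//.
transitivity (dotL2 setT (fourier (Sop sigma w)) (Vop (bmellin f2))).
  exact: dotVop.
transitivity (dotL2 setT (fourier (Sop sigma (laplace_line f1))) (fourier (laplace_line f2))).
  exact: (ae_eq_dot measurableT (L2_fourier (LS _ Lw)) (L2_fourier (LS _ LG1)) LVb2 LFG2
    FSw (ae_eq_sym (fourier_laplace_line t2))).
rewrite (dot_unitary meas_setT meas_setT UF (LS _ LG1) LG2).
pose Psi x : C := Sop sigma (laplace_line f1) x * (laplace_line f2 x)^*.
have mPsi : cmeas (setT : set RT) Psi.
  exact: cmeasM (L2_cmeas (LS _ LG1)) (cmeasJ (L2_cmeas LG2)).
(* The integrand on (0, oo) expressed through [Psi], from which its measurability follows; the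
   factor 1/l cancels the weights of the two functions [laplace_line]. *)
pose phi l : C := (expR (- ln l))%:C * Psi (- ln l).
have phiE l : Rpos l -> sigma l * (laplace f1 l%:C * (laplace f2 l%:C)^*) = phi l.
  rewrite /Rpos /= in_itv /= andbT => l0.
  rewrite /phi /Psi /Sop /mulop /laplace_line !opprK lnK//.
  rewrite conjcM conjcR.
  have -> : (expR (- ln l))%:C = ((expR (ln l / 2) * expR (ln l / 2))^-1)%:C.
    by rewrite -expRD -splitr expRN.
  have : expR (ln l / 2) != 0 by rewrite gt_eqF// expR_gt0.
  move: (expR (ln l / 2)) (laplace f1 _) (laplace f2 _) (sigma l) => e a b c e0.
  transitivity ((((e * e)^-1 * (e * e))%:C) * (c * (a * b^*))).
    by rewrite mulVf ?mul1r// mulf_neq0.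
  by rewrite !rcM; ring.
have mphi : cmeas (@Rpos R : set RT) phi.
  have mln : measurable_fun (@Rpos R) (fun x : R => - ln x).
    by apply: measurableT_comp => //; apply: measurable_funTS; exact: measurable_ln.
  apply: cmeasM.
    by apply: cmeas_real; apply: measurableT_comp.
  have [m1 m2] := mPsi.
  by split; [exact: (measurableT_comp m1 mln)|exact: (measurableT_comp m2 mln)].
transitivity (cInt mu Rpos phi); last by apply: eq_cInt => l /phiE ->.
rewrite (cInt_expR mphi).
have -> : (fun x => (expR x)%:C * phi (expR x)) = refl Psi.
  apply/funext => x; rewrite /phi expRK mulrA -rcM -expRD addrN expR0 mul1r//.
by rewrite (cInt_refl mPsi).
Qed.

End symbol.

(** For a test function F near g, orthogonality gives |g|^2 = (g, g - F) <= |g| e. *)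
Lemma test_separates (g : R -> C) : L2 Rpos g ->
  (forall F, test_fun F -> dotL2 Rpos g F = 0) -> nrm Rpos g <= 0.
Proof.
move=> Lg H; apply: (@le0_eps _ 1) => // e e0; rewrite mul1r.
have [F tF gF] := test_dense Lg e0; have LF := test_L2 tF.
have LgF := L2B measurable_Rpos Lg LF.
have [n0|n0] := leP (nrm Rpos g) 0; first exact: le_trans n0 (ltW e0).
rewrite -(ler_pM2l n0) -expr2 sqr_nrm.
have E : (nrm2 Rpos g)%:C = dotL2 Rpos g (fun x => g x - F x).
  rewrite (dotBr measurable_Rpos Lg LF Lg) (H F tF) subr0.
  exact: (esym (dotff (measurable_Rpos (R := R)) g)).
have : cabs (nrm2 Rpos g)%:C <= nrm Rpos g * e.
  rewrite E; apply: le_trans (le_cabs_dot measurable_Rpos Lg LgF) _.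
  by rewrite ler_wpM2l// ltW.
by rewrite cabsC ger0_norm// nrm2_ge0.
Qed.

(** Varying f2 shows that the operators agree on each test function; density and the two operator
    bounds extend this to L^2. *)
Lemma bounded_test_eq (H H' : @operator R) :
  bounded_operator Rpos Rpos H -> bounded_operator Rpos Rpos H' ->
  (forall f1 f2, test_fun f1 -> test_fun f2 ->
    dotL2 Rpos (H f1) f2 = dotL2 Rpos (H' f1) f2) ->
  forall f, L2 Rpos f -> H f = H' f %[ae mu in Rpos].
Proof.
move=> [[LH aH linH] [K HK]] [[LH' aH' linH'] [K' HK']] eqH f Lf.
have mR := @measurable_Rpos R.
have Htest F : test_fun F -> nrm Rpos (fun x => H F x - H' F x) <= 0.
  move=> tF; have LF := test_L2 tF; apply: test_separates.
    by apply: L2B => //; [exact: LH|exact: LH'].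
  move=> G tG; rewrite (dotBl mR (LH _ LF) (LH' _ LF) (test_L2 tG)) eqH//.
  by rewrite subrr.
have bd (T : @operator R) (k : R) : linear_operator Rpos Rpos T ->
    (forall f, L2 Rpos f -> (sqnorm2 Rpos (T f) <= (k ^+ 2)%:E * sqnorm2 Rpos f)%E) ->
    forall u v, L2 Rpos u -> L2 Rpos v ->
      nrm Rpos (fun x => T u x - T v x) <= `|k| * nrm Rpos (fun x => u x - v x).
  move=> [LT _ linT] kT u v Lu Lv.
  have Luv : L2 Rpos (fun x => -1 * v x + u x) by apply: L2D => //; exact: L2Z.
  have LTuv : L2 Rpos (fun x => -1 * T v x + T u x).
    by apply: L2D => //; [apply: L2Z => //; exact: LT|exact: LT].
  have -> : (fun x => T u x - T v x) = fun x => -1 * T v x + T u x.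
    by apply/funext => x; rewrite mulN1r addrC.
  have -> : (fun x => u x - v x) = fun x => -1 * v x + u x.
    by apply/funext => x; rewrite mulN1r addrC.
  have e1 := ae_eq_nrm2 mR (LT _ Luv) LTuv (linT (-1) _ _ Lv Lu).
  rewrite /nrm -e1 -sqrtr_sqr -sqrtrM ?sqr_ge0// ler_wsqrtr//.
  by have := kT _ Luv; rewrite (sqnorm2E mR Luv) (sqnorm2E mR (LT _ Luv)) -EFinM lee_fin.
apply: (nrmB_le0 mR (LH _ Lf) (LH' _ Lf)).
apply: (@le0_eps _ (`|K| + `|K'|)); first by rewrite addr_ge0.
move=> e e0; have [F tF fF] := test_dense Lf e0; have LF := test_L2 tF.
have h1 := bd _ _ (And3 LH aH linH) HK _ _ Lf LF.
have h2 := bd _ _ (And3 LH' aH' linH') HK' _ _ Lf LF.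
have h3 := le_nrmB3 mR (LH _ Lf) (LH _ LF) (LH' _ Lf).
have h4 := le_nrmB3 mR (LH _ LF) (LH' _ LF) (LH' _ Lf).
rewrite (nrmB_sym _ (H' F)) in h4.
have h5 := Htest F tF.
apply: le_trans h3 _; rewrite mulrDl lerD//.
  by apply: le_trans h1 _; rewrite ler_wpM2l.
apply: le_trans h4 _; rewrite -[leRHS]add0r lerD//.
by apply: le_trans h2 _; rewrite ler_wpM2l.
Qed.

End main.

(** Boundedness is built into [hankel_operator], so the existence clause contains the boundedness
    asserted for H and keeps the last clause from being vacuous; [hankel_model sigma] is the
    witness. *)
Theorem theorem4p3 (R : realType)
    (h : (R -> R[i]) -> R[i]) (sg : (R[i] -> R[i]) -> R[i]) (sigma : R -> R[i]) :
  antilinear_distribution h -> sigma_function h sg -> represented_by sg sigma ->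
  [/\ unitary_operator Rpos setT (@bmellin R),
      exists H : @operator R, hankel_operator h H &
      forall H : @operator R, hankel_operator h H ->
        forall f : R -> R[i], L2 Rpos f ->
          H f = (adjoint Rpos setT bmellin \o Aop sigma \o bmellin) f
            %[ae (@lebesgue_measure R) in Rpos]].
Proof.
move=> _ [_ hsg] [Ls rep].
have form f1 f2 : test_fun f1 -> test_fun f2 ->
    dotL2 Rpos (hankel_model sigma f1) f2 = h (half_convolution (fun s => (f1 s)^*) f2).
  move=> t1 t2; have tc := test_half_convolution (testJ t1) t2.
  rewrite hsg// rep; last by exists (half_convolution (fun s => (f1 s)^*) f2).
  rewrite (hankel_model_form Ls t1 t2); apply: eq_cInt => l.
  rewrite /Rpos /= in_itv /= andbT => /ltW l0.
  (* The pairing conjugates the Laplace transform of the convolution, so the conjugate on f1 cancels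
     and the one on f2 remains. *)
  by rewrite (laplace_half_convolution l0 (testJ t1) t2) (laplaceJ l0 t1) conjcM conjCK.
have bm := hankel_model_bounded Ls.
split; first exact: bmellin_unitary.
- by exists (hankel_model sigma); split.
- move=> H [bH fH] f Lf; apply: (bounded_test_eq bH bm _ Lf) => f1 f2 t1 t2.
  by rewrite fH// form.
Qed.
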